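(* The space $H(\mathbb{C})$ of entire functions does not satisfy the Invariant Subset Property.
   Context: $H(\mathbb{C})$ is the Fréchet space of entire functions endowed with the norms $p_j(f)=\sup_{|z|\le j}|f(z)|$, $j\ge 1$. A continuous linear operator $T:X\to X$ on a Fréchet space $X$ possesses a non-trivial invariant subset if there exists a non-empty closed subset $M$ of $X$, different from $\{0\}$ and $X$, such that $TM\subset M$. The space $X$ satisfies the Invariant Subset Property if every continuous linear operator on $X$ possesses a non-trivial invariant subset. *)

(* Defs.v *)
From HB Require Import structures.
From mathcomp Require Import all_boot all_order all_algebra.
From mathcomp Require Import all_classical all_reals all_analysis.
From mathcomp Require Import complex.
Set Implicit Arguments.
Unset Strict Implicit.
Unset Printing Implicit Defensive.
Import Order.TTheory GRing.Theory Num.Theory.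
Import numFieldNormedType.Exports.
Import Normc.
Local Open Scope classical_set_scope.
Local Open Scope ring_scope.

Section invariant_subsets.
Context {K : numFieldType} (X : tvsType K).

Definition has_nontrivial_invariant_subset (T : X -> X) : Prop :=
  exists M : set X,
    [/\ M !=set0, closed M, M <> [set 0], M <> setT & T @` M `<=` M].

Definition invariant_subset_property : Prop :=
  forall T : {linear X -> X}, continuous T -> has_nontrivial_invariant_subset T.

End invariant_subsets.

Section entire_predicate.
Context {R : realType}.
Local Notation C := (R[i]^o).

(* The scalar field is R[i], so [derivable f z 1] is complex
   differentiability of f at z. *)
Definition entire : {pred C -> C} :=
  fun f => `[< forall z : C, derivable f z 1 >].

Fact entire_submod_closed : submod_closed entire.
Proof.
split=> [|a f g /asboolP hf /asboolP hg]; apply/asboolP => z.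
  exact: derivable_cst.
apply: derivableD => //; exact: derivableZ.
Qed.

HB.instance Definition _ :=
  GRing.isSubmodClosed.Build R[i] (C -> C) entire entire_submod_closed.

End entire_predicate.
Arguments entire : clear implicits.

Record entire_fun (R : realType) :=
  EntireFun { entire_val :> R[i]^o -> R[i]^o ; _ : entire_val \in entire R }.

HB.instance Definition _ (R : realType) := [isSub for @entire_val R].
HB.instance Definition _ (R : realType) := [Choice of entire_fun R by <:].
HB.instance Definition _ (R : realType) :=
  [SubChoice_isSubLmodule of entire_fun R by <:].

Section entire_seminorms.
Context {R : realType}.
Local Notation C := (R[i]^o).
Implicit Types (f g h : entire_fun R) (j n : nat) (e : R).

(* [normc] is the modulus with values in R; the norm `|z| of MathComp is the
   same number seen in R[i]. *)
Definition seminorm j f : R :=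
  sup [set normc (f z) | z in [set z : C | normc z <= j%:R]].

Definition seminorm_ball f n e : set (entire_fun R) :=
  [set g | forall j, (1 <= j <= n)%N -> seminorm j (f - g) < e].

Let normC (z : C) : `|z| = (normc z)%:C%C. Proof. by []. Qed.

Let normc_ge0 (z : C) : 0 <= normc z.
Proof. by case: z => a b; exact: sqrtr_ge0. Qed.

Let ltcR (a b : R) : (a%:C%C < b%:C%C :> R[i]) = (a < b).
Proof. by rewrite ltcE /= eqxx. Qed.

Let pos_real (e : R[i]) : 0 < e -> exists2 d : R, 0 < d & e = d%:C%C.
Proof.
case: e => d y; rewrite ltcE /= => /andP[/eqP -> d0]; exists d => //.
Qed.

Let entire_continuous f : continuous (f : C -> C).
Proof.
case: f => f /= /asboolP hf z.
by apply: differentiable_continuous; apply/derivable1_diffP; exact: hf.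
Qed.

Let normc_continuous : continuous (@normc R : C -> R).
Proof.
move=> z; apply/(@cvgrPdist_lt R R C (nbhs z) (nbhs_filter z)) => e e0.
have e0' : 0 < e%:C%C :> R[i] by rewrite ltcR.
near=> w.
have : `|z - w| < e%:C%C by near: w; apply: (@cvgr_dist_lt _ C _ (nbhs z) _ id).
rewrite normC ltcR; apply: le_lt_trans.
have D (a b : C) : normc a <= normc (a - b) + normc b.
  by rewrite -[in X in X <= _](subrK b a); exact: le_normcD.
rewrite ler_norml; apply/andP; split; last by rewrite lerBlDr; exact: D.
rewrite lerBrDr addrC lerBlDr; apply: (le_trans (D w z)).
by rewrite [leRHS]addrC -[z - w]opprB (@normcN R).
Unshelve. all: by end_near. Qed.

Let complex_continuous : continuous (fun x : R * R => (x.1 +i* x.2)%C : C).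
Proof.
move=> [x y]; apply/(@cvgrPdist_lt R[i] C (R * R)%type (nbhs (x, y)) (nbhs_filter (x, y))) => e' /pos_real[e e0 ->].
near=> u.
rewrite normC ltcR.
have -> : normc ((x +i* y)%C - (u.1 +i* u.2)%C : C)
          = normc ((x - u.1) +i* (y - u.2))%C by [].
have h1 : `|x - u.1| < e / 2.
  near: u; apply: (@cvgr_dist_lt _ _ _ (nbhs (x, y)) _ fst); last by rewrite divr_gt0.
  exact: cvg_fst.
have h2 : `|y - u.2| < e / 2.
  near: u; apply: (@cvgr_dist_lt _ _ _ (nbhs (x, y)) _ snd); last by rewrite divr_gt0.
  exact: cvg_snd.
apply: (@le_lt_trans _ _ (`|x - u.1| + `|y - u.2|)); last first.
  by rewrite [e]splitr ltrD.
rewrite /normc -[leRHS]ger0_norm ?addr_ge0// -sqrtr_sqr ler_sqrt ?sqr_ge0//.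
by rewrite [leRHS]sqrrD !real_normK ?num_real// [leRHS]addrAC lerDl mulrn_wge0//.
Unshelve. all: by end_near. Qed.

Fact seminorm_has_ubound j f :
  has_ubound [set normc (f z) | z in [set z : C | normc z <= j%:R]].
Proof.
pose g (x : R * R) : R := normc (f (x.1 +i* x.2)%C).
have cg : continuous g.
  move=> x; apply: (@continuous_comp _ _ _ (fun x : R * R => (x.1 +i* x.2)%C : C)
    ((@normc R : C -> R) \o f)); first exact: complex_continuous.
  apply: continuous_comp; [exact: entire_continuous|exact: normc_continuous].
have cK : compact (`[- (j%:R : R), j%:R] `*` `[- (j%:R : R), j%:R]).
  by apply: compact_setX; exact: segment_compact.
have : compact (g @` (`[- (j%:R : R), j%:R] `*` `[- (j%:R : R), j%:R])).
  by apply: continuous_compact => //; exact: continuous_subspaceT.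
move=> /(@compact_bounded R R)[M [_ hM]]; exists (M + 1).
move=> _ [[x y] /= xyj <-]; apply: le_trans (ler_norm _) _.
apply: (hM (M + 1)); first by rewrite ltrDl.
have hs (a b : R) : `|a| <= Num.sqrt (a ^+ 2 + b ^+ 2).
  by rewrite -sqrtr_sqr ler_sqrt ?addr_ge0 ?sqr_ge0// lerDl sqr_ge0.
exists (x, y) => //=; split; rewrite in_itv/= -ler_norml.
  exact: le_trans (hs x y) xyj.
by apply: le_trans xyj; rewrite addrC; exact: hs.
Qed.

Let normc0C : normc (0 : C) = 0.
Proof. exact: normc0. Qed.

Let disc0 j : normc (0 : C) <= j%:R.
Proof. by rewrite normc0C ler0n. Qed.

Let disc_image0 j f :
  [set normc (f z) | z in [set z : C | normc z <= j%:R]] !=set0.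
Proof. by exists (normc (f 0)), (0 : C); first exact: disc0. Qed.

Fact seminorm_ub j f (z : C) : normc z <= j%:R -> normc (f z) <= seminorm j f.
Proof. by move=> zj; apply: ub_le_sup (seminorm_has_ubound j f) _ _; exists z. Qed.

Fact seminorm_le j f (e : R) :
  (forall z : C, normc z <= j%:R -> normc (f z) <= e) -> seminorm j f <= e.
Proof. by move=> fe; apply: ge_sup => // _ [z zj <-]; exact: fe. Qed.

Fact seminorm_ge0 j f : 0 <= seminorm j f.
Proof.
apply: le_trans (normc_ge0 (f 0)) _; apply: seminorm_ub.
exact: disc0.
Qed.

Fact seminormD j f g : seminorm j (f + g) <= seminorm j f + seminorm j g.
Proof.
apply: seminorm_le => z zj; apply: le_trans (le_normcD _ _) _.
by rewrite lerD// seminorm_ub.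
Qed.

Fact seminormZ j (a : R[i]) f : seminorm j (a *: f) <= normc a * seminorm j f.
Proof.
apply: seminorm_le => z zj.
have -> : normc ((a *: f) z) = normc a * normc (f z) by rewrite -normcM.
by rewrite ler_wpM2l ?seminorm_ub//; exact: (normc_ge0 a).
Qed.

Fact seminorm0 j : seminorm j 0 = 0.
Proof.
apply/eqP; rewrite eq_le seminorm_ge0 andbT; apply: seminorm_le => z _.
by rewrite [leLHS]normc0C.
Qed.

Fact seminormN j f : seminorm j (- f) = seminorm j f.
Proof.
have N1 : normc (-1 : R[i]) = 1 by rewrite (@normcN R) normc1.
have H h : seminorm j (- h) <= seminorm j h.
  by rewrite -scaleN1r; apply: le_trans (seminormZ _ _ _) _; rewrite N1 mul1r.
by apply/eqP; rewrite eq_le H -[in X in X <= _](opprK f) H.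
Qed.

Fact seminorm_ball_center f n e : 0 < e -> seminorm_ball f n e f.
Proof. by move=> e0 j _; rewrite subrr seminorm0. Qed.

Fact seminorm_ballS f n m e d : (m <= n)%N -> e <= d ->
  seminorm_ball f n e `<=` seminorm_ball f m d.
Proof.
move=> mn ed g fg j /andP[j1 jm]; apply: lt_le_trans ed.
by apply: fg; rewrite j1 (leq_trans jm).
Qed.

Fact seminorm_ball_open f n e g : seminorm_ball f n e g ->
  exists2 d, 0 < d & seminorm_ball g n d `<=` seminorm_ball f n e.
Proof.
elim: n => [|n IH] fg.
  by exists 1 => // h _ j /andP[/leq_trans /[apply]].
have [d d0 dP] := IH (seminorm_ballS (leqnSn n) (lexx e) fg).
have en : 0 < e - seminorm n.+1 (f - g).
  by rewrite subr_gt0; apply: fg; rewrite leqnn.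
exists (Num.min d (e - seminorm n.+1 (f - g))); first by rewrite lt_min d0.
move=> h gh j /andP[j1]; rewrite leq_eqVlt => /predU1P[->|jn].
  rewrite -(subrKA g) (le_lt_trans (seminormD _ _ _))// addrC -ltrBrDr.
  apply: lt_le_trans (gh n.+1 _) _; first by rewrite leqnn.
  by rewrite ge_min lexx orbT.
apply: dP; last by rewrite j1.
by apply: seminorm_ballS gh => //; rewrite ge_min lexx.
Qed.

End entire_seminorms.

Section entire_topology.
Context {R : realType}.
Local Notation E := (entire_fun R).
Local Notation C := (R[i]^o).

Definition entire_nbhs (f : E) : set_system E :=
  filter_from [set ne : nat * R | 0 < ne.2]
    (fun ne => seminorm_ball f ne.1 ne.2).

HB.instance Definition _ := hasNbhs.Build E entire_nbhs.

Let entire_nbhs_filter (f : E) : ProperFilter (nbhs f).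
Proof.
apply: filter_from_proper; last first.
  by move=> [n e] /= e0; exists f; exact: seminorm_ball_center.
apply: filter_from_filter; first by exists (0%N, 1) => /=.
move=> [n e] [m d] /= e0 d0; exists (maxn n m, Num.min e d) => /=.
  by rewrite lt_min e0.
rewrite subsetI; split; apply: seminorm_ballS.
- exact: leq_maxl.
- by rewrite ge_min lexx.
- exact: leq_maxr.
- by rewrite ge_min lexx orbT.
Qed.

Let entire_nbhs_singleton (f : E) (A : set E) : nbhs f A -> A f.
Proof. by move=> [[n e] /= e0]; apply; exact: seminorm_ball_center. Qed.

Let entire_nbhs_nbhs (f : E) (A : set E) : nbhs f A -> nbhs f (nbhs^~ A).
Proof.
move=> [[n e] /= e0 fA]; exists (n, e) => //= g /seminorm_ball_open[d d0 gd].
by exists (n, d) => //; exact: subset_trans fA.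
Qed.

HB.instance Definition _ := Nbhs_isNbhsTopological.Build E
  entire_nbhs_filter entire_nbhs_singleton entire_nbhs_nbhs.

Let entire_add_continuous : continuous (fun x : E * E => x.1 + x.2).
Proof.
move=> [f g] A [[n e] /= e0 fgA].
exists (seminorm_ball f n (e / 2), seminorm_ball g n (e / 2)).
  by split; exists (n, e / 2) => //=; rewrite divr_gt0.
move=> [f' g'] /= [ff gg]; apply: fgA => j jn /=.
rewrite opprD addrACA [e]splitr; apply: le_lt_trans (seminormD _ _ _) _.
by rewrite ltrD//; [exact: ff|exact: gg].
Qed.

Let entire_scale_continuous : continuous (fun z : C * E => z.1 *: z.2).
Proof.
move=> [a f] A [[n e] /= e0 fA].
pose P := \sum_(j < n.+1) seminorm j f.
have P0 : 0 <= P by apply: sumr_ge0 => j _; exact: seminorm_ge0.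
have a0 : 0 <= normc a by case: (a) => x y; exact: sqrtr_ge0.
pose S := P + normc a + 2.
have S0 : 0 < S by rewrite ltr_wpDl// addr_ge0.
pose d := Num.min 1 (e / S).
have d0 : 0 < d by rewrite lt_min ltr01 divr_gt0.
have d1 : d <= 1 by rewrite ge_min lexx.
have dS : d * S <= e by rewrite -ler_pdivlMr// ge_min lexx orbT.
exists ([set b : C | `|a - b| < d%:C%C], seminorm_ball f n d).
  split; last by exists (n, d).
  by apply: (@cvgr_dist_lt _ C _ (nbhs a) _ id) => //; rewrite ltcE/= eqxx.
move=> [b g] /= [ab fg]; apply: fA => j /[dup] jn /fg fgj /=.
have {}ab : normc (a - b) < d by move: ab; rewrite ltcE => /andP[].
have c0 : 0 <= normc (a - b) by case: (a - b) => x y; exact: sqrtr_ge0.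
have -> : a *: f - b *: g = (a - b) *: f + a *: (f - g) - (a - b) *: (f - g).
  by rewrite [(a - b) *: (f - g)]scalerBl opprB -addrA [_ + (_ - _)]addrC subrK
             scalerBl scalerBr subrKA.
have jP : seminorm j f <= P.
  have jn1 : (j < n.+1)%N by case/andP: jn.
  rewrite /P (bigD1 (Ordinal jn1))//= lerDl.
  by apply: sumr_ge0 => i _; exact: seminorm_ge0.
apply: lt_le_trans dS.
apply: le_lt_trans (seminormD _ _ _) _; rewrite seminormN.
apply: (@le_lt_trans _ _ (d * P + normc a * d + d * 1)).
  apply: lerD; first (apply: le_trans (seminormD _ _ _) _; apply: lerD).
  - apply: le_trans (seminormZ _ _ _) _.
    by apply: ler_pM => //; [exact: seminorm_ge0|exact: ltW].
  - by apply: le_trans (seminormZ _ _ _) _; rewrite ler_wpM2l// ltW.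
  - apply: le_trans (seminormZ _ _ _) _.
    by apply: ler_pM => //; [exact: seminorm_ge0|exact: ltW|
                             exact: le_trans (ltW fgj) d1].
rewrite [normc a * _]mulrC -!mulrDr ltr_pM2l// /S ltrD2l ltr1n//.
Qed.

Let entire_locally_convex : exists2 B : set_system E,
  (forall b, b \in B -> convex_set b) & basis B.
Proof.
exists [set seminorm_ball f ne.1 ne.2 | f in setT & ne in [set: nat * R]].
  move=> _ /set_mem[f _ [[n e] _ <-]] g h t /set_mem fg /set_mem fh.
  apply/mem_set => j jn /=.
  have t0 : 0 <= t%:num :> R[i] by [].
  have t1 : t%:num <= 1 :> R[i] by [].
  have -> : f - (t%:num *: g + (1 - t%:num) *: h)
          = t%:num *: (f - g) + (1 - t%:num) *: (f - h) :> E.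
    by rewrite !scalerBr addrACA -scalerDl [t%:num + _]addrC subrK scale1r opprD.
  have nt : t%:num = (normc t%:num)%:C%C by rewrite -[LHS]ger0_norm.
  have nt1 : 1 - t%:num = (normc (1 - t%:num))%:C%C.
    by rewrite -[LHS]ger0_norm ?subr_ge0.
  have s0 : 0 <= normc t%:num by case: (t%:num) => x y; exact: sqrtr_ge0.
  have s0' : 0 <= normc (1 - t%:num).
    by case: (1 - t%:num) => x y; exact: sqrtr_ge0.
  have s1 : normc t%:num + normc (1 - t%:num) = 1.
    apply: (@complexI R); rewrite rmorphD/= -nt -nt1 addrC subrK//.
  pose m := Num.max (seminorm j (f - g)) (seminorm j (f - h)).
  have me : m < e by rewrite gt_max fg// fh.
  apply: le_lt_trans me; apply: le_trans (seminormD _ _ _) _.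
  rewrite -[m]mul1r -s1 mulrDl; apply: lerD.
    by apply: le_trans (seminormZ _ _ _) _; rewrite ler_wpM2l// le_max lexx.
  by apply: le_trans (seminormZ _ _ _) _; rewrite ler_wpM2l// le_max lexx orbT.
split.
  move=> _ [f _ [[n e] _ <-]]; rewrite openE => g /seminorm_ball_open[d d0 gd].
  by exists (n, d).
move=> f A [[n e] /= e0 fA]; exists (seminorm_ball f n e) => //.
split; last exact: seminorm_ball_center.
by exists f => //; exists (n, e).
Qed.

HB.instance Definition _ :=
  PreTopologicalNmodule_isTopologicalNmodule.Build E entire_add_continuous.
HB.instance Definition _ :=
  TopologicalNmodule_isTopologicalLmodule.Build R[i] E entire_scale_continuous.
(* This factory only provides the uniform structure. *)
HB.instance Definition _ := PreTopologicalLmod_isTvs.Build R[i] E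
  entire_add_continuous entire_scale_continuous entire_locally_convex.
HB.instance Definition _ := Uniform_isTvs.Build R[i] E entire_locally_convex.

End entire_topology.

(* Main.v *)
Require Import Defs.
From HB Require Import structures.
From mathcomp Require Import all_boot all_order all_algebra.
From mathcomp Require Import all_classical all_reals all_analysis.
From mathcomp Require Import complex.
From mathcomp Require Import zify ring lra.
Set Implicit Arguments.
Unset Strict Implicit.
Unset Printing Implicit Defensive.
Import Order.TTheory GRing.Theory Num.Theory.
Import numFieldNormedType.Exports.
Import Normc.
Local Open Scope classical_set_scope.
Local Open Scope ring_scope.

(** A continuous linear operator is constructed under which every nonzero
    entire function has a dense orbit, after C. Read's operators without
    invariant subsets.  A closed invariant set other than {0} contains a nonzero
    f, hence the orbit of f, hence everything ([read_op_no_invariant]).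

    Entire functions are handled through their Taylor coefficients x, which are
    the sequences such that |x_n| 2^(jn) is bounded for every j.  Entire means
    complex differentiable at every point, so this rests on Cauchy's theory:
    Goursat's theorem on rectangles ([goursat]), Cauchy's formula on a square
    ([cauchy_formula]), the resulting Taylor expansion with its error bound
    ([taylor]), and the converse that rapidly decreasing coefficients define an
    entire function ([psum_holo]).

    The operator.  Let p be a sequence of polynomials, p_n of degree n, and let
    the coordinates of a polynomial in the basis p be regarded as the Taylor
    coefficients of another polynomial.  Multiplication by X then becomes an
    operator T on polynomials, and with the norms |sum a_n p_n|_j =
    sum |a_n| 2^(jn) it extends continuously to entire functions as soon as
    |X p_n|_j is at most exponential in n ([read_op]).  The point is to choose p
    such that ([read_basis]), for every rapidly decreasing x different from 0,
    every target g and every J, there are arbitrarily large N and some c with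

    - X^c (sum of x_n p_n over n <= N) close to g in the norm J, and
    - |X^c p_n|_J <= 2 2^((3J+4)n) for n > N.

    The first property makes T^c map a Taylor polynomial of f close to the
    target, and the second keeps the image of the remaining tail small, since
    the coefficients of f decrease faster than any geometric sequence
    ([read_op_orbit]).

    Blocks.  The basis is built by successive blocks.  Once p_0, ..., p_N are
    chosen, a block belongs to a polynomial q and a huge number k, and fixes p_n
    up to n = (J+3)k + N.  For n = rk + s with r >= 1 and s <= N it puts
    p_n = 2^((J+1)k) (X^n - q X^(n-k)); as p_n has norm 2^(jn), this forces X^k
    to act like q on polynomials of degree at most N, with a tiny error
    ([pnorm_window_diff]).  The other p_n are multiples of X^n, by powers of 2
    for which X stays bounded ([small_shift_step]) and X^k, with a few more
    factors X, costs at most the factor allowed above ([large_shift_step]).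

    Rounds.  Write y for the sum of x_n p_n over n <= N1.  A round ([round])
    consists of a block with q = g, so that X^a is close to g; a block with q a
    large constant 2^b', so that 2^-b' X^b is close to the identity in low
    degrees, kills higher monomials and is small on the tail; and blocks with
    q = 2^-b' X^(b+a-N) r for r in a finite set F.  The set F contains, for every
    y that can occur, an approximate inverse r with r y close to X^N modulo a
    high power of X ([finite_cover]).  This is compactness, applicable because
    the low coefficients of y cannot all be small ([initial_lower_bound]).  For
    the right r, and c the number k of its block, X^c y is close to
    2^-b' X^b X^(a-N) r y, then to X^(a-N) X^N = X^a, then to g.  Countably many
    rounds, each kind repeated infinitely often, serve all x, g and J. *)

(** * Primitives of continuous real functions *)

Section primitives.
Context {R : realType}.
Implicit Types (f F h : R -> R).

Lemma is_derive_near f F (df t : R) (U : set R) : nbhs t U ->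
  (forall y, U y -> f y = F y) -> is_derive t 1 F df -> is_derive t 1 f df.
Proof.
move=> Ut fF dF; apply: (@near_eq_is_derive _ _ _ F) => //.
by near=> y; rewrite fF//; near: y.
Unshelve. all: by end_near. Qed.

Lemma primitive_right f (a : R) : continuous f ->
  exists F, forall t, a < t -> is_derive t 1 F (f t).
Proof.
move=> cf; exists (fun x => (\int[lebesgue_measure]_(t in `[a, x]) (f t))%R) => t at_.
have tu : t < t + 1 by rewrite ltrDl.
have int : lebesgue_measure.-integrable `[a, t + 1] (EFin \o f).
  apply: continuous_compact_integrable; first exact: segment_compact.
  exact: continuous_subspaceT.
have [dF <-] := @continuous_FTC1_closed R f a t (t + 1) tu int at_ (cf t).
by rewrite derive1E; apply: derivableP.
Qed.

(** The integral of f from a fixed point has derivative f to the right of that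
    point. The left half-line is treated by the reflection t -> -t, and on the
    overlap of the two half-lines the two primitives differ by a constant. *)
Lemma primitive_exists f : continuous f ->
  exists F, forall t : R, is_derive t 1 F (f t).
Proof.
move=> cf.
have [A dA] := @primitive_right f (-1) cf.
have cfN : continuous (fun t => f (- t)).
  by move=> t; apply: continuous_comp; [exact: opp_continuous | exact: cf].
have [B dB] := @primitive_right _ (-1) cfN.
pose B' x := - B (- x).
have dB' (t : R) : t < 1 -> is_derive t 1 B' (f t).
  move=> t1; have /dB dBt : -1 < - t by rewrite ltrN2.
  have -> : B' = - (B \o -%R) by [].
  have -> : f t = - - f t by rewrite opprK.
  apply: is_deriveN.
  have dN : is_derive t 1 (-%R : R -> R) (-1) by exact: is_deriveN.
  apply: (is_derive_eq (is_derive1_comp dBt dN)).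
  by rewrite !opprK mulrN1.
have AB x : -1 < x < 1 -> A x - A 0 = B' x - B' 0.
  move=> /andP[x1 x2].
  have key u v : u <= v -> -1 < u -> v < 1 -> A u - B' u = A v - B' v.
    move=> uv u1 v1.
    have dAB (t : R) : -1 < t -> t < 1 -> is_derive t 1 (A - B') 0.
      move=> t1 t2; have := dA _ t1; have := dB' _ t2 => hB hA.
      by rewrite -(subrr (f t)); exact: is_deriveB.
    have h1 : forall t : R, t \in `]u, v[%R -> is_derive t 1 (A - B') 0.
      by move=> t; rewrite in_itv/= => /andP[ut tv]; apply: dAB; [exact: lt_trans ut|exact: lt_trans v1].
    have h2 : {within `[u, v], continuous (A - B')}.
      apply: derivable_within_continuous => t; rewrite in_itv/= => /andP[ut tv].
      by have [] := dAB t (lt_le_trans u1 ut) (le_lt_trans tv v1).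
    have [c _] := @MVT_segment R (A - B') (cst 0) u v uv h1 h2.
    by rewrite mul0r => /eqP; rewrite subr_eq0 => /eqP h; exact: esym h.
  have : A x - B' x = A 0 - B' 0.
    have [x0|x0] := leP x 0; first by apply: key; lra.
    by apply/esym; apply: key; lra.
  by lra.
exists (fun x => if 0 <= x then A x - A 0 else B' x - B' 0) => t.
have [t0|t0] := ltP (-1/2) t.
  apply: (@is_derive_near _ (fun x => A x - A 0) _ _ [set y | -1/2 < y]).
  - exact: lt_nbhsr.
  - move=> y /= y1; case: leP => // y0; rewrite AB//; lra.
  - rewrite -(subr0 (f t)).
    apply: is_deriveB; apply: dA; lra.
apply: (@is_derive_near _ (fun x => B' x - B' 0) _ _ [set y | y < 0]).
- by apply: lt_nbhsl; lra.
- by move=> y /= y0; rewrite leNgt y0.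
- rewrite -(subr0 (f t)).
  apply: is_deriveB; apply: dB'; lra.
Qed.

Lemma derivative_mean F f (a b m M : R) : a <= b ->
  (forall t : R, is_derive t 1 F (f t)) -> (forall t, a <= t <= b -> m <= f t <= M) ->
  m * (b - a) <= F b - F a <= M * (b - a).
Proof.
move=> ab dF fM.
have cF : {within `[a, b], continuous F}.
  by apply: derivable_within_continuous => t _; have [] := dF t.
have dF' : forall t : R, t \in `]a, b[%R -> is_derive t 1 F (f t) by [].
have [c] := MVT_segment ab dF' cF.
rewrite in_itv/= => cab ->.
by have /andP[h1 h2] := fM c cab; rewrite !ler_wpM2r ?subr_ge0.
Qed.

End primitives.

(** * Complex differentiation and integration along lines *)

Section complex_lines.
Context {R : realType}.
Local Notation C := (R[i]).
Implicit Types (f g F : C -> C) (z w u : C) (h H : R -> C) (a b c d t : R).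

Lemma normc_ge0 z : 0 <= normc z.
Proof. by case: z => x y; exact: sqrtr_ge0. Qed.

Lemma normc_real t : normc (t%:C%C) = `|t|.
Proof. by rewrite /normc /= expr0n addr0 sqrtr_sqr. Qed.

Lemma normc_eq0 z : (normc z == 0) = (z == 0).
Proof. by apply/eqP/eqP => [/eq0_normc//|->]; exact: normc0. Qed.

Lemma normc_gt0 z : (0 < normc z) = (z != 0).
Proof. by rewrite lt_def normc_ge0 andbT normc_eq0. Qed.

Lemma Re_le_normc z : `|complex.Re z| <= normc z.
Proof.
case: z => x y /=; rewrite -sqrtr_sqr ler_sqrt ?addr_ge0 ?sqr_ge0//.
by rewrite lerDl sqr_ge0.
Qed.

Lemma Im_le_normc z : `|complex.Im z| <= normc z.
Proof.
case: z => x y /=; rewrite -sqrtr_sqr ler_sqrt ?addr_ge0 ?sqr_ge0//.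
by rewrite lerDr sqr_ge0.
Qed.

Lemma normc_le_ReIm z : normc z <= `|complex.Re z| + `|complex.Im z|.
Proof.
case: z => x y /=; rewrite -[leRHS]ger0_norm ?addr_ge0// -sqrtr_sqr.
rewrite ler_sqrt ?sqr_ge0// sqrrD !real_normK ?num_real//.
by rewrite addrAC lerDl mulrn_wge0 ?mulr_ge0.
Qed.

Lemma normcX z n : normc (z ^+ n) = normc z ^+ n.
Proof. by elim: n => [|n IH]; rewrite ?expr0 ?normc1// !exprS normcM IH. Qed.

Lemma normc_sum (I : Type) (s : seq I) (P : pred I) (G : I -> C) :
  normc (\sum_(i <- s | P i) G i) <= \sum_(i <- s | P i) normc (G i).
Proof.
elim/big_rec2 : _ => [|i x y _ IH]; first by rewrite normc0.
by apply: le_trans (le_normcD _ _) _; rewrite lerD2l.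
Qed.

Lemma normcB z w : normc (z - w) = normc (w - z).
Proof. by rewrite -normcN opprB. Qed.

(** Continuity and complex differentiability with the real-valued modulus,
    which suits the estimates below; [derivable_cderiv] and [cderiv_derivable]
    relate them to derivability. *)
Definition ccont f z := forall e, 0 < e ->
  exists2 d, 0 < d & forall w, normc (w - z) < d -> normc (f w - f z) <= e.

Definition cderiv f z (l : C) := forall e, 0 < e ->
  exists2 d, 0 < d &
    forall w, normc (w - z) < d -> normc (f w - f z - l * (w - z)) <= e * normc (w - z).

Lemma is_derive_eps (phi : R -> R) t (l : R) :
  (forall e, 0 < e -> exists2 d, 0 < d &
    forall s, `|s - t| < d -> `|phi s - phi t - l * (s - t)| <= e * `|s - t|) ->
  is_derive t 1 phi l.
Proof.
move=> H.
have cv : h^-1 *: ((phi \o shift t) (h *: 1) - phi t) @[h --> 0^'] --> l.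
  apply/cvgrPdist_le => /= e e0; have [d d0 dP] := H e e0.
  near=> h.
  have h0 : h != 0 by near: h; exact: nbhs_dnbhs_neq.
  have := dP (h + t); rewrite addrK => /(_ _)/wrap[].
    by near: h; apply: dnbhs0_lt.
  rewrite /GRing.scale/= mulr1 => hP.
  rewrite -(ler_pM2r (_ : 0 < `|h|)) ?normr_gt0// -normrM mulrBl.
  by rewrite mulrAC mulVf// mul1r distrC.
by apply: DeriveDef; [exact: cvgP cv|exact: cvg_lim].
Unshelve. all: by end_near. Qed.

Definition line z u t : C := z + t%:C%C * u.

Definition rcont h :=
  continuous (fun t => complex.Re (h t)) /\ continuous (fun t => complex.Im (h t)).

Definition cprim H h := forall t : R,
  is_derive t 1 (fun t => complex.Re (H t)) (complex.Re (h t)) /\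
  is_derive t 1 (fun t => complex.Im (H t)) (complex.Im (h t)).

Lemma line_dist z u t s : normc (line z u s - line z u t) = `|s - t| * normc u.
Proof.
rewrite /line opprD addrACA subrr add0r -mulrBl normcM -normc_real.
by rewrite -[(s - t)%:C%C]/(real_complex R (s - t)) rmorphB.
Qed.

Lemma ReB z w : complex.Re (z - w) = complex.Re z - complex.Re w.
Proof. by case: z w => [x y] [x' y']. Qed.

Lemma ImB z w : complex.Im (z - w) = complex.Im z - complex.Im w.
Proof. by case: z w => [x y] [x' y']. Qed.

Lemma ReD z w : complex.Re (z + w) = complex.Re z + complex.Re w.
Proof. by case: z w => [x y] [x' y']. Qed.

Lemma ImD z w : complex.Im (z + w) = complex.Im z + complex.Im w.
Proof. by case: z w => [x y] [x' y']. Qed.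

Lemma rcont_line f z u : normc u = 1 -> (forall t, ccont f (line z u t)) ->
  rcont (fun t => f (line z u t)).
Proof.
move=> u1 cf.
have H (p : C -> R) : (forall x y, `|p x - p y| <= normc (x - y)) ->
    continuous (fun t => p (f (line z u t))).
  move=> pP t; apply/(@cvgrPdist_le _ R^o) => /= e e0; have [d d0 dP] := cf t e e0.
  near=> s; apply: le_trans (pP _ _) _; rewrite normcB; apply: dP.
  rewrite line_dist u1 mulr1 distrC; near: s.
  exact: (@cvgr_dist_lt _ R^o _ (nbhs t) _ id).
split; apply: H => x y; first by rewrite -ReB; exact: Re_le_normc.
by rewrite -ImB; exact: Im_le_normc.
Unshelve. all: by end_near. Qed.

Lemma cprim_line F f z u : normc u = 1 ->
  (forall t, cderiv F (line z u t) (f (line z u t))) ->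
  cprim (fun t => F (line z u t)) (fun t => f (line z u t) * u).
Proof.
move=> u1 dF t.
have H (p : C -> R) : (forall x, `|p x| <= normc x) ->
    (forall x y, p (x - y) = p x - p y) ->
    (forall x (s : R), p (x * s%:C%C) = p x * s) ->
    is_derive t 1 (fun t => p (F (line z u t))) (p (f (line z u t) * u)).
  move=> pn pB pZ; apply: is_derive_eps => e e0; have [d d0 dP] := dF t e e0.
  exists d => // s st; rewrite -pZ -!pB.
  apply: le_trans (pn _) _.
  have E : line z u s - line z u t = u * (s - t)%:C%C.
    by rewrite /line opprD addrACA subrr add0r -mulrBl -rmorphB mulrC.
  have := dP (line z u s); rewrite line_dist u1 mulr1 => /(_ st).
  by rewrite E mulrA.
split; apply: H.
- exact: Re_le_normc.
- exact: ReB.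
- by case=> x y s /=; rewrite mulr0 subr0.
- exact: Im_le_normc.
- exact: ImB.
- by case=> x y s /=; rewrite mulr0 add0r.
Qed.

End complex_lines.

Section integrals.
Context {R : realType}.
Local Notation C := (R[i]).
Implicit Types (f g F : C -> C) (z w u l : C) (h H : R -> C) (a b c d t : R).

Lemma normC_normc z : `|z| = (normc z)%:C%C. Proof. by []. Qed.

Lemma derivable_cderiv (f : R[i]^o -> R[i]^o) (z : R[i]^o) :
  derivable f z 1 -> cderiv f z ('D_1 f z).
Proof.
move=> df e e0.
have cv : (fun h : R[i]^o => h^-1 *: ((f \o shift z) (h *: 1) - f z)) @ 0^' --> 'D_1 f z by [].
have e0' : 0 < e%:C%C :> R[i] by rewrite ltcR.
move/(@cvgrPdist_le _ R[i]^o) : cv => /(_ _ e0').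
case=> /= d' d0' dP.
have [d d0 d'E] : exists2 d : R, 0 < d & d' = d%:C%C.
  by case: d' d0' {dP} => d y; rewrite ltcE /= => /andP[/eqP -> d0]; exists d.
exists d => // w wz.
have [->|wzN] := eqVneq w z; first by rewrite !subrr mulr0 subrr normc0 mulr0.
have h0 : w - z != 0 by rewrite subr_eq0.
have := dP (w - z); rewrite /= sub0r normrN d'E normC_normc ltcR => /(_ wz h0).
rewrite /GRing.scale/= mulr1 subrK normC_normc lecR => H.
rewrite -(ler_pM2r (_ : 0 < normc (w - z))) ?normc_gt0// in H.
rewrite -normcM mulrBl mulrAC mulVf// mul1r normcB in H.
exact: H.
Qed.

Lemma cderiv_derivable (f : R[i]^o -> R[i]^o) (z : R[i]^o) l :
  cderiv f z l -> is_derive z 1 f l.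
Proof.
move=> H.
have cv : (fun h : R[i]^o => h^-1 *: ((f \o shift z) (h *: 1) - f z)) @ 0^' --> (l : R[i]^o).
  apply/(@cvgrPdist_le _ R[i]^o) => /= e' e0'.
  have [e e0 ->] : exists2 d : R, 0 < d & e' = d%:C%C.
    by case: e' e0' => d y; rewrite ltcE /= => /andP[/eqP -> d0]; exists d.
  have [d d0 dP] := H e e0.
  have d0' : 0 < d%:C%C :> R[i] by rewrite ltcR.
  near=> h.
  have h0 : h != 0 by near: h; exact: nbhs_dnbhs_neq.
  have hd : normc h < d.
    have : `|h| < d%:C%C by near: h; exact: dnbhs0_lt.
    by rewrite normC_normc ltcR.
  have := dP (h + z); rewrite addrK => /(_ hd) hP.
  rewrite /GRing.scale/= mulr1 normC_normc lecR.
  rewrite -(ler_pM2r (_ : 0 < normc h)) ?normc_gt0// -normcM mulrBl.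
  by rewrite mulrAC mulVf// mul1r normcB.
by apply: DeriveDef; [exact: cvgP cv|exact: cvg_lim].
Unshelve. all: by end_near. Qed.

Lemma cderiv_ccont f z l : cderiv f z l -> ccont f z.
Proof.
move=> df e e0; have [d d0 dP] := df 1 ltr01.
have L0 : 0 < 1 + normc l by rewrite ltr_pwDl// normc_ge0.
exists (Num.min d (e / (1 + normc l))); first by rewrite lt_min d0 divr_gt0.
move=> w; rewrite lt_min => /andP[wd we].
rewrite -(subrK (l * (w - z)) (f w - f z)).
apply: le_trans (le_normcD _ _) _.
apply: le_trans (lerD (dP w wd) (lexx _)) _.
by rewrite normcM -mulrDl mulrC -ler_pdivlMr// ltW.
Qed.

(** The integral of a complex function of a real variable, as a difference of
    values of a primitive: additivity in the interval and the fundamental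
    theorem hold by construction, and continuous integrands have primitives by
    [cprim_exists]. *)
Definition cint h a b : C :=
  if pselect (exists H, cprim H h) is left p
  then let H := projT1 (cid p) in H b - H a else 0.

Lemma cprim_unique H H' h a b : cprim H h -> cprim H' h ->
  H b - H a = H' b - H' a.
Proof.
move=> Hh H'h.
have E (p : C -> R) : (forall x y, p (x - y) = p x - p y) ->
    (forall t : R, is_derive t 1 (fun t => p (H t)) (p (h t))) ->
    (forall t : R, is_derive t 1 (fun t => p (H' t)) (p (h t))) ->
    p (H b - H a) = p (H' b - H' a).
  move=> pB d1 d2.
  have D t : is_derive (t : R) 1 ((fun t => p (H t)) - (fun t => p (H' t))) 0.
    by rewrite -(subrr (p (h t))); apply: is_deriveB.
  have := @is_derive_0_is_cst R _ a b D.
  rewrite /GRing.add/= /GRing.opp/= !pB => e.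
  by move: e; lra.
have hR : complex.Re (H b - H a) = complex.Re (H' b - H' a).
  by apply: E; [exact: ReB|move=> t; case: (Hh t)|move=> t; case: (H'h t)].
have hI : complex.Im (H b - H a) = complex.Im (H' b - H' a).
  by apply: E; [exact: ImB|move=> t; case: (Hh t)|move=> t; case: (H'h t)].
move: hR hI; case: (H b - H a) => x y; case: (H' b - H' a) => x' y' /=.
by move=> -> ->.
Qed.

Lemma cintE H h a b : cprim H h -> cint h a b = H b - H a.
Proof.
move=> Hh; rewrite /cint; case: pselect => [p|[]]; last by exists H.
by apply: cprim_unique Hh; case: (cid p).
Qed.

Lemma cprim_exists h : rcont h -> exists H, cprim H h.
Proof.
move=> [/primitive_exists[A dA] /primitive_exists[B dB]].
by exists (fun t => (A t +i* B t)%C) => t; split => /=.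
Qed.

Lemma cint_split h a m b : cint h a b = cint h a m + cint h m b.
Proof.
rewrite /cint; case: pselect => p; last by rewrite addr0.
by rewrite /= [RHS]addrC addrA subrK.
Qed.

Lemma cprimD H H' h h' : cprim H h -> cprim H' h' ->
  cprim (fun t => H t + H' t) (fun t => h t + h' t).
Proof.
move=> Hh Hh' t; have [a1 a2] := Hh t; have [b1 b2] := Hh' t; split.
  have -> : (fun t => complex.Re (H t + H' t)) =
    (fun t => complex.Re (H t)) + (fun t => complex.Re (H' t)).
    by apply/funext => s; rewrite ReD.
  by rewrite ReD; exact: is_deriveD.
have -> : (fun t => complex.Im (H t + H' t)) =
  (fun t => complex.Im (H t)) + (fun t => complex.Im (H' t)).
  by apply/funext => s; rewrite ImD.
by rewrite ImD; exact: is_deriveD.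
Qed.

Lemma cprimZ z H h : cprim H h -> cprim (fun t => z * H t) (fun t => z * h t).
Proof.
case: z => x y Hh t; have [a1 a2] := Hh t.
have RZ (w : C) : complex.Re ((x +i* y)%C * w) = x * complex.Re w - y * complex.Im w by case: w.
have IZ (w : C) : complex.Im ((x +i* y)%C * w) = x * complex.Im w + y * complex.Re w by case: w.
split.
  have -> : (fun t => complex.Re ((x +i* y)%C * H t)) =
    (x *: (fun t => complex.Re (H t) : R^o)) - (y *: (fun t => complex.Im (H t) : R^o)).
    by apply/funext => s; rewrite RZ.
  by rewrite RZ; apply: is_deriveB; apply: is_deriveZ.
have -> : (fun t => complex.Im ((x +i* y)%C * H t)) =
  (x *: (fun t => complex.Im (H t) : R^o)) + (y *: (fun t => complex.Re (H t) : R^o)).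
  by apply/funext => s; rewrite IZ.
by rewrite IZ; apply: is_deriveD; apply: is_deriveZ.
Qed.

(** The factor 2 comes from estimating real and imaginary parts separately; no
    constant in this part needs to be sharp. *)
Lemma cint_bound h a b (M : R) : rcont h -> a <= b ->
  (forall t, a <= t <= b -> normc (h t) <= M) ->
  normc (cint h a b) <= 2 * M * (b - a).
Proof.
move=> /cprim_exists[H Hh] ab hM; rewrite (cintE _ _ Hh).
have E (p : C -> R) : (forall x, `|p x| <= normc x) ->
    (forall x y, p (x - y) = p x - p y) ->
    (forall t : R, is_derive t 1 (fun t => p (H t)) (p (h t))) ->
    `|p (H b - H a)| <= M * (b - a).
  move=> pn pB pd; rewrite pB ler_norml -mulNr.
  apply: derivative_mean => // t /hM htM.
  by rewrite -ler_norml; exact: le_trans (pn _) htM.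
apply: le_trans (normc_le_ReIm _) _.
rewrite -mulrA mulr_natl mulr2n lerD//; apply: E.
- exact: Re_le_normc.
- exact: ReB.
- by move=> t; case: (Hh t).
- exact: Im_le_normc.
- exact: ImB.
- by move=> t; case: (Hh t).
Qed.

Definition lint f z u a b := cint (fun t => f (line z u t) * u) a b.

Lemma rcont_prim_line f z u : normc u = 1 -> (forall t, ccont f (line z u t)) ->
  exists H, cprim H (fun t => f (line z u t) * u).
Proof.
move=> u1 cf; have [H Hh] := cprim_exists (rcont_line u1 cf).
exists (fun t => u * H t).
have -> : (fun t => f (line z u t) * u) = (fun t => u * f (line z u t)).
  by apply/funext => t; rewrite mulrC.
exact: cprimZ.
Qed.

Lemma lintD f g z u a b : normc u = 1 ->
  (forall t, ccont f (line z u t)) -> (forall t, ccont g (line z u t)) ->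
  lint (fun w => f w + g w) z u a b = lint f z u a b + lint g z u a b.
Proof.
move=> u1 /(rcont_prim_line u1)[H Hf] /(rcont_prim_line u1)[H' Hg].
rewrite /lint (cintE _ _ Hf) (cintE _ _ Hg).
have -> : (fun t => (f (line z u t) + g (line z u t)) * u) =
  (fun t => f (line z u t) * u + g (line z u t) * u).
  by apply/funext => t; rewrite mulrDl.
by rewrite (cintE _ _ (cprimD Hf Hg)) opprD addrACA.
Qed.

Lemma lintZ f z u a b l : normc u = 1 -> (forall t, ccont f (line z u t)) ->
  lint (fun w => l * f w) z u a b = l * lint f z u a b.
Proof.
move=> u1 /(rcont_prim_line u1)[H Hf].
rewrite /lint (cintE _ _ Hf).
have -> : (fun t => (l * f (line z u t)) * u) = (fun t => l * (f (line z u t) * u)).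
  by apply/funext => t; rewrite mulrA.
by rewrite (cintE _ _ (cprimZ l Hf)) mulrBr.
Qed.

Lemma lint_eq f g z u a b : (forall t, f (line z u t) = g (line z u t)) ->
  lint f z u a b = lint g z u a b.
Proof. by move=> fg; rewrite /lint; congr cint; apply/funext => t; rewrite fg. Qed.

Lemma lint_bound f z u a b (M : R) : normc u = 1 -> a <= b ->
  (forall t, ccont f (line z u t)) ->
  (forall t, a <= t <= b -> normc (f (line z u t)) <= M) ->
  normc (lint f z u a b) <= 2 * M * (b - a).
Proof.
move=> u1 ab cf fM; have [h1 h2] := rcont_line u1 cf.
apply: cint_bound => //; last first.
  by move=> t /fM; rewrite normcM u1 mulr1.
case: u u1 cf fM h1 h2 => x y u1 cf fM h1 h2.
split => t.
  have -> : (fun t => complex.Re (f (line z (x +i* y)%C t) * (x +i* y)%C)) =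
   (fun t => complex.Re (f (line z (x +i* y)%C t)) * x - complex.Im (f (line z (x +i* y)%C t)) * y).
    by apply/funext => s; case: (f _).
  by apply: cvgB; (apply: cvgM; last exact: cvg_cst); [exact: h1|exact: h2].
have -> : (fun t => complex.Im (f (line z (x +i* y)%C t) * (x +i* y)%C)) =
   (fun t => complex.Re (f (line z (x +i* y)%C t)) * y + complex.Im (f (line z (x +i* y)%C t)) * x).
  by apply/funext => s; case: (f _).
by apply: cvgD; (apply: cvgM; last exact: cvg_cst); [exact: h1|exact: h2].
Qed.

Lemma lint_primitive F f z u a b : normc u = 1 ->
  (forall t, cderiv F (line z u t) (f (line z u t))) ->
  lint f z u a b = F (line z u b) - F (line z u a).
Proof. by move=> u1 dF; rewrite /lint (cintE _ _ (cprim_line u1 dF)). Qed.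

End integrals.

(** * Goursat's theorem on rectangles *)

Section rectangles.
Context {R : realType}.
Local Notation C := (R[i]).
Implicit Types (f g F : C -> C) (z w u l : C) (a b c d t : R).

(** The contour integral over the boundary of the rectangle [a, b] x [c, d],
    taken counterclockwise. *)
Definition rint f a b c d : C :=
  lint f (0 +i* c)%C 1 a b + lint f (b +i* 0)%C 'i%C c d
  - lint f (0 +i* d)%C 1 a b - lint f (a +i* 0)%C 'i%C c d.

(** The full lines that carry the sides, because primitives along a line are
    defined on the whole line. *)
Definition clines a b c d z :=
  [|| complex.Im z == c, complex.Im z == d, complex.Re z == a | complex.Re z == b].

Definition in_rect a b c d z :=
  (a <= complex.Re z <= b) && (c <= complex.Im z <= d).

Lemma normci : normc ('i%C : C) = 1.
Proof. by rewrite /normc /= expr0n add0r expr1n sqrtr1. Qed.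

Lemma lineh c t : line (0 +i* c)%C 1 t = (t +i* c)%C.
Proof. by rewrite /line mulr1; congr Complex; rewrite /= ?add0r ?addr0. Qed.

Lemma linev a t : line (a +i* 0)%C 'i%C t = (a +i* t)%C.
Proof.
rewrite /line /GRing.mul /=; congr Complex; rewrite /=.
  by rewrite mulr0 mul0r subrr addr0.
by rewrite mulr1 mul0r addr0 add0r.
Qed.

Lemma rint_split_re f a m b c d : rint f a b c d = rint f a m c d + rint f m b c d.
Proof.
rewrite /rint /lint (cint_split _ a m b) [in X in _ - X - _](cint_split _ a m b).
ring.
Qed.

Lemma rint_split_im f a b c m d : rint f a b c d = rint f a b c m + rint f a b m d.
Proof.
rewrite /rint /lint (cint_split _ c m d) [in X in _ - _ - X](cint_split _ c m d).
ring.
Qed.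

Lemma normcD4 z1 z2 z3 z4 :
  normc (z1 + z2 - z3 - z4) <= normc z1 + normc z2 + normc z3 + normc z4.
Proof.
have h1 := le_normcD (z1 + z2 - z3) (- z4); have h2 := le_normcD (z1 + z2) (- z3).
have h3 := le_normcD z1 z2; rewrite !normcN in h1 h2; lra.
Qed.

Section on_lines.
Variables (a b c d : R).
Let L := clines a b c d.
Let Lb t : L (t +i* c)%C. Proof. by rewrite /L/clines /= eqxx. Qed.
Let Lt t : L (t +i* d)%C. Proof. by rewrite /L/clines /= eqxx orbT. Qed.
Let Ll t : L (a +i* t)%C. Proof. by rewrite /L/clines /= eqxx !orbT. Qed.
Let Lr t : L (b +i* t)%C. Proof. by rewrite /L/clines /= eqxx !orbT. Qed.

Lemma rintD f g : (forall z, L z -> ccont f z) -> (forall z, L z -> ccont g z) ->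
  rint (fun w => f w + g w) a b c d = rint f a b c d + rint g a b c d.
Proof.
move=> cf cg; rewrite /rint !lintD ?normci ?normc1//; try (move=> t;
  rewrite ?lineh ?linev; first [exact: cf|exact: cg]).
ring.
Qed.

Lemma rintZ f l : (forall z, L z -> ccont f z) ->
  rint (fun w => l * f w) a b c d = l * rint f a b c d.
Proof.
move=> cf; rewrite /rint !lintZ ?normci ?normc1//; try (move=> t;
  rewrite ?lineh ?linev; exact: cf).
ring.
Qed.

Lemma rint_eq f g : (forall z, L z -> f z = g z) ->
  rint f a b c d = rint g a b c d.
Proof.
move=> fg; rewrite /rint; congr (_ + _ - _ - _); apply: lint_eq => t;
  by rewrite ?lineh ?linev fg.
Qed.

(** The values of the primitive at the four corners cancel. *)
Lemma rint_primitive F f : (forall z, L z -> cderiv F z (f z)) ->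
  rint f a b c d = 0.
Proof.
move=> dF; rewrite /rint !(@lint_primitive _ F) ?normci ?normc1//; try (move=> t;
  rewrite ?lineh ?linev; exact: dF).
rewrite !lineh !linev; ring.
Qed.

Lemma rint_bound f (M : R) : a <= b -> c <= d -> (forall z, L z -> ccont f z) ->
  (forall z, L z -> in_rect a b c d z -> normc (f z) <= M) ->
  normc (rint f a b c d) <= 4 * M * ((b - a) + (d - c)).
Proof.
move=> ab cd cf fM; rewrite /rint.
have Hh y : (forall t, L (t +i* y)%C) -> c <= y <= d ->
   normc (lint f (0 +i* y)%C 1 a b) <= 2 * M * (b - a).
  move=> Ly cyd; apply: lint_bound; rewrite ?normc1// => t; rewrite lineh; first exact: cf.
  by move=> tab; apply: fM; rewrite // /in_rect /= tab cyd.
have Hv x : (forall t, L (x +i* t)%C) -> a <= x <= b ->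
   normc (lint f (x +i* 0)%C 'i%C c d) <= 2 * M * (d - c).
  move=> Lx axb; apply: lint_bound; rewrite ?normci// => t; rewrite linev; first exact: cf.
  by move=> tcd; apply: fM; rewrite // /in_rect /= axb tcd.
apply: le_trans (normcD4 _ _ _ _) _.
have h1 := Hh c Lb; have h2 := Hh d Lt.
have h3 := Hv a Ll; have h4 := Hv b Lr.
move: h1 h2 h3 h4; rewrite !lexx ab cd /= => /(_ isT) h1 /(_ isT) h2 /(_ isT) h3 /(_ isT) h4.
by lra.
Qed.
End on_lines.

Lemma cderiv_affine_primitive z k l w :
  cderiv (fun w => k * w + l / 2 * (w - z) ^+ 2) w (k + l * (w - z)).
Proof.
move=> e e0.
have L0 : 0 < normc l + 1 by rewrite ltr_pwDr// normc_ge0.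
exists (e / (normc l + 1)); first by rewrite divr_gt0.
move=> v vw.
have -> : k * v + l / 2 * (v - z) ^+ 2 - (k * w + l / 2 * (w - z) ^+ 2)
   - (k + l * (w - z)) * (v - w) = l / 2 * (v - w) * (v - w) by field.
rewrite normcM ler_wpM2r ?normc_ge0// !normcM normcV.
have -> : normc (2 : C) = 2.
  by have := normc_real (2 : R); rewrite ger0_norm// => <-; rewrite rmorph_nat.
move: vw; rewrite ltr_pdivlMr// => vw.
have := normc_ge0 l; have := normc_ge0 (v - w); nra.
Qed.

Lemma normc_in_rect a b c d z w : in_rect a b c d z -> in_rect a b c d w ->
  normc (z - w) <= (b - a) + (d - c).
Proof.
move=> /andP[z1 z2] /andP[w1 w2]; apply: le_trans (normc_le_ReIm _) _.
rewrite ReB ImB; apply: lerD; rewrite ler_norml; lra.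
Qed.

Lemma half_ge0 : 0 <= (1/2 : R).
Proof. by rewrite divr_ge0. Qed.

Lemma half_lt1 : `|1/2 : R| < 1.
Proof.
by rewrite ger0_norm ?half_ge0// ltr_pdivrMr// mul1r ltr1n.
Qed.

(** The integral is the sum of those over the four quarters, so one of them
    carries at least a quarter of it. *)
Lemma goursat_step f a b c d (A : R) : normc (rint f a b c d) >= 4 * A ->
  exists a' c', [/\ a' = a \/ a' = (a + b) / 2, c' = c \/ c' = (c + d) / 2 &
    normc (rint f a' (a' + (b - a) / 2) c' (c' + (d - c) / 2)) >= A].
Proof.
rewrite (rint_split_re f a ((a + b) / 2)).
rewrite (rint_split_im f a _ c ((c + d) / 2)) (rint_split_im f _ b c ((c + d) / 2)).
set r1 := rint _ _ _ _ _; set r2 := rint _ _ _ _ _.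
set r3 := rint _ _ _ _ _; set r4 := rint _ _ _ _ _ => H.
have E1 : a + (b - a) / 2 = (a + b) / 2 by field.
have E2 : (a + b) / 2 + (b - a) / 2 = b by field.
have E3 : c + (d - c) / 2 = (c + d) / 2 by field.
have E4 : (c + d) / 2 + (d - c) / 2 = d by field.
have [h1|h1] := leP A (normc r1).
  by exists a, c; rewrite E1 E3; split => //; left.
have [h2|h2] := leP A (normc r2).
  by exists a, ((c + d) / 2); rewrite E1 E4; split => //; [left|right].
have [h3|h3] := leP A (normc r3).
  by exists ((a + b) / 2), c; rewrite E2 E3; split => //; [right|left].
have [h4|h4] := leP A (normc r4).
  by exists ((a + b) / 2), ((c + d) / 2); rewrite E2 E4; split => //; right.
have := le_trans H (le_normcD _ _).
have := le_normcD r1 r2; have := le_normcD r3 r4.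
by lra.
Qed.

(** Completeness in the form of nested intervals of geometrically decreasing
    length. It provides the limit point in Goursat's theorem and the sums of
    series. *)
Lemma nested_limit (x : nat -> R) (W : R) :
  (forall n, x n <= x n.+1 <= x n + W * (1/2) ^+ n.+1) -> 0 <= W ->
  exists X, forall n, x n <= X <= x n + W * (1/2) ^+ n.
Proof.
move=> H W0.
have mono n m : x n <= x (n + m)%N.
  elim: m => [|m IH]; first by rewrite addn0.
  by rewrite addnS (le_trans IH)//; case/andP: (H (n + m)%N).
have anti n m : x (n + m)%N + W * (1/2) ^+ (n + m) <= x n + W * (1/2) ^+ n.
  elim: m => [|m IH]; first by rewrite addn0.
  rewrite addnS; apply: le_trans IH; case/andP: (H (n + m)%N) => _.
  rewrite exprS; set e := (1/2) ^+ _; lra.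
have pw n : 0 <= W * (1/2) ^+ n by rewrite mulr_ge0// exprn_ge0//; lra.
have ub n m : x m <= x n + W * (1/2) ^+ n.
  have [nm|mn] := leqP n m.
    rewrite -(subnKC nm); apply: le_trans (anti n (m - n)%N).
    by rewrite lerDl.
  rewrite -(subnKC (ltnW mn)); apply: le_trans (mono m (n - m)%N) _.
  by rewrite lerDl.
exists (sup (range x)) => n; apply/andP; split.
  apply: ub_le_sup; last by exists n.
  by exists (x 0%N + W * (1/2) ^+ 0) => _ [m _ <-]; exact: ub.
apply: ge_sup; first by exists (x 0%N), 0%N.
by move=> _ [m _ <-]; exact: ub.
Qed.

(** Repeated quartering keeps an integral of at least eta 4^-n over a rectangle
    of size O(2^-n) around some point. Near this point f differs from an affine
    function, whose integral vanishes, by o(2^-n) on a contour of length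
    O(2^-n): a contradiction. *)
Lemma goursat f a b c d : a <= b -> c <= d -> (forall z, ccont f z) ->
  (forall z, in_rect a b c d z -> exists l, cderiv f z l) ->
  rint f a b c d = 0.
Proof.
move=> ab cd cf df; apply/eqP; rewrite -normc_eq0 eq_le normc_ge0 andbT leNgt.
apply/negP => eta0; set eta := normc _ in eta0.
pose w := b - a; pose h := d - c.
have w0 : 0 <= w by rewrite subr_ge0.
have h0 : 0 <= h by rewrite subr_ge0.
pose Q n (p : R * R) := eta * (1/4) ^+ n <=
  normc (rint f p.1 (p.1 + w * (1/2) ^+ n) p.2 (p.2 + h * (1/2) ^+ n)).
pose nxt n (p q : R * R) := [/\ p.1 <= q.1 <= p.1 + w * (1/2) ^+ n.+1,
   p.2 <= q.2 <= p.2 + h * (1/2) ^+ n.+1 & Q n p -> Q n.+1 q].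
have pw (W : R) n : 0 <= W -> 0 <= W * (1/2) ^+ n.
  by move=> W0; rewrite mulr_ge0// exprn_ge0//; lra.
have nxtP n p : exists q, nxt n p q.
  have [Qp|Qp] := pselect (Q n p); last first.
    by exists p; split; rewrite // lexx /= lerDl pw.
  have : 4 * (eta * (1/4) ^+ n.+1) <=
     normc (rint f p.1 (p.1 + w * (1/2) ^+ n) p.2 (p.2 + h * (1/2) ^+ n)).
    by apply: le_trans Qp; rewrite exprS; set e := (1/4) ^+ n; lra.
  move=> /goursat_step[a' [c' [ha hc Hq]]].
  have E (x W : R) : (x + W * (1/2) ^+ n - x) / 2 = W * (1/2) ^+ n.+1.
    by rewrite exprS; field.
  exists (a', c'); split => /=.
  - have := pw w n w0; have := pw w n.+1 w0; move: ha; rewrite exprS; set e := (1/2) ^+ n.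
    by case=> ->; lra.
  - have := pw h n h0; have := pw h n.+1 h0; move: hc; rewrite exprS; set e := (1/2) ^+ n.
    by case=> ->; lra.
  - by move=> _; rewrite /Q /=; move: Hq; rewrite !E.
pose s := fix s n := if n is m.+1 then projT1 (cid (nxtP m (s m))) else (a, c).
have sP n : nxt n (s n) (s n.+1) by rewrite /=; case: (cid _).
have Qs n : Q n (s n).
  elim: n => [|n IH]; last by have [_ _] := sP n; apply.
  by rewrite /Q /= expr0 mulr1 !expr0 !mulr1 /w /h [a + _]addrC [c + _]addrC !subrK.
have [x xP] : exists X, forall n, (s n).1 <= X <= (s n).1 + w * (1/2) ^+ n.
  by apply: (@nested_limit (fun n => (s n).1)) => // n; have [] := sP n.
have [y yP] : exists X, forall n, (s n).2 <= X <= (s n).2 + h * (1/2) ^+ n.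
  by apply: (@nested_limit (fun n => (s n).2)) => // n; have [] := sP n.
have [l dl] : exists l, cderiv f (x +i* y)%C l.
  apply: df; rewrite /in_rect /=.
  have := xP 0%N; have := yP 0%N; rewrite /= expr0 !mulr1 /w /h.
  by rewrite [a + _]addrC [c + _]addrC !subrK => -> ->.
pose S := w + h + 1.
have S0 : 0 < S by rewrite /S ltr_pwDr// addr_ge0.
have [dd dd0 ddP] := dl (eta / (8 * S ^+ 2)) (divr_gt0 eta0 (mulr_gt0 (ltr0n _ 8) (exprn_gt0 _ S0))).
have [n nP] : exists n, S * (1/2) ^+ n < dd.
  have : (1/2 : R) ^+ n @[n --> \oo] --> (0 : R) by apply: cvg_expr; exact: half_lt1.
  move=> /cvgrPdist_lt/(_ (dd / S)); rewrite divr_gt0// => /(_ isT)[n _ /(_ n (leqnn n))].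
  rewrite /= sub0r normrN ger0_norm ?exprn_ge0 ?half_ge0//.
  by rewrite ltr_pdivlMr// mulrC; exists n.
have := Qs n; rewrite /Q; set p := s n in nP *.
set a1 := p.1; set c1 := p.2; set b1 := a1 + _; set d1 := c1 + _.
(* rho is f minus its affine approximation at the limit point; its integral is
   that of f. *)
pose rho v := f v + (-1) * ((f (x +i* y)%C) + l * (v - (x +i* y)%C)).
have cont_aff v : ccont (fun v => f (x +i* y)%C + l * (v - (x +i* y)%C)) v.
  move=> e e0; have L0 : 0 < normc l + 1 by rewrite ltr_pwDr// normc_ge0.
  exists (e / (normc l + 1)); first by rewrite divr_gt0.
  move=> v' vv'; rewrite opprD addrACA subrr add0r -mulrBr opprB addrA subrK normcM.
  move: vv'; rewrite ltr_pdivlMr//; have := normc_ge0 (v' - v); have := normc_ge0 l; nra.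
have cont_aff' v : ccont (fun v => -1 * (f (x +i* y)%C + l * (v - (x +i* y)%C))) v.
  move=> e /(cont_aff v)[k k0 kP]; exists k => // v' /kP.
  by rewrite !mulN1r -opprD normcN.
have rho_cont v : ccont rho v.
  move=> e e0; have e20 : 0 < e / 2 by rewrite divr_gt0.
  have [k1 k10 k1P] := cf v _ e20; have [k2 k20 k2P] := cont_aff' v _ e20.
  exists (Num.min k1 k2); first by rewrite lt_min k10.
  move=> v'; rewrite lt_min => /andP[/k1P H1 /k2P H2].
  rewrite /rho opprD addrACA [e]splitr; apply: le_trans (le_normcD _ _) _.
  exact: lerD.
have Erho : rint rho a1 b1 c1 d1 = rint f a1 b1 c1 d1.
  rewrite /rho rintD; [|by move=> *; exact: cf|by move=> *; exact: cont_aff'].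
  rewrite rintZ; last by move=> *; exact: cont_aff.
  rewrite [X in _ + _ * X](rint_primitive (F := fun w => f (x +i* y)%C * w + l / 2 * (w - (x +i* y)%C) ^+ 2)).
    by rewrite mulr0 addr0.
  by move=> v _; exact: cderiv_affine_primitive.
have ab1 : a1 <= b1 by rewrite lerDl pw.
have cd1 : c1 <= d1 by rewrite lerDl pw.
rewrite -Erho => HQ.
(* The tolerance eta / (8 S^2) makes the bound below equal to half of eta 4^-n.
   *)
have en0 : 0 < (1/2 : R) ^+ n by rewrite exprn_gt0//; lra.
have wn : (b1 - a1) + (d1 - c1) <= S * (1/2) ^+ n.
  by rewrite /b1 /d1 /S; set e := (1/2) ^+ n in en0 *; lra.
have B : normc (rint rho a1 b1 c1 d1) <=
    4 * (eta / (8 * S ^+ 2) * (S * (1/2) ^+ n)) * ((b1 - a1) + (d1 - c1)).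
  apply: rint_bound => // v _ vr.
  have vx : normc (v - (x +i* y)%C) <= S * (1/2) ^+ n.
    apply: le_trans wn; apply: normc_in_rect vr _.
    by rewrite /in_rect /= xP yP.
  have := ddP v (le_lt_trans vx nP); rewrite /rho mulN1r opprD addrA => /le_trans; apply.
  by rewrite ler_wpM2l// divr_ge0// ?ltW// mulr_gt0// exprn_gt0.
have := le_trans HQ B; rewrite leNgt => /negP; apply.
have -> : (1/4 : R) ^+ n = (1/2) ^+ n * (1/2) ^+ n by rewrite -exprMn; congr (_ ^+ _); field.
have T0 : 0 <= 4 * (eta / (8 * S ^+ 2) * (S * (1/2) ^+ n)).
  by rewrite !mulr_ge0// ?invr_ge0 ?mulr_ge0 ?exprn_ge0// ltW.
apply: (le_lt_trans (ler_wpM2l T0 wn)).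
have -> : 4 * (eta / (8 * S ^+ 2) * (S * (1 / 2) ^+ n)) * (S * (1 / 2) ^+ n) =
  eta * ((1 / 2) ^+ n * (1 / 2) ^+ n) / 2 by field; rewrite gt_eqF.
have := mulr_gt0 eta0 (mulr_gt0 en0 en0); set T := eta * _; lra.
Qed.

(** Cutting off everything but a small square around z0 does not change the
    integral, and over the small square it is small because f is bounded there.
    *)
Lemma goursat_except f z0 a b c d : (forall z, ccont f z) ->
  (forall z, z != z0 -> exists l, cderiv f z l) ->
  a < complex.Re z0 < b -> c < complex.Im z0 < d ->
  rint f a b c d = 0.
Proof.
case: z0 => x y /= cf df /andP[ax xb] /andP[cy yd].
apply/eqP; rewrite -normc_eq0 eq_le normc_ge0 andbT; apply/ler_addgt0Pl => e e0.
rewrite addr0; pose M := normc (f (x +i* y)%C) + 1.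
have M0 : 0 < M by rewrite ltr_pwDr// normc_ge0.
have [k k0 kP] := cf (x +i* y)%C 1 ltr01.
(* r keeps the small square inside the rectangle and inside the disc on which f
   is within 1 of its value at the centre, and makes its integral, bounded by 4
   M (4 r), at most e. *)
pose r := Num.min (Num.min (x - a) (b - x)) (Num.min (Num.min (y - c) (d - y))
   (Num.min (k / 8) (e / (16 * M)))).
have r0 : 0 < r.
  by rewrite !lt_min !subr_gt0 ax xb cy yd /= !divr_gt0// mulr_gt0.
have [r1 r2 r3 r4 r5] : [/\ r <= x - a, r <= b - x, r <= y - c, r <= d - y & r <= k / 8].
  by rewrite /r; split; rewrite !ge_min lexx ?orbT.
have r6 : r <= e / (16 * M) by rewrite /r !ge_min lexx ?orbT.
rewrite (rint_split_re _ a (x - r) b) goursat; [|lra|lra|by []|]; last first.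
  move=> z /andP[z1 z2]; apply: df; apply/eqP => zE; move: z1; rewrite zE /=; lra.
rewrite add0r (rint_split_re _ _ (x + r) b) [X in _ + X]goursat; [|lra|lra|by []|]; last first.
  move=> z /andP[z1 z2]; apply: df; apply/eqP => zE; move: z1; rewrite zE /=; lra.
rewrite addr0 (rint_split_im _ _ _ _ (y - r)) goursat; [|lra|lra|by []|]; last first.
  move=> z /andP[z1 z2]; apply: df; apply/eqP => zE; move: z2; rewrite zE /=; lra.
rewrite add0r (rint_split_im _ _ _ _ (y + r)) [X in _ + X]goursat; [|lra|lra|by []|]; last first.
  move=> z /andP[z1 z2]; apply: df; apply/eqP => zE; move: z2; rewrite zE /=; lra.
rewrite addr0; apply: le_trans (@rint_bound _ _ _ _ f M _ _ _ _) _; try lra.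
- by move=> z _; exact: cf.
- move=> z _ zr; rewrite -(subrK (f (x +i* y)%C) (f z)) /M [_ + 1]addrC.
  apply: le_trans (le_normcD _ _) _; rewrite lerD2r; apply: kP.
  apply: (@le_lt_trans _ _ ((x + r - (x - r)) + (y + r - (y - r)))); last lra.
  apply: normc_in_rect zr _; rewrite /in_rect /=; lra.
- move: r6; rewrite ler_pdivlMr ?mulr_gt0//; nra.
Qed.

End rectangles.

(** * The Cauchy kernel on a square *)

Section holomorphic.
Context {R : realType}.
Local Notation C := (R[i]).
Implicit Types (f g : C -> C) (z w : C).

Definition holo f z := derivable (f : R[i]^o -> R[i]^o) (z : R[i]^o) 1.

Lemma holo_ccont f z : holo f z -> ccont f z.
Proof. by move=> /derivable_cderiv/cderiv_ccont. Qed.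

Lemma holoM f g z : holo f z -> holo g z -> holo (fun w => f w * g w) z.
Proof. exact: derivableM. Qed.

Lemma holoB f g z : holo f z -> holo g z -> holo (fun w => f w - g w) z.
Proof. exact: derivableB. Qed.

Lemma holo_id z : holo id z. Proof. exact: derivable_id. Qed.

Lemma holo_cst l z : holo (fun=> l) z. Proof. exact: derivable_cst. Qed.

Lemma holoV f z : f z != 0 -> holo f z -> holo (fun w => (f w)^-1) z.
Proof. by move=> fz hf; apply: derivableV. Qed.

Lemma holoX f n z : holo f z -> holo (fun w => f w ^+ n) z.
Proof.
move=> hf; elim: n => [|n IH].
  by rewrite (_ : (fun w => _) = fun=> 1); [exact: holo_cst|apply/funext => w; rewrite expr0].
rewrite (_ : (fun w => _) = fun w => f w * f w ^+ n); first exact: holoM.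
by apply/funext => w; rewrite exprS.
Qed.

Lemma cderivM f g z l m : cderiv f z l -> cderiv g z m ->
  cderiv (fun w => f w * g w) z (f z * m + g z * l).
Proof.
move=> /cderiv_derivable df /cderiv_derivable dg.
have [d1 <-] := is_deriveM df dg.
exact: derivable_cderiv.
Qed.

Lemma cderivV z : z != 0 -> cderiv (fun w => w^-1) z (- z ^- 2).
Proof.
move=> z0 e e0; have nz : 0 < normc z by rewrite normc_gt0.
exists (Num.min (normc z / 2) (e * normc z ^+ 3 / 2)).
  by rewrite lt_min !divr_gt0// mulr_gt0// exprn_gt0.
move=> w; rewrite lt_min => /andP[w1 w2].
have wz : normc z / 2 <= normc w.
  by have := le_normcD w (z - w); rewrite addrC subrK normcB; lra.
have nw : 0 < normc w by apply: lt_le_trans wz; rewrite divr_gt0.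
have w0 : w != 0 by rewrite -normc_gt0.
have -> : w^-1 - z^-1 - - z ^- 2 * (w - z) = (w - z) / (w * z ^+ 2) * (w - z).
  by field; rewrite w0 z0.
rewrite normcM ler_wpM2r ?normc_ge0// normcM normcV ler_pdivrMr; last first.
  by rewrite normcM mulr_gt0// normcX exprn_gt0.
rewrite normcM normcX; apply: le_trans (ltW w2) _.
have -> : e * normc z ^+ 3 / 2 = e * (normc z / 2 * normc z ^+ 2) by field.
by rewrite ler_wpM2l ?(ltW e0)// ler_wpM2r// exprn_ge0// ltW.
Qed.

Lemma cderivX_inv n z : z != 0 ->
  cderiv (fun w => w^-1 ^+ n.+1) z (- n.+1%:R * z^-1 ^+ n.+2).
Proof.
move=> z0; elim: n => [|n IH].
  have -> : (fun w : C => w^-1 ^+ 1) = (fun w => w^-1).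
    by apply/funext => w; rewrite expr1.
  by rewrite mulN1r exprVn; exact: cderivV.
have -> : (fun w : C => w^-1 ^+ n.+2) = (fun w => w^-1 * w^-1 ^+ n.+1).
  by apply/funext => w; rewrite exprS.
have := cderivM (cderivV z0) IH.
suff -> : z^-1 * (- n.+1%:R * z^-1 ^+ n.+2) + z^-1 ^+ n.+1 * - z ^- 2 =
  - n.+2%:R * z^-1 ^+ n.+3 by [].
rewrite !exprS; set W := z^-1 ^+ n; rewrite -[n.+2]addn1 natrD expr0.
by field.
Qed.

Lemma cderivV_exp n w : w != 0 ->
  cderiv (fun w => - (n.+1%:R)^-1 * w^-1 ^+ n.+1) w (w^-1 ^+ n.+2).
Proof.
move=> w0; have n0 : n.+1%:R != 0 :> C by rewrite pnatr_eq0.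
have /cderiv_derivable d0 := cderivX_inv n w0.
have [d1 E] := @is_deriveZ _ _ _ _ (- (n.+1%:R)^-1 : R[i]) _ _ _ d0.
have -> : w^-1 ^+ n.+2 = - n.+1%:R^-1 *: (- n.+1%:R * w^-1 ^+ n.+2 : R[i]^o).
  by rewrite /GRing.scale/= mulrA mulrNN mulVf// mul1r.
rewrite -E; exact: derivable_cderiv.
Qed.

(** Squares rather than circles: on the sides of a square the integrands are
    rational functions of the parameter, so neither the exponential function
    nor angles occur. *)
Section square.
Variable (r : R).
Hypothesis r0 : 0 < r.
Let L := clines (- r) r (- r) r.
Let sq f := rint f (- r) r (- r) r.

Lemma square_normc_ge w : L w -> r <= normc w.
Proof.
rewrite /L /clines => H; have h1 := Re_le_normc w; have h2 := Im_le_normc w.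
have rr : `|r| = r by rewrite ger0_norm// ltW.
case/or4P: H => /eqP e; [move: h2|move: h2|move: h1|move: h1];
  by rewrite e ?normrN rr.
Qed.

Lemma square_neq w : L w -> w != 0.
Proof. by move=> /square_normc_ge h; rewrite -normc_gt0 (lt_le_trans r0). Qed.

Lemma square_sub_ge w z : normc z <= r / 2 -> L w -> r / 2 <= normc (w - z).
Proof.
move=> zr /square_normc_ge wr; have := le_normcD (w - z) z; rewrite subrK; lra.
Qed.

Lemma square_sub_neq w z : normc z <= r / 2 -> L w -> w - z != 0.
Proof.
by move=> zr /(square_sub_ge zr) h; rewrite -normc_gt0 (lt_le_trans _ h)// divr_gt0.
Qed.

Lemma square_normc_le w : in_rect (- r) r (- r) r w -> normc w <= 2 * r.
Proof.
move=> /andP[h1 h2]; apply: le_trans (normc_le_ReIm w) _.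
rewrite mulr_natl mulr2n; apply: lerD; rewrite ler_norml; lra.
Qed.

Lemma cauchy_kernel_holo z n w : normc z <= r / 2 -> L w ->
  holo (fun w => w^-1 ^+ n * (w - z)^-1) w.
Proof.
move=> zr Lw; apply: holoM.
  by apply: holoX; apply: holoV; [exact: square_neq|exact: holo_id].
by apply: holoV; [exact: square_sub_neq|apply: holoB; [exact: holo_id|exact: holo_cst]].
Qed.

Lemma invX_holo n w : L w -> holo (fun w => w^-1 ^+ n) w.
Proof. by move=> Lw; apply: holoX; apply: holoV; [exact: square_neq|exact: holo_id]. Qed.

(** 1/(w - z) is replaced by the geometric sum of z^n/w^(n+1), n < M, with the
    remainder (z/w)^M/(w - z). *)
Lemma rint_kernel_expansion f z M : (forall w, holo f w) -> normc z <= r / 2 ->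
  sq (fun w => f w * (w - z)^-1) =
  \sum_(n < M) z ^+ n * sq (fun w => f w * w^-1 ^+ n.+1)
  + z ^+ M * sq (fun w => f w * (w^-1 ^+ M * (w - z)^-1)).
Proof.
move=> hf zr; elim: M => [|M IH].
  rewrite big_ord0 expr0 mul1r add0r; congr rint; apply/funext => w.
  by rewrite expr0 mul1r.
rewrite big_ord_recr /= IH -addrA; congr (_ + _).
pose g1 w := f w * w^-1 ^+ M.+1; pose g2 w := f w * (w^-1 ^+ M.+1 * (w - z)^-1).
have h1 w : L w -> ccont g1 w.
  by move=> Lw; apply: holo_ccont; apply: holoM => //; exact: invX_holo.
have h2 w : L w -> ccont g2 w.
  by move=> Lw; apply: holo_ccont; apply: holoM => //; exact: cauchy_kernel_holo.
have h3 w : L w -> ccont (fun w => z * g2 w) w.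
  move=> Lw; apply: holo_ccont; apply: holoM; first exact: holo_cst.
  by apply: holoM => //; exact: cauchy_kernel_holo.
rewrite exprS -/(sq g1) -/(sq g2) [z * _]mulrC -mulrA -mulrDr; congr (_ * _).
rewrite -rintZ// -rintD//; apply: rint_eq => w Lw; rewrite /g1 /g2 !exprS.
by field; rewrite (square_neq Lw) (square_sub_neq zr Lw).
Qed.

Lemma sq_bound f (M : R) : (forall w, L w -> holo f w) ->
  (forall w, L w -> in_rect (- r) r (- r) r w -> normc (f w) <= M) ->
  normc (sq f) <= 16 * r * M.
Proof.
move=> hf fM; apply: le_trans (@rint_bound _ _ _ _ _ f M _ _ _ _) _ => //.
- by have := ltW r0; lra.
- by have := ltW r0; lra.
- by move=> w Lw; apply: holo_ccont; exact: hf.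
- by rewrite opprK; lra.
Qed.

(** On the contour |w| >= r and |w - z| >= r/2, and the contour has length 8r.
    *)
Lemma kernel_remainder f z M (S : R) : (forall w, holo f w) -> normc z <= r / 2 ->
  (forall w, normc w <= 2 * r -> normc (f w) <= S) ->
  normc (z ^+ M * sq (fun w => f w * (w^-1 ^+ M * (w - z)^-1)))
  <= 32 * S * (normc z / r) ^+ M.
Proof.
move=> hf zr fS.
have S0 : 0 <= S.
  by apply: le_trans (fS 0 _); rewrite ?normc_ge0 ?normc0 ?mulr_ge0// ltW.
have B : normc (sq (fun w => f w * (w^-1 ^+ M * (w - z)^-1))) <=
    16 * r * (S * (r^-1 ^+ M * (r / 2)^-1)).
  apply: sq_bound => w Lw.
    by apply: holoM => //; exact: cauchy_kernel_holo.
  move=> /square_normc_le w2; rewrite !normcM normcX !normcV.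
  apply: ler_pM; rewrite ?normc_ge0 ?mulr_ge0 ?exprn_ge0 ?invr_ge0 ?normc_ge0//.
    exact: fS.
  apply: ler_pM; rewrite ?exprn_ge0 ?invr_ge0 ?normc_ge0//.
    apply: lerXn2r; rewrite ?nnegrE ?invr_ge0 ?normc_ge0//; first exact: ltW.
    by rewrite lef_pV2 ?posrE ?normc_gt0 ?square_neq// square_normc_ge.
  rewrite lef_pV2 ?posrE ?normc_gt0 ?square_sub_neq ?divr_gt0//.
  exact: square_sub_ge.
rewrite normcM normcX; apply: le_trans (ler_wpM2l (exprn_ge0 _ (normc_ge0 _)) B) _.
rewrite exprMn; set X := normc z ^+ M; set Y := r^-1 ^+ M.
have -> : X * (16 * r * (S * (Y * (r / 2)^-1))) = 32 * S * (X * Y).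
  by field; rewrite gt_eqF.
by [].
Qed.

Lemma sq_invX n : sq (fun w => w^-1 ^+ n.+2) = 0.
Proof.
by apply: (rint_primitive (F := fun w => - (n.+1%:R)^-1 * w^-1 ^+ n.+1)) => w Lw;
  apply: cderivV_exp; exact: square_neq Lw.
Qed.

(** In the expansion of 1/(w - z) only the term n = 0 contributes, because
    w^-(n+2) has a primitive; the remainder tends to 0. *)
Lemma winding z : normc z <= r / 2 -> sq (fun w => (w - z)^-1) = sq (fun w => w^-1).
Proof.
move=> zr; apply/eqP; rewrite -subr_eq0 -normc_eq0 eq_le normc_ge0 andbT.
have h1 : forall w, holo (fun=> 1) w by move=> w; exact: holo_cst.
have E M : sq (fun w => (w - z)^-1) - sq (fun w => w^-1) =
  z ^+ M.+1 * sq (fun w => 1 * (w^-1 ^+ M.+1 * (w - z)^-1)).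
  have := rint_kernel_expansion M.+1 h1 zr.
  have -> : (fun w => 1 * (w - z)^-1) = (fun w => (w - z)^-1).
    by apply/funext => w; rewrite mul1r.
  move=> ->; rewrite big_ord_recl /= expr0 mul1r big1 ?addr0.
    have -> : (fun w : C => 1 * w^-1 ^+ 1) = (fun w => w^-1).
      by apply/funext => w; rewrite mul1r expr1.
    by rewrite addrC addrA [- _ + _]addrC subrr add0r.
  move=> i _; have -> : (fun w : C => 1 * w^-1 ^+ (lift ord0 i).+1) = (fun w => w^-1 ^+ i.+2).
    by apply/funext => w; rewrite mul1r lift0.
  by rewrite sq_invX mulr0.
have B M : normc (sq (fun w => (w - z)^-1) - sq (fun w => w^-1)) <= 32 * (1/2) ^+ M.+1.
  rewrite (E M); apply: le_trans (@kernel_remainder _ z M.+1 1 h1 zr _) _.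
    by move=> w _; rewrite normc1.
  rewrite mulr1 ler_wpM2l// lerXn2r ?nnegrE ?divr_ge0 ?normc_ge0 ?half_ge0//; first exact: ltW.
  by rewrite ler_pdivrMr//; lra.
apply/ler_addgt0Pl => e e0; rewrite addr0.
have : (1/2 : R) ^+ n @[n --> \oo] --> (0 : R) by apply: cvg_expr; exact: half_lt1.
move=> /cvgrPdist_lt/(_ (e / 32)); rewrite divr_gt0// => /(_ isT)[n _ /(_ n.+1 (leqnSn n))].
rewrite /= sub0r normrN ger0_norm ?exprn_ge0 ?half_ge0// => h.
by apply: le_trans (B n) _; move: h; set X := _ ^+ _; lra.
Qed.

(** The four sides contribute together the integral of 4r/(t^2 + r^2) over [-r,
    r] to the imaginary part. The integrand is at least 2/r there. That the
    integral does not vanish is all that is needed, because the formulas below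
    divide by it without knowing its value. *)
Lemma winding_ge : 4 <= normc (sq (fun w => w^-1)).
Proof.
apply: le_trans (Im_le_normc _); apply: le_trans (ler_norm _).
rewrite /sq /rint.
have hc : forall w, L w -> ccont (fun w => w^-1) w.
  by move=> w Lw; apply: holo_ccont; apply: holoV; [exact: square_neq|exact: holo_id].
have [|H1 H1P] := @rcont_prim_line R (fun w => w^-1) (0 +i* - r)%C 1 (normc1 _).
  by move=> t; apply: hc; rewrite lineh /L/clines/= eqxx.
have [|H2 H2P] := @rcont_prim_line R (fun w => w^-1) (r +i* 0)%C 'i%C (normci).
  by move=> t; apply: hc; rewrite linev /L/clines/= eqxx !orbT.
have [|H3 H3P] := @rcont_prim_line R (fun w => w^-1) (0 +i* r)%C 1 (normc1 _).
  by move=> t; apply: hc; rewrite lineh /L/clines/= eqxx !orbT.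
have [|H4 H4P] := @rcont_prim_line R (fun w => w^-1) (-r +i* 0)%C 'i%C (normci).
  by move=> t; apply: hc; rewrite linev /L/clines/= eqxx !orbT.
rewrite /lint (cintE _ _ H1P) (cintE _ _ H2P) (cintE _ _ H3P) (cintE _ _ H4P).
pose F t := complex.Im (H1 t) + complex.Im (H2 t) - complex.Im (H3 t) - complex.Im (H4 t).
(* All four sides are parametrised by the same t in [-r, r]. *)
pose F' t : R := 4 * r / (t ^+ 2 + r ^+ 2).
have dF (t : R) : is_derive t 1 F (F' t).
  have [_ d1] := H1P t; have [_ d2] := H2P t; have [_ d3] := H3P t; have [_ d4] := H4P t.
  have N0 : t ^+ 2 + r ^+ 2 != 0.
    by rewrite gt_eqF// ltr_wpDl ?sqr_ge0// exprn_gt0.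
  have -> : F' t = complex.Im ((line (0 +i* - r)%C 1 t)^-1 * 1) + complex.Im ((line (r +i* 0)%C 'i%C t)^-1 * 'i%C)
     - complex.Im ((line (0 +i* r)%C 1 t)^-1 * 1) - complex.Im ((line (-r +i* 0)%C 'i%C t)^-1 * 'i%C).
    have ImV (x y : R) : complex.Im ((x +i* y)%C^-1) = - (y / (x ^+ 2 + y ^+ 2)) by [].
    have ReV (x y : R) : complex.Re ((x +i* y)%C^-1) = x / (x ^+ 2 + y ^+ 2) by [].
    have ImMi (w : C) : complex.Im (w * 'i%C) = complex.Re w.
      by case: w => x y /=; rewrite mulr1 mulr0 addr0.
    rewrite !lineh !linev !ImMi !mulr1 !ImV !ReV /F' !sqrrN [r ^+ 2 + _]addrC.
    by field.
  apply: is_deriveB; apply: is_deriveB; exact: is_deriveD.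
have rr : - r <= r by have := ltW r0; lra.
have [|+ _] := andP (@derivative_mean R F F' (- r) r (2 / r) (4 / r) rr dF _); last first.
  have -> : 2 / r * (r - - r) = 4 by field; rewrite gt_eqF.
  by move=> h; apply: le_trans h _; rewrite /F !(ImB, ImD); lra.
move=> t /andP[ta tb]; have t2 : t ^+ 2 <= r ^+ 2.
  by rewrite -subr_ge0 subr_sqr mulr_ge0//; lra.
have t20 := sqr_ge0 t; have r20 : 0 < r ^+ 2 by rewrite exprn_gt0.
have n0 : 0 < t ^+ 2 + r ^+ 2 by lra.
rewrite /F' ler_pdivlMr// ler_pdivrMr// ![_ / r * _]mulrAC ler_pdivrMr// ler_pdivlMr//.
by rewrite -!mulrA -!expr2; lra.
Qed.

End square.
End holomorphic.

(** * Cauchy's formula, Taylor expansions and power series *)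

Section taylor.
Context {R : realType}.
Local Notation C := (R[i]).
Implicit Types (f g : C -> C) (z w : C) (a b u : nat -> C).

Lemma holo_cderiv f z : holo f z -> exists l, cderiv f z l.
Proof. by move=> /derivable_cderiv; exists ('D_1 (f : R[i]^o -> R[i]^o) z). Qed.

(** The difference quotient of f at z, completed by the derivative, is
    continuous at z and differentiable elsewhere, so that [goursat_except]
    applies to it. *)
Lemma cauchy_formula (r : R) f z : 0 < r -> (forall w, holo f w) -> normc z <= r / 2 ->
  rint (fun w => f w * (w - z)^-1) (- r) r (- r) r =
  f z * rint (fun w => w^-1) (- r) r (- r) r.
Proof.
move=> r0 hf zr; rewrite -(winding r0 zr).
pose D : C := 'D_1 (f : R[i]^o -> R[i]^o) z.
have fD : cderiv f z D by exact: derivable_cderiv (hf z).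
pose G w := if w == z then D else (f w - f z) * (w - z)^-1.
have nearG w : w != z -> exists2 d : R, 0 < d & forall v, normc (v - w) < d ->
    G v = (f v - f z) * (v - z)^-1.
  move=> wz; exists (normc (w - z)); first by rewrite normc_gt0 subr_eq0.
  by move=> v vw; rewrite /G; case: eqP => // vz; move: vw; rewrite vz normcB ltxx.
have hq w : w != z -> holo (fun w => (f w - f z) * (w - z)^-1) w.
  move=> wz; apply: holoM.
    by apply: holoB; [exact: hf|exact: holo_cst].
  by apply: holoV; [rewrite subr_eq0|apply: holoB; [exact: holo_id|exact: holo_cst]].
have dG w : w != z -> exists l, cderiv G w l.
  move=> wz; have /holo_cderiv[l dl] := hq w wz.
  exists l => e e0; have [d d0 dP] := dl e e0; have [d' d'0 d'P] := nearG w wz.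
  exists (Num.min d d'); first by rewrite lt_min d0.
  move=> v; rewrite lt_min => /andP[v1 v2]; rewrite d'P// (d'P w) ?subrr ?normc0//.
  exact: dP.
have cG w : ccont G w.
  have [->|wz] := eqVneq w z; last by have [l] := dG w wz; exact: cderiv_ccont.
  move=> e e0; have [d d0 dP] := fD e e0; exists d => // v vz.
  rewrite /G eqxx; case: eqVneq => [_|vzN]; first by rewrite subrr normc0 ltW.
  have v0 : v - z != 0 by rewrite subr_eq0.
  have v1 : 0 < normc (v - z) by rewrite normc_gt0.
  rewrite -(ler_pM2r v1) -normcM mulrBl mulfVK//; exact: dP.
have zz : in_rect (- r) r (- r) r z && ((- r < complex.Re z < r) && (- r < complex.Im z < r)).
  have h1 := Re_le_normc z; have h2 := Im_le_normc z.
  move: h1 h2 => /le_trans/(_ zr) + /le_trans/(_ zr).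
  by rewrite !ler_norml /in_rect => /andP[a1 a2] /andP[b1 b2]; lra.
have {zz} /and3P[_ z1 z2] := zz.
have G0 := goursat_except cG dG z1 z2.
set L := clines (- r) r (- r) r.
have hk w : L w -> holo (fun w => (w - z)^-1) w.
  move=> Lw; apply: holoV; first exact: (square_sub_neq r0 zr Lw).
  by apply: holoB; [exact: holo_id|exact: holo_cst].
have c1 w : L w -> ccont (fun w => f w * (w - z)^-1) w.
  by move=> Lw; apply: holo_ccont; apply: holoM => //; exact: hk.
have c2 w : L w -> ccont (fun w => - f z * (w - z)^-1) w.
  by move=> Lw; apply: holo_ccont; apply: holoM; [exact: holo_cst|exact: hk].
have c3 w : L w -> ccont (fun w => (w - z)^-1) w by move=> Lw; apply: holo_ccont; exact: hk.
have : rint (fun w => f w * (w - z)^-1 + - f z * (w - z)^-1) (- r) r (- r) r = 0.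
  rewrite -G0; apply: rint_eq => w Lw; rewrite /G -mulrDl.
  by case: eqP => // wz; have := square_sub_neq r0 zr Lw; rewrite wz subrr eqxx.
by rewrite rintD// rintZ// mulNr => /eqP; rewrite subr_eq0 => /eqP.
Qed.

(** The expansion of the kernel under Cauchy's integral. The coefficients may
    still depend on r; [expands_unique] will show that they do not. *)
Lemma taylor_square (r : R) f : 0 < r -> (forall w, holo f w) ->
  exists a, forall S, (forall w, normc w <= 2 * r -> normc (f w) <= S) ->
   (forall n, normc (a n) * r ^+ n <= 4 * S) /\
   forall z, normc z <= r / 2 -> forall M,
     normc (f z - \sum_(n < M) a n * z ^+ n) <= 8 * S * (normc z / r) ^+ M.
Proof.
move=> r0 hf; set k := rint (fun w => w^-1) (- r) r (- r) r.
have k4 : 4 <= normc k := winding_ge r0.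
have nk0 : 0 < normc k by apply: lt_le_trans k4.
have k0 : k != 0 by rewrite -normc_gt0.
pose b n := rint (fun w => f w * w^-1 ^+ n.+1) (- r) r (- r) r.
exists (fun n => b n / k) => S fS; split.
  move=> n; rewrite normcM normcV.
  have B : normc (b n) <= 16 * r * (S * r^-1 ^+ n.+1).
    apply: sq_bound => // w Lw.
      by apply: holoM => //; exact: (invX_holo r0).
    move=> /square_normc_le/fS fw; rewrite normcM normcX normcV.
    apply: ler_pM; rewrite ?normc_ge0 ?exprn_ge0 ?invr_ge0 ?normc_ge0//.
    apply: lerXn2r; rewrite ?nnegrE ?invr_ge0 ?normc_ge0//; first exact: ltW.
    rewrite lef_pV2 ?posrE ?normc_gt0 ?(square_neq r0 Lw)//.
    exact: (square_normc_ge r0 Lw).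
  rewrite mulrAC ler_pdivrMr//; apply: le_trans (ler_wpM2r (exprn_ge0 _ (ltW r0)) B) _.
  have -> : 16 * r * (S * r^-1 ^+ n.+1) * r ^+ n = 16 * S.
    rewrite exprS exprVn; field; by rewrite expf_neq0 ?gt_eqF.
  have S0 : 0 <= S by apply: le_trans (fS 0 _); rewrite ?normc_ge0 ?normc0 ?mulr_ge0// ltW.
  have := mulr_ge0 S0 (_ : 0 <= normc k - 4); rewrite subr_ge0 => /(_ k4); lra.
move=> z zr M.
have -> : f z - \sum_(n < M) b n / k * z ^+ n =
    (z ^+ M * rint (fun w => f w * (w^-1 ^+ M * (w - z)^-1)) (- r) r (- r) r) / k.
  rewrite -[f z](mulfK k0) -cauchy_formula// (rint_kernel_expansion r0 M hf zr).
  rewrite mulrDl mulr_suml addrAC -sumrB big1 ?add0r// => i _.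
  by rewrite /b; ring.
rewrite normcM normcV ler_pdivrMr//.
apply: le_trans (kernel_remainder r0 M hf zr fS) _.
have S0 : 0 <= S by apply: le_trans (fS 0 _); rewrite ?normc_ge0 ?normc0 ?mulr_ge0// ltW.
set X := (normc z / r) ^+ M.
have X0 : 0 <= X by rewrite exprn_ge0// divr_ge0 ?normc_ge0// ltW.
have := mulr_ge0 (mulr_ge0 S0 X0) (_ : 0 <= normc k - 4); rewrite subr_ge0 => /(_ k4); nra.
Qed.

(** An error of order |z|^M near 0 already determines the coefficients, and it
    is stable under linear operations. *)
Definition expands f a := exists S K rho : R, 0 < rho /\
  forall z, normc z <= rho -> forall M,
    normc (f z - \sum_(n < M) a n * z ^+ n) <= S * (K * normc z) ^+ M.

(** By induction: once the coefficients below n agree, the difference of the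
    n-th ones times t^n is O(t^(n+1)) as t tends to 0. *)
Lemma expands_unique f a b : expands f a -> expands f b -> a = b.
Proof.
move=> [S1 [K1 [r1 [r10 H1]]]] [S2 [K2 [r2 [r20 H2]]]].
apply/funext; elim/ltn_ind => n IH; apply/eqP; rewrite -subr_eq0 -normc_eq0.
rewrite eq_le normc_ge0 andbT; apply/ler_addgt0Pl => e e0; rewrite addr0.
pose B := `|S1 * K1 ^+ n.+1| + `|S2 * K2 ^+ n.+1| + 1.
have B0 : 0 < B by rewrite ltr_pwDr// addr_ge0.
pose t := Num.min (Num.min r1 r2) (e / B).
have t0 : 0 < t by rewrite !lt_min r10 r20 divr_gt0.
have [t1 t2 t3] : [/\ t <= r1, t <= r2 & t <= e / B].
  by rewrite /t !ge_min !lexx ?orbT.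
have nt : normc (t%:C%C) = t by rewrite normc_real ger0_norm// ltW.
have := H1 t%:C%C; rewrite nt => /(_ t1 n.+1).
have := H2 t%:C%C; rewrite nt => /(_ t2 n.+1).
rewrite !big_ord_recr /=.
have -> : \sum_(i < n) b i * t%:C%C ^+ i = \sum_(i < n) a i * t%:C%C ^+ i.
  by apply: eq_bigr => i _; rewrite IH.
set s := \sum_(i < n) _ => h2 h1.
have E : (a n - b n) * t%:C%C ^+ n =
   (f t%:C%C - (s + b n * t%:C%C ^+ n)) - (f t%:C%C - (s + a n * t%:C%C ^+ n)) by ring.
have := le_normcD (f t%:C%C - (s + b n * t%:C%C ^+ n)) (- (f t%:C%C - (s + a n * t%:C%C ^+ n))).
rewrite -E normcN normcM normcX nt => h3.
have tn0 : 0 < t ^+ n by rewrite exprn_gt0.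
rewrite -(ler_pM2r tn0); apply: le_trans h3 _; apply: le_trans (lerD h2 h1) _.
rewrite !exprMn !mulrA -mulrDl [t ^+ n.+1]exprS mulrA ler_wpM2r ?(ltW tn0)//.
apply: (@le_trans _ _ (B * t)); last by rewrite mulrC -ler_pdivlMr.
rewrite ler_wpM2r ?(ltW t0)// /B.
have := ler_norm (S1 * K1 ^+ n.+1); have := ler_norm (S2 * K2 ^+ n.+1); lra.
Qed.

Lemma expandsD f g a b : expands f a -> expands g b ->
  expands (fun z => f z + g z) (fun n => a n + b n).
Proof.
move=> [S1 [K1 [r1 [r10 H1]]]] [S2 [K2 [r2 [r20 H2]]]].
exists (`|S1| + `|S2|), (`|K1| + `|K2|), (Num.min r1 r2); rewrite lt_min r10 r20.
split=> // z; rewrite le_min => /andP[z1 z2] M.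
have -> : f z + g z - \sum_(n < M) (a n + b n) * z ^+ n =
   (f z - \sum_(n < M) a n * z ^+ n) + (g z - \sum_(n < M) b n * z ^+ n).
  rewrite addrACA -opprD -big_split /=; congr (_ - _).
  by apply: eq_bigr => i _; rewrite mulrDl.
apply: le_trans (le_normcD _ _) _; rewrite mulrDl; apply: lerD.
  apply: le_trans (H1 z z1 M) _; apply: le_trans (ler_norm _) _.
  rewrite normrM ler_wpM2l// normrX lerXn2r ?nnegrE ?mulr_ge0 ?normc_ge0 ?addr_ge0//.
  by rewrite normrM [`|normc z|]ger0_norm ?normc_ge0// ler_wpM2r ?normc_ge0// lerDl.
apply: le_trans (H2 z z2 M) _; apply: le_trans (ler_norm _) _.
rewrite normrM ler_wpM2l// normrX lerXn2r ?nnegrE ?mulr_ge0 ?normc_ge0 ?addr_ge0//.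
by rewrite normrM [`|normc z|]ger0_norm ?normc_ge0// ler_wpM2r ?normc_ge0// lerDr.
Qed.

Lemma expandsZ f a (l : C) : expands f a ->
  expands (fun z => l * f z) (fun n => l * a n).
Proof.
move=> [S [K [r [r0 H]]]]; exists (normc l * S), K, r; split=> // z zr M.
have -> : l * f z - \sum_(n < M) l * a n * z ^+ n = l * (f z - \sum_(n < M) a n * z ^+ n).
  by rewrite mulrBr mulr_sumr; congr (_ - _); apply: eq_bigr => i _; rewrite mulrA.
by rewrite normcM -mulrA ler_wpM2l ?normc_ge0// H.
Qed.

(** Convergence at a geometric rate, the only kind that occurs. Sums are then
    unique and linear by explicit estimates. *)
Definition sums u (X : C) := exists B : R, forall M,
  normc (X - \sum_(n < M) u n) <= B * (1/2) ^+ M.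

Lemma pow_half_small (B e : R) : 0 < e -> exists n, B * (1/2) ^+ n <= e.
Proof.
move=> e0; have B0 : 0 < `|B| + 1 by rewrite ltr_pwDr.
have : (1/2 : R) ^+ n @[n --> \oo] --> (0 : R) by apply: cvg_expr; exact: half_lt1.
move=> /cvgrPdist_lt/(_ (e / (`|B| + 1))); rewrite divr_gt0// => /(_ isT)[n _ /(_ n (leqnn n))].
rewrite /= sub0r normrN ger0_norm ?exprn_ge0 ?half_ge0// ltr_pdivlMr// => h.
exists n; apply: le_trans (ltW h); rewrite mulrC ler_wpM2l ?exprn_ge0 ?half_ge0//.
by have := ler_norm B; lra.
Qed.

Lemma sums_unique u X Y : sums u X -> sums u Y -> X = Y.
Proof.
move=> [B HB] [B' HB']; apply/eqP; rewrite -subr_eq0 -normc_eq0.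
rewrite eq_le normc_ge0 andbT; apply/ler_addgt0Pl => e e0; rewrite addr0.
have [n hn] := @pow_half_small (B + B') e e0.
apply: le_trans hn; rewrite mulrDl; apply: le_trans (lerD (HB n) (HB' n)).
set s := \sum_(i < n) _; have -> : X - Y = (X - s) - (Y - s) by ring.
by apply: le_trans (le_normcD _ _) _; rewrite normcN.
Qed.

Lemma sums_exist u (B : R) : (forall n, normc (u n) <= B * (1/2) ^+ n) ->
  exists X, forall M, normc (X - \sum_(n < M) u n) <= 4 * B * (1/2) ^+ M.
Proof.
move=> uB.
have B0 : 0 <= B by have := le_trans (normc_ge0 _) (uB 0%N); rewrite expr0 mulr1.
have H (p : C -> R) : (forall x, `|p x| <= normc x) ->
    (forall x y, p (x + y) = p x + p y) ->
    exists X : R, forall M, `|X - p (\sum_(n < M) u n)| <= 2 * B * (1/2) ^+ M.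
  (* Subtracting the bound for the remaining terms makes the partial sums
     increasing. *)
  move=> pn pD; pose x n := p (\sum_(n < n) u n) - 2 * B * (1/2) ^+ n.
  have [||X XP] := @nested_limit R x (4 * B).
  - move=> n; rewrite /x big_ord_recr /= pD exprS.
    have := le_trans (pn (u n)) (uB n); rewrite ler_norml => /andP[h1 h2].
    by move: h1 h2; set e := (1/2) ^+ n; lra.
  - by rewrite mulr_ge0.
  exists X => M; have := XP M; rewrite /x ler_norml; set e := (1/2) ^+ M; lra.
have [X XP] := H _ Re_le_normc ReD.
have [Y YP] := H _ Im_le_normc ImD.
exists (X +i* Y)%C => M; apply: le_trans (normc_le_ReIm _) _; rewrite ReB ImB /=.
by apply: le_trans (lerD (XP M) (YP M)) _; rewrite -mulrDl; set e := (1/2) ^+ M; lra.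
Qed.

Lemma sumsD u (v : nat -> C) X Y : sums u X -> sums v Y -> sums (fun n => u n + v n) (X + Y).
Proof.
move=> [B HB] [B' HB']; exists (B + B') => M.
rewrite big_split /= opprD addrACA mulrDl.
exact: le_trans (le_normcD _ _) (lerD (HB M) (HB' M)).
Qed.

Lemma sumsZ u X (l : C) : sums u X -> sums (fun n => l * u n) (l * X).
Proof.
move=> [B HB]; exists (normc l * B) => M.
by rewrite -mulr_sumr -mulrBr normcM -mulrA ler_wpM2l ?normc_ge0.
Qed.

Definition csum u : C := if pselect (exists X, sums u X) is left p
  then projT1 (cid p) else 0.

Lemma csumE u X : sums u X -> csum u = X.
Proof.
move=> uX; rewrite /csum; case: pselect => [p|[]]; last by exists X.
by apply: sums_unique uX; case: cid.
Qed.

Lemma csumP u (B : R) : (forall n, normc (u n) <= B * (1/2) ^+ n) ->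
  sums u (csum u) /\ forall M, normc (csum u - \sum_(n < M) u n) <= 4 * B * (1/2) ^+ M.
Proof.
move=> /sums_exist[X XP]; have uX : sums u X by exists (4 * B).
by rewrite (csumE uX); split.
Qed.

Definition rapid a := forall r : R, 0 <= r -> exists B : R, forall n, normc (a n) * r ^+ n <= B.

Definition psum a z := csum (fun n => a n * z ^+ n).

Lemma monomial_taylor_bound (rho : R) z w n : 1 <= rho -> normc z <= rho -> normc w <= rho ->
  normc (w ^+ n - z ^+ n - (n%:R * z ^+ n.-1) * (w - z)) <= n%:R ^+ 2 * rho ^+ n * normc (w - z) ^+ 2.
Proof.
move=> r1 zr wr; have r0 : 0 <= rho by lra.
elim: n => [|n IH].
  by rewrite !expr0 subrr !mul0r subrr normc0 expr0n /= !mul0r.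
have -> : w ^+ n.+1 - z ^+ n.+1 - (n.+1%:R * z ^+ n.+1.-1) * (w - z) =
   w * (w ^+ n - z ^+ n - (n%:R * z ^+ n.-1) * (w - z)) + n%:R * z ^+ n.-1 * (w - z) ^+ 2.
  by rewrite /= -[n.+1]addn1 natrD; case: n {IH} => [|n] /=; rewrite ?addn1 !exprS; ring.
apply: le_trans (le_normcD _ _) _.
have nn : normc (n%:R : C) = n%:R.
  by have := normc_real (n%:R : R); rewrite ger0_norm// => <-; rewrite rmorph_nat.
have h1 : normc (w * (w ^+ n - z ^+ n - (n%:R * z ^+ n.-1) * (w - z))) <=
   n%:R ^+ 2 * rho ^+ n.+1 * normc (w - z) ^+ 2.
  rewrite normcM [rho ^+ n.+1]exprS.
  have -> : n%:R ^+ 2 * (rho * rho ^+ n) * normc (w - z) ^+ 2 =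
     rho * (n%:R ^+ 2 * rho ^+ n * normc (w - z) ^+ 2) by ring.
  exact: ler_pM (normc_ge0 _) (normc_ge0 _) wr IH.
have h2 : normc (n%:R * z ^+ n.-1 * (w - z) ^+ 2) <= n%:R * rho ^+ n.+1 * normc (w - z) ^+ 2.
  rewrite !normcM !normcX nn. rewrite ler_wpM2r ?mulr_ge0 ?normc_ge0// ler_wpM2l//.
  apply: (@le_trans _ _ (rho ^+ n.-1)); first by rewrite lerXn2r ?nnegrE ?normc_ge0.
  by rewrite ler_weXn2l// (leq_trans (leq_pred n)).
apply: le_trans (lerD h1 h2) _; rewrite -!mulrDl ler_wpM2r ?exprn_ge0 ?normc_ge0//.
rewrite ler_wpM2r ?exprn_ge0// -[n.+1]addn1 natrD.
have : 0 <= n%:R :> R by []; nra.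
Qed.

(** The terms are differentiated one by one. The second-order remainders add up
    because the decrease of a at the radius 8 rho absorbs the factor n^2 <= 4^n
    of [monomial_taylor_bound] and leaves a geometric series of ratio 1/2. *)
Lemma psum_holo a z : rapid a -> holo (psum a) z.
Proof.
move=> ha; pose rho := normc z + 1.
have r1 : 1 <= rho by rewrite lerDr normc_ge0.
have r0 : 0 <= rho by lra.
have z_r : normc z <= rho by rewrite lerDl.
have [B HB] := ha (8 * rho) (mulr_ge0 (ler0n _ 8) r0).
have B0 : 0 <= B by have := HB 0%N; rewrite expr0 mulr1; apply: le_trans; rewrite normc_ge0.
have nn n : normc (n%:R : C) = n%:R.
  by have := normc_real (n%:R : R); rewrite ger0_norm// => <-; rewrite rmorph_nat.
have n2 n : n%:R ^+ 2 <= 4 ^+ n :> R.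
  have h : n%:R <= 2 ^+ n :> R by rewrite -natrX ler_nat ltnW// ltn_expl.
  have -> : (4 : R) ^+ n = (2 ^+ n) ^+ 2 by rewrite -exprM mulnC exprM; congr (_ ^+ _); rewrite expr2 -natrM.
  by rewrite lerXn2r ?nnegrE ?exprn_ge0.
have n1 n : n%:R <= 4 ^+ n :> R.
  by rewrite -natrX ler_nat ltnW// ltn_expl.
have aB n (x : R) : 0 <= x -> x <= 4 ^+ n * rho ^+ n -> normc (a n) * x <= B * (1/2) ^+ n.
  move=> x0 xr; apply: (@le_trans _ _ (normc (a n) * (4 ^+ n * rho ^+ n))).
    by rewrite ler_wpM2l ?normc_ge0.
  have := ler_wpM2r (exprn_ge0 n half_ge0) (HB n).
  rewrite -mulrA -!exprMn; have -> : 8 * rho * (1/2) = 4 * rho by field.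
  by [].
pose d n := a n * (n%:R * z ^+ n.-1).
have dB n : normc (d n) <= B * (1/2) ^+ n.
  rewrite /d normcM; apply: aB; rewrite ?normc_ge0// normcM nn normcX.
  apply: ler_pM; rewrite ?exprn_ge0 ?normc_ge0//.
  apply: (@le_trans _ _ (rho ^+ n.-1)); first by rewrite lerXn2r ?nnegrE ?normc_ge0.
  by rewrite ler_weXn2l// leq_pred.
have [sd _] := csumP dB.
have zB w n : normc w <= rho -> normc (a n * w ^+ n) <= B * (1/2) ^+ n.
  move=> wr; rewrite normcM; apply: aB; rewrite ?normc_ge0// normcX.
  rewrite -[X in X <= _]mul1r; apply: ler_pM; rewrite ?exprn_ge0 ?normc_ge0//.
    by rewrite exprn_ege1// ler1n.
  by rewrite lerXn2r ?nnegrE ?normc_ge0.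
have [sz _] := csumP (fun n => zB z n z_r).
suff D : cderiv (psum a) z (csum d) by have [] := cderiv_derivable D.
move=> e e0; exists (Num.min 1 (e / (4 * B + 1))).
  by rewrite lt_min ltr01 divr_gt0// ltr_pwDr// mulr_ge0.
move=> w; rewrite lt_min => /andP[w1 w2].
have wr : normc w <= rho.
  by rewrite -(subrK z w) /rho addrC; apply: le_trans (le_normcD _ _) _; rewrite lerD2l ltW.
have [sw _] := csumP (fun n => zB w n wr).
(* The second-order remainder of the n-th term at z. *)
pose u n := a n * w ^+ n + -1 * (a n * z ^+ n) + - (w - z) * d n.
have su : sums u (psum a w + -1 * psum a z + - (w - z) * csum d).
  by apply: sumsD; [apply: sumsD => //; exact: sumsZ|exact: sumsZ].
have uB n : normc (u n) <= B * normc (w - z) ^+ 2 * (1/2) ^+ n.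
  have -> : u n = a n * (w ^+ n - z ^+ n - (n%:R * z ^+ n.-1) * (w - z)).
    by rewrite /u /d; ring.
  rewrite normcM.
  apply: (@le_trans _ _ (normc (a n) * (n%:R ^+ 2 * rho ^+ n * normc (w - z) ^+ 2))).
    by rewrite ler_wpM2l ?normc_ge0// monomial_taylor_bound.
  rewrite mulrA [B * _]mulrC -[leRHS]mulrA [leRHS]mulrC ler_wpM2r ?exprn_ge0 ?normc_ge0//.
  by apply: aB; [rewrite mulr_ge0 ?exprn_ge0|rewrite ler_wpM2r ?exprn_ge0].
have [_ /(_ 0%N)] := csumP uB; rewrite (csumE su) big_ord0 subr0 expr0 mulr1.
have -> : psum a w + -1 * psum a z + - (w - z) * csum d =
   psum a w - psum a z - csum d * (w - z) by ring.
move=> /le_trans; apply; rewrite expr2 !mulrA ler_wpM2r ?normc_ge0//.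
move: w2; rewrite ltr_pdivlMr ?ltr_pwDr ?mulr_ge0//; have := normc_ge0 (w - z); lra.
Qed.

(** The remainder after M terms is z^M times a series bounded on the unit disc.
    *)
Lemma expands_psum a : rapid a -> expands (psum a) a.
Proof.
move=> ha; have [B HB] := ha 4 (ler0n _ 4).
have B0 : 0 <= B by have := HB 0%N; rewrite expr0 mulr1; apply: le_trans; rewrite normc_ge0.
have cB n : normc (a n * (2 : C) ^+ n) <= B * (1/2) ^+ n.
  have n2 : normc (2 : C) = 2.
    by have := normc_real (2 : R); rewrite ger0_norm// => <-; rewrite rmorph_nat.
  rewrite normcM normcX n2; have := ler_wpM2r (exprn_ge0 n half_ge0) (HB n).
  by rewrite -mulrA -exprMn; have -> : 4 * (1/2) = 2 :> R by field.
exists (4 * B), 1, 1; split=> // z z1 M; rewrite mul1r.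
have zB n : normc (a (M + n)%N * z ^+ (M + n)) <= B * normc z ^+ M * (1/2) ^+ n.
  rewrite normcM normcX exprD mulrA [B * _]mulrC -[leRHS]mulrA mulrAC [leRHS]mulrC.
  rewrite ler_wpM2r ?exprn_ge0 ?normc_ge0//.
  apply: (@le_trans _ _ (normc (a (M + n)%N))).
    by rewrite -[leRHS]mulr1 ler_wpM2l ?normc_ge0// exprn_ile1 ?normc_ge0.
  apply: (@le_trans _ _ (B * (1/2) ^+ (M + n))).
    apply: le_trans (cB _); rewrite normcM -[X in X <= _]mulr1 ler_wpM2l ?normc_ge0//.
    rewrite normcX exprn_ege1//.
    by have := normc_real (2 : R); rewrite ger0_norm// rmorph_nat => ->; rewrite ler1n.
  rewrite ler_wpM2l// exprD -[leRHS]mul1r ler_wpM2r ?exprn_ge0 ?half_ge0//.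
  by rewrite exprn_ile1 ?half_ge0//; lra.
have [[B' sB'] /(_ 0%N)] := csumP zB; rewrite big_ord0 subr0 expr0 mulr1 => le4.
suff -> : psum a z - \sum_(n < M) a n * z ^+ n = csum (fun n => a (M + n)%N * z ^+ (M + n)).
  by rewrite -mulrA.
have zB0 n : normc (a n * z ^+ n) <= B * (1/2) ^+ n.
  rewrite normcM normcX; apply: (@le_trans _ _ (normc (a n))).
    by rewrite -[leRHS]mulr1 ler_wpM2l ?normc_ge0// exprn_ile1 ?normc_ge0.
  apply: le_trans (cB _); rewrite normcM -[X in X <= _]mulr1 ler_wpM2l ?normc_ge0//.
  rewrite normcX exprn_ege1//.
  by have := normc_real (2 : R); rewrite ger0_norm// rmorph_nat => ->; rewrite ler1n.
have [[B'' sB''] _] := csumP zB0.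
apply/esym/csumE; exists (B'' * (1/2) ^+ M) => N.
have := sB'' (M + N)%N; rewrite big_split_ord /= exprD mulrA opprD addrA.
by [].
Qed.

Lemma psum_normc_le a (r B : R) z : (forall n, normc (a n) * (2 * r) ^+ n <= B) ->
  normc z <= r -> normc (psum a z) <= 4 * B.
Proof.
move=> aB zr; have r0 : 0 <= r by apply: le_trans zr; exact: normc_ge0.
have zB n : normc (a n * z ^+ n) <= B * (1/2) ^+ n.
  rewrite normcM normcX; apply: (@le_trans _ _ (normc (a n) * r ^+ n)).
    by rewrite ler_wpM2l ?normc_ge0// lerXn2r ?nnegrE ?normc_ge0.
  have := ler_wpM2r (exprn_ge0 n half_ge0) (aB n).
  rewrite -mulrA -exprMn; have -> : 2 * r * (1/2) = r by field.
  by [].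
by have [_ /(_ 0%N)] := csumP zB; rewrite big_ord0 subr0 expr0 mulr1.
Qed.

End taylor.

(** * Weighted norms on polynomials *)

Section powers_of_two.
Context {R : realType}.

Definition pw (z : int) : R := 2 ^ z.

Lemma pwD a b : pw (a + b) = pw a * pw b.
Proof. by rewrite /pw expfzDr. Qed.

Lemma pw_gt0 a : 0 < pw a. Proof. by rewrite exprz_gt0. Qed.

Lemma pw_ge0 a : 0 <= pw a. Proof. exact: ltW (pw_gt0 a). Qed.

Lemma pw0 : pw 0 = 1. Proof. by rewrite /pw expr0z. Qed.

Lemma pw1 : pw 1 = 2. Proof. by rewrite /pw expr1z. Qed.

Lemma pw_nat (n : nat) : pw n%:Z = 2 ^+ n. Proof. by []. Qed.

Lemma pw_le a b : a <= b -> pw a <= pw b.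
Proof. by move=> ab; rewrite /pw ler_weXz2l// ler1n. Qed.

Lemma pw_le1 a : a <= 0 -> pw a <= 1.
Proof. by move=> a0; rewrite -pw0 pw_le. Qed.

Lemma pwNK a : pw (- a) * pw a = 1.
Proof. by rewrite -pwD addNr pw0. Qed.

Lemma le_pwN (x B : R) (a : int) : x * pw a <= B -> x <= B * pw (- a).
Proof.
move=> h; rewrite -[x]mulr1 -(pwNK a) [pw (- a) * _]mulrC mulrA.
by rewrite ler_wpM2r ?pw_ge0.
Qed.

Definition cpw (z : int) : R[i] := (pw z)%:C%C.

Lemma normc_cpw z : normc (cpw z) = pw z.
Proof. by rewrite normc_real ger0_norm// pw_ge0. Qed.

Lemma cpwD a b : cpw (a + b) = cpw a * cpw b.
Proof. by rewrite /cpw pwD rmorphM. Qed.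

Lemma cpwNK a : cpw (- a) * cpw a = 1.
Proof. by rewrite -cpwD addNr /cpw pw0. Qed.

Lemma cpw_neq0 z : cpw z != 0.
Proof. by rewrite -normc_gt0 normc_cpw pw_gt0. Qed.

End powers_of_two.

Section l1_norm.
Context {R : realType}.
Local Notation C := (R[i]).
Implicit Types (c f g : {poly C}) (j n : nat).

Definition l1 j c : R := \sum_(i < size c) normc c`_i * pw (j * i)%:Z.

Lemma l1_widen j c n : (size c <= n)%N ->
  l1 j c = \sum_(i < n) normc c`_i * pw (j * i)%:Z.
Proof.
move=> cn; rewrite /l1 (big_ord_widen _ (fun i => normc c`_i * pw (j * i)%:Z) cn).
rewrite big_mkcond /=; apply: eq_bigr => i _; case: ltnP => // ci.
by rewrite nth_default// normc0 mul0r.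
Qed.

Lemma l1_ge0 j c : 0 <= l1 j c.
Proof. by apply: sumr_ge0 => i _; rewrite mulr_ge0 ?normc_ge0 ?pw_ge0. Qed.

Lemma l1D j f g : l1 j (f + g) <= l1 j f + l1 j g.
Proof.
set n := maxn (size f) (size g).
rewrite !(@l1_widen _ _ n) ?leq_maxl ?leq_maxr ?size_polyD// -big_split /=.
apply: ler_sum => i _; rewrite -mulrDl ler_wpM2r ?pw_ge0// coefD; exact: le_normcD.
Qed.

Lemma l1Z j (a : C) f : l1 j (a *: f) = normc a * l1 j f.
Proof.
rewrite (@l1_widen _ _ (size f)) ?size_scale_leq// /l1 mulr_sumr.
by apply: eq_bigr => i _; rewrite coefZ normcM mulrA.
Qed.

Lemma l1_0 j : l1 j 0 = 0.
Proof. by rewrite /l1 size_poly0 big_ord0. Qed.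

Lemma l1N j f : l1 j (- f) = l1 j f.
Proof. by rewrite -scaleN1r l1Z normcN normc1 mul1r. Qed.

Lemma l1_sum j (I : Type) (s : seq I) (P : pred I) (F : I -> {poly C}) :
  l1 j (\sum_(i <- s | P i) F i) <= \sum_(i <- s | P i) l1 j (F i).
Proof.
elim/big_rec2 : _ => [|i x y _ IH]; first by rewrite l1_0.
by apply: le_trans (l1D _ _ _) _; rewrite lerD2l.
Qed.

Lemma l1_Xn j n : l1 j 'X^n = pw (j * n)%:Z.
Proof.
rewrite /l1 size_polyXn big_ord_recr /= coefXn eqxx normc1 mul1r big1 ?add0r//.
by move=> i _; rewrite coefXn ltn_eqF// normc0 mul0r.
Qed.

Lemma l1_coef j c n : normc c`_n * pw (j * n)%:Z <= l1 j c.
Proof.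
have [cn|nc] := leqP (size c) n.
  by rewrite nth_default// normc0 mul0r l1_ge0.
rewrite /l1 (bigD1 (Ordinal nc)) //= lerDl.
by apply: sumr_ge0 => i _; rewrite mulr_ge0 ?normc_ge0 ?pw_ge0.
Qed.

Lemma l1_le j n c : (size c <= n.+1)%N -> l1 j c <= pw (j * n)%:Z * l1 0 c.
Proof.
move=> cn; rewrite /l1 mulr_sumr; apply: ler_sum => i _.
rewrite mul0n mulr1 mulrC ler_wpM2r ?normc_ge0// pw_le//.
rewrite lez_nat leq_mul2l; apply/orP; right.
by rewrite -ltnS (leq_trans (ltn_ord i)).
Qed.

Lemma l1M f g : l1 0 (f * g) <= l1 0 f * l1 0 g.
Proof.
rewrite -[f]coefK poly_def mulr_suml; apply: le_trans (l1_sum _ _ _ _) _.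
have -> : l1 0 (\sum_(i < size f) f`_i *: 'X^i) = \sum_(i < size f) normc f`_i.
  by rewrite -poly_def coefK /l1; apply: eq_bigr => i _; rewrite mul0n mulr1.
rewrite mulr_suml; apply: ler_sum => i _.
rewrite -scalerAl l1Z ler_wpM2l ?normc_ge0//.
rewrite mulrC (@l1_widen _ _ (i + size g)); last first.
  by have [->|g0] := eqVneq g 0; rewrite ?mul0r ?size_poly0// size_mulXn// .
rewrite big_split_ord /= big1 ?add0r => [|k _]; last first.
  by rewrite coefMXn ltn_ord normc0 mul0r.
rewrite le_eqVlt; apply/orP; left; apply/eqP; rewrite /l1; apply: eq_bigr => k _.
by rewrite coefMXn ltnNge leq_addr /= addKn !mul0n.
Qed.

End l1_norm.

(** * Coordinates in a graded basis *)

Section coordinates.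
Context {R : realType}.
Local Notation C := (R[i]).
Variable p : nat -> {poly C}.
Hypothesis hp : forall n, size (p n) = n.+1.
Implicit Types (c f g : {poly C}) (j n : nat).

(** Coordinates in the basis p are stored in a polynomial: X^n stands for the
    n-th basis vector. Thus [comb] maps coordinates to the vector and [coord]
    is its inverse. *)
Definition comb c : {poly C} := \sum_(i < size c) c`_i *: p i.

Lemma comb_widen c n : (size c <= n)%N -> comb c = \sum_(i < n) c`_i *: p i.
Proof.
move=> cn; rewrite /comb (big_ord_widen _ (fun i => c`_i *: p i) cn).
rewrite big_mkcond /=; apply: eq_bigr => i _; case: ltnP => // ci.
by rewrite nth_default// scale0r.
Qed.

Lemma combD f g : comb (f + g) = comb f + comb g.
Proof.
set n := maxn (size f) (size g).
rewrite !(@comb_widen _ n) ?leq_maxl ?leq_maxr ?size_polyD// -big_split /=.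
by apply: eq_bigr => i _; rewrite coefD scalerDl.
Qed.

Lemma combZ (a : C) f : comb (a *: f) = a *: comb f.
Proof.
rewrite (@comb_widen _ (size f)) ?size_scale_leq// /comb scaler_sumr.
by apply: eq_bigr => i _; rewrite coefZ scalerA.
Qed.

Lemma comb0 : comb 0 = 0.
Proof. by rewrite /comb size_poly0 big_ord0. Qed.

Lemma comb_sum (I : Type) (s : seq I) (P : pred I) (F : I -> {poly C}) :
  comb (\sum_(i <- s | P i) F i) = \sum_(i <- s | P i) comb (F i).
Proof. exact: (big_morph comb combD comb0). Qed.

Lemma combXn n : comb 'X^n = p n.
Proof.
rewrite /comb size_polyXn big_ord_recr /= coefXn eqxx scale1r big1 ?add0r//.
by move=> i _; rewrite coefXn ltn_eqF// scale0r.
Qed.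

Lemma size_comb c : size (comb c) = size c.
Proof.
have [->|c0] := eqVneq c 0; first by rewrite /comb size_poly0 big_ord0 size_poly0.
have [m cm] : exists m, size c = m.+1.
  by exists (size c).-1; rewrite prednK// lt0n size_poly_eq0.
rewrite /comb cm big_ord_recr /= addrC size_polyDl.
  rewrite size_scale ?hp//; have := lead_coef_eq0 c.
  by rewrite /lead_coef cm /= => ->.
rewrite size_scale ?hp; last first.
  by have := lead_coef_eq0 c; rewrite /lead_coef cm /= => ->.
apply: (leq_ltn_trans (size_sum _ _ _)); rewrite ltnS; apply/bigmax_leqP => i _.
by apply: leq_trans (size_scale_leq _ _) _; rewrite hp.
Qed.

Lemma comb_inj : injective comb.
Proof.
move=> f g fg; apply/eqP; rewrite -subr_eq0 -size_poly_eq0 -size_comb.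
by rewrite combD -scaleN1r combZ scaleN1r fg subrr size_poly0.
Qed.

Fixpoint coord_rec n f : {poly C} :=
  if n is m.+1 then
    let a := f`_m / lead_coef (p m) in a *: 'X^m + coord_rec m (f - a *: p m)
  else 0.

Definition coord f := coord_rec (size f) f.

Lemma coordK f : comb (coord f) = f.
Proof.
rewrite /coord; have := leqnn (size f); move: {2 3}(size f) => n.
elim: n f => [|n IH] f fn /=.
  by rewrite /comb size_poly0 big_ord0; apply/esym/eqP; rewrite -size_poly_leq0.
rewrite combD combZ combXn IH ?[_ + (_ - _)]addrC ?subrK//.
apply/leq_sizeP => i; rewrite leq_eqVlt => /predU1P[<-|ni].
  rewrite coefB coefZ /lead_coef hp /= mulfVK ?subrr//.
  by have := lead_coef_eq0 (p n); rewrite /lead_coef hp /= => ->; rewrite -size_poly_eq0 hp.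
by rewrite coefB coefZ [f`_i]nth_default ?(leq_trans fn)// [(p n)`_i]nth_default ?hp// mulr0 subrr.
Qed.

Lemma combK c : coord (comb c) = c.
Proof. by apply: comb_inj; rewrite coordK. Qed.

Lemma coordD f g : coord (f + g) = coord f + coord g.
Proof. by apply: comb_inj; rewrite combD !coordK. Qed.

Lemma coordZ (a : C) f : coord (a *: f) = a *: coord f.
Proof. by apply: comb_inj; rewrite combZ !coordK. Qed.

Lemma coord_sum (I : Type) (s : seq I) (P : pred I) (F : I -> {poly C}) :
  coord (\sum_(i <- s | P i) F i) = \sum_(i <- s | P i) coord (F i).
Proof.
apply: (big_morph coord coordD); by apply: comb_inj; rewrite coordK comb0.
Qed.

Lemma coord_p n : coord (p n) = 'X^n.
Proof. by rewrite -combXn combK. Qed.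

Lemma size_coord f : size (coord f) = size f.
Proof. by rewrite -{2}(coordK f) size_comb. Qed.

(** The norm of sum a_n p_n is the sum of |a_n| 2^(jn): under the
    identification of coordinates with Taylor coefficients it dominates the
    supremum on the disc of radius j. *)
Definition pnorm j f : R := l1 j (coord f).

Lemma pnorm_ge0 j f : 0 <= pnorm j f. Proof. exact: l1_ge0. Qed.

Lemma pnormD j f g : pnorm j (f + g) <= pnorm j f + pnorm j g.
Proof. by rewrite /pnorm coordD l1D. Qed.

Lemma pnormZ j (a : C) f : pnorm j (a *: f) = normc a * pnorm j f.
Proof. by rewrite /pnorm coordZ l1Z. Qed.

Lemma pnormN j f : pnorm j (- f) = pnorm j f.
Proof. by rewrite -scaleN1r pnormZ normcN normc1 mul1r. Qed.

Lemma pnormB j f g : pnorm j (f - g) <= pnorm j f + pnorm j g.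
Proof. by apply: le_trans (pnormD _ _ _) _; rewrite pnormN. Qed.

Lemma pnorm_p j n : pnorm j (p n) = pw (j * n)%:Z.
Proof. by rewrite /pnorm coord_p l1_Xn. Qed.

Lemma pnorm0 j : pnorm j 0 = 0.
Proof. by rewrite -(scale0r 0) pnormZ normc0 mul0r. Qed.

Lemma pnorm_sum j (I : Type) (s : seq I) (P : pred I) (F : I -> {poly C}) :
  pnorm j (\sum_(i <- s | P i) F i) <= \sum_(i <- s | P i) pnorm j (F i).
Proof.
elim/big_rec2 : _ => [|i x y _ IH]; first by rewrite pnorm0.
by apply: le_trans (pnormD _ _ _) _; rewrite lerD2l.
Qed.

(** The norms differ on polynomials of degree at most n by a factor 2^(jn)
    only, which reduces most estimates to j = 0. *)
Lemma pnorm_deg j n f : (size f <= n.+1)%N -> pnorm j f <= pw (j * n)%:Z * pnorm 0 f.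
Proof. by move=> fn; apply: l1_le; rewrite size_coord. Qed.

Lemma pnorm_deg_pw j n f (a : int) : (size f <= n.+1)%N -> pnorm 0 f <= pw a ->
  pnorm j f <= pw ((j * n)%:Z + a).
Proof.
move=> fn fa; apply: le_trans (pnorm_deg j fn) _.
by rewrite pwD ler_wpM2l// pw_ge0.
Qed.

Lemma pnormM j f g (B : R) :
  (forall i, (i < size f)%N -> pnorm j ('X^i * g) <= B) ->
  pnorm j (f * g) <= l1 0 f * B.
Proof.
move=> gB; rewrite -[f in f * g]coefK poly_def mulr_suml.
apply: le_trans (pnorm_sum _ _ _ _) _.
rewrite /l1 mulr_suml; apply: ler_sum => i _.
by rewrite -scalerAl pnormZ mul0n mulr1 ler_wpM2l ?normc_ge0// gB.
Qed.

End coordinates.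

(** * One block of the basis *)

Section block.
Context {R : realType}.
Local Notation C := (R[i]).

(** The exponent of the weight of X^n, n = rk + s, outside the windows s <= N.
    On the first half of a row it is a large constant, so that X^n has tiny
    norm and leaving a window costs nothing despite the factor 2^((J+1)k) of
    its elements. Then it decreases with slope 2 to reach about 0 when the next
    window begins, so that X stays bounded along the row. The rows r >= 1 have
    twice the exponent of the row 0: moving by X^k from the row 0, where n may
    be small compared with k, must gain a factor that pays for the increase of
    the degree by k. *)
Definition muexp (J k n : nat) : nat :=
  ((if n < k then J.+2 else 2 * J.+2) * minn k (2 * (k - n %% k)))%N.

(** The elements of the block of q above p_0, ..., p_N, arranged in rows of
    length k; a row r >= 1 begins with its window s <= N. *)
Definition block (N : nat) (q : {poly C}) (J k n : nat) : {poly C} :=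
  if (k <= n)%N && (n %% k <= N)%N
  then cpw (J.+1 * k)%N *: ('X^n - q * 'X^(n - k))
  else cpw (muexp J k n) *: 'X^n.

Lemma size_block N (q : {poly C}) J k n : (0 < k)%N -> (size q <= k)%N -> size (block N q J k n) = n.+1.
Proof.
move=> k0 qk; rewrite /block; case: ifP => [/andP[kn _]|_].
  rewrite size_scale ?cpw_neq0// size_polyDl ?size_polyXn// size_polyN.
  have [->|q0] := eqVneq q 0; first by rewrite mul0r size_poly0.
  by rewrite size_mulXn// ltnS -(subnKC kn) addKn addnC leq_add2r.
by rewrite size_scale ?cpw_neq0// size_polyXn.
Qed.

End block.

(** A single block, with a bound 2^al for the monomials up to N and the
    information [hT] on the monomials beyond the block, to be provided by the
    following block. The shifts X^e, e <= E, are to stay bounded on the whole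
    basis, and D bounds the additional shifts; k is large compared with all of
    these. *)
Section step.
Context {R : realType}.
Local Notation C := (R[i]).
Variable p : nat -> {poly C}.
Hypothesis hp : forall n, size (p n) = n.+1.
Variables (N E al : nat) (q : {poly C}) (J ka D k : nat).
Local Notation H := J.+2.
Let top := (J.+3 * k + N)%N.
Hypothesis EN : (E <= N)%N.
Hypothesis ED : (E <= D)%N.
Hypothesis hq : 1 + l1 0 q <= pw ka.
Hypothesis hk : (16 * J.+2 * D + 8 * D + 8 * N + 8 * size q + al + J.+4 * ka + 16 <= k)%N.
Hypothesis hb : forall n, (N < n <= top)%N -> p n = block N q J k n.
Hypothesis hA : forall i, (i <= N)%N -> pnorm p 0 'X^i <= pw al.
Hypothesis hT : forall i, (top < i <= 2 * top)%N ->
  pnorm p 0 'X^i <= pw (- (4 * top)%:Z).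

Let g s := minn k (2 * (k - s)).
Let h r := (if r is 0%N then H else 2 * H)%N.

Let k_gt0 : (0 < k)%N. Proof. lia. Qed.

Let rows r : (r < J.+3)%N -> (r * k + k <= J.+3 * k)%N.
Proof. by move=> rR; rewrite -mulSnr leq_mul2r rR orbT. Qed.

Let topk : (3 * k <= top)%N.
Proof. by rewrite /top (leq_trans _ (leq_addr _ _))// leq_mul2r orbC. Qed.

Lemma p_window r s : (r < J.+3)%N -> (s <= N)%N ->
  p (r.+1 * k + s) = cpw (J.+1 * k)%N *: ('X^(r.+1 * k + s) - q * 'X^(r * k + s)).
Proof.
move=> rR sN; have rk := rows rR.
rewrite hb; last by rewrite /top mulSnr; lia.
rewrite /block modnMDl modn_small; last by lia.
by rewrite sN mulSnr addnAC leq_addl /= addnK.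
Qed.

Lemma p_mono r s : (r < J.+3)%N -> (N < s < k)%N ->
  p (r * k + s) = cpw (h r * g s)%N *: 'X^(r * k + s).
Proof.
move=> rR /andP[Ns sk]; have rk := rows rR.
rewrite hb; last by rewrite /top; lia.
rewrite /block /muexp modnMDl modn_small// leqNgt [(s <= N)%N]leqNgt Ns andbF.
by case: r {rR rk} => [|r] /=; rewrite ?mul0n ?sk// mulSnr ltnNge addnAC leq_addl.
Qed.

Lemma Xn_mono r s : (r < J.+3)%N -> (N < s < k)%N ->
  'X^(r * k + s) = cpw (- (h r * g s)%N%:Z) *: p (r * k + s).
Proof. by move=> rR sk; rewrite p_mono// scalerA cpwNK scale1r. Qed.

Lemma Xn_window r s : (r < J.+3)%N -> (s <= N)%N ->
  'X^(r.+1 * k + s) = cpw (- (J.+1 * k)%N%:Z) *: p (r.+1 * k + s) + q * 'X^(r * k + s).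
Proof. by move=> rR sN; rewrite p_window// scalerA cpwNK scale1r subrK. Qed.

Lemma pnorm0_mono r s : (r < J.+3)%N -> (N < s < k)%N ->
  pnorm p 0 'X^(r * k + s) = pw (- (h r * g s)%N%:Z).
Proof. by move=> rR sk; rewrite Xn_mono// pnormZ// normc_cpw pnorm_p// mul0n mulr1. Qed.

Let A' := (al + J.+3 * ka)%N.

(** In the windows X^n = 2^-((J+1)k) p_n + q X^(n-k), so that the bound for
    monomials grows by the factor 2^ka from one row to the next. *)
Lemma pnorm0_row r i : (r < J.+3)%N -> (i < r.+1 * k)%N -> (i <= top)%N ->
  pnorm p 0 'X^i <= pw (al + r * ka)%N.
Proof.
elim: r i => [|r IH] i rR; rewrite mulSnr.
  rewrite mul0n add0n addn0 => ik _; have [iN|Ni] := leqP i N; first exact: hA.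
  have -> : i = (0 * k + i)%N by rewrite mul0n.
  rewrite pnorm0_mono ?Ni//; apply: pw_le; lia.
move=> ik itop; have [ir|ri] := ltnP i (r.+1 * k)%N.
  apply: le_trans (IH i (ltnW rR) ir itop) _; apply: pw_le; lia.
rewrite -(subnKC ri); set s := (i - _)%N; have sk : (s < k)%N by rewrite /s; lia.
have [sN|Ns] := leqP s N; last first.
  by rewrite pnorm0_mono ?Ns//; apply: pw_le; lia.
rewrite Xn_window//; last exact: ltnW.
apply: le_trans (pnormD hp _ _ _) _; rewrite pnormZ// normc_cpw pnorm_p// mul0n mulr1.
apply: (@le_trans _ _ (1 + l1 0 q * pw (al + r * ka)%N)).
  apply: lerD; first by apply: pw_le1; lia.
  apply: pnormM => // t tq; rewrite -exprD; apply: IH; first exact: ltnW.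
    by rewrite mulSnr; lia.
  by have := rows (ltnW rR); rewrite /top; lia.
have -> : (al + r.+1 * ka)%N%:Z = ka%:Z + (al + r * ka)%N%:Z by rewrite mulSnr; lia.
rewrite pwD; apply: le_trans (ler_wpM2r (pw_ge0 _) hq).
rewrite mulrDl mul1r lerD2r -(@pw0 R) pw_le//; lia.
Qed.

Lemma pnorm0_top i : (i <= top)%N -> pnorm p 0 'X^i <= pw A'.
Proof.
move=> it; have [ir|ri] := ltnP i (J.+3 * k)%N.
  by apply: le_trans (@pnorm0_row J.+2 _ _ ir it) _ => //; apply: pw_le; rewrite /A'; lia.
(* X^i lies in the last window, which is treated as in [pnorm0_row]. *)
rewrite -(subnKC ri); set s := (i - _)%N; have sN : (s <= N)%N by rewrite /s /top in it *; lia.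
rewrite Xn_window//.
apply: le_trans (pnormD hp _ _ _) _; rewrite pnormZ// normc_cpw pnorm_p// mul0n mulr1.
apply: (@le_trans _ _ (1 + l1 0 q * pw (al + J.+2 * ka)%N)).
  apply: lerD; first by apply: pw_le1; lia.
  apply: pnormM => // t tq; rewrite -exprD; apply: pnorm0_row => //.
    by rewrite mulSnr; lia.
  by have := @rows J.+2 (ltnSn _); rewrite /top; lia.
have -> : A'%:Z = ka%:Z + (al + J.+2 * ka)%N%:Z by rewrite /A' mulSnr; lia.
rewrite pwD; apply: le_trans (ler_wpM2r (pw_ge0 _) hq).
rewrite mulrDl mul1r lerD2r -(@pw0 R) pw_le//; lia.
Qed.

Lemma pnorm0_all i : (i <= 2 * top)%N -> pnorm p 0 'X^i <= pw A'.
Proof.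
move=> i2; have [it|ti] := leqP i top; first exact: pnorm0_top.
by apply: le_trans (hT _) _; [rewrite ti|apply: pw_le; lia].
Qed.

(** Row J+3 consists of a window only; behind it the bound comes from the next
    block. *)
Lemma pnorm0_early r s : (r <= J.+3)%N -> (N < s)%N -> (2 * s <= k)%N ->
  pnorm p 0 'X^(r * k + s) <= pw (- (h r * k)%N%:Z).
Proof.
move=> rR Ns sk; have gE : g s = k by rewrite /g; lia.
move: rR; rewrite leq_eqVlt => /predU1P[->|rR].
  apply: le_trans (hT _) _; first by rewrite /top; move: topk; rewrite /top; lia.
  by apply: pw_le; rewrite /h /top [(J.+3 * k)%N]mulSnr; lia.
by rewrite pnorm0_mono ?gE//; lia.
Qed.

Lemma pnorm_early j r s : (r <= J.+3)%N -> (N < s)%N -> (2 * s <= k)%N ->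
  pnorm p j 'X^(r * k + s) <= pw ((j * (r * k + s))%N%:Z - (h r * k)%N%:Z).
Proof.
move=> rR Ns sk; apply: pnorm_deg_pw => //; first by rewrite size_polyXn.
exact: pnorm0_early.
Qed.

(** The purpose of the block: (X^k - q) X^s is 2^-((J+1)k) times the basis
    element p_(k+s) of norm 2^(j(k+s)), a small number for j <= J. *)
Lemma pnorm_window_diff j (f : {poly C}) : (size f <= N.+1)%N ->
  pnorm p j (('X^k - q) * f) <= l1 0 f * pw ((j * (k + N))%N%:Z - (J.+1 * k)%N%:Z).
Proof.
move=> fN; rewrite mulrC; apply: pnormM => // s sf.
have sN : (s <= N)%N by rewrite -ltnS (leq_trans sf).
have -> : 'X^s * ('X^k - q) = cpw (- (J.+1 * k)%N%:Z) *: p (1 * k + s).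
  rewrite p_window// scalerA cpwNK scale1r mul1n mul0n add0n mulrBr -exprD addnC.
  by rewrite [q * _]mulrC.
rewrite pnormZ// normc_cpw pnorm_p// -pwD; apply: pw_le; rewrite mul1n.
have : (j * (k + s) <= j * (k + N))%N by rewrite leq_mul2l leq_add2l sN orbT.
by lia.
Qed.

Lemma kaA : (ka + A' <= k)%N.
Proof.
have : (J.+4 * ka = J.+3 * ka + ka)%N by rewrite mulSnr.
by rewrite /A'; lia.
Qed.

Lemma shift_bounds : (16 * (J.+2 * D) <= k)%N /\ (4 * (J.+2 * D) + A' + D <= k)%N.
Proof.
have HD : (16 * J.+2 * D = 16 * (J.+2 * D))%N by rewrite mulnA.
have Ha : (J.+4 * ka = J.+3 * ka + ka)%N by rewrite mulSnr.
by have := leq0n (J.+2 * D); split; rewrite /A'; lia.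
Qed.

(** Shifting by X^(mk+t) maps an element of a window to the element at the
    corresponding place of another window, or to monomials right behind the
    windows, whose weights absorb the factor 2^((J+1)k). *)
Lemma window_shift j r m s t : (r < J.+3)%N -> (r.+1 + m <= J.+3)%N -> (s <= N)%N ->
  (2 * (N + t + size q) <= k)%N ->
  pnorm p j ('X^(m * k + t) * p (r.+1 * k + s)) <=
  pw (j * (m * k + t + (r.+1 * k + s)))%N%:Z.
Proof.
move=> rR rm sN tk; rewrite p_window// -scalerAr mulrBr -exprD mulrCA -exprD.
have -> : (m * k + t + (r.+1 * k + s) = (r.+1 + m) * k + (s + t))%N by lia.
have -> : (m * k + t + (r * k + s) = (r + m) * k + (s + t))%N by lia.
have [st|st] := leqP (s + t) N.
  case: (ltnP (r + m) J.+3) => [rm3|]; last by lia.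
  have := p_window rm3 st; rewrite -addSn => <-.
  by rewrite pnorm_p.
rewrite -[leRHS]mulr1 -(@pw0 R) -pwD; apply: pnorm_deg_pw => //.
  apply: leq_trans (size_scale_leq _ _) _.
  have [->|q0] := eqVneq q 0; first by rewrite mul0r subr0 size_polyXn.
  have -> : ((r.+1 + m) * k = (r + m) * k + k)%N by rewrite addSn mulSnr.
  rewrite size_polyDl ?size_polyXn//.
  have qk : (size q <= k)%N by lia.
  by rewrite size_polyN size_mulXn// ltnS addnAC leq_add2r leq_add2l.
rewrite pnormZ// normc_cpw.
have B1 : pnorm p 0 'X^((r.+1 + m) * k + (s + t)) <= pw (- (H * k)%N%:Z).
  apply: le_trans (@pnorm0_early _ _ _ st _) _ => //; first lia.
  by apply: pw_le; have := leq0n (H * k); rewrite /h addSn; lia.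
have B2 : pnorm p 0 (q * 'X^((r + m) * k + (s + t))) <= l1 0 q * pw (- (H * k)%N%:Z).
  apply: pnormM => // i iq; rewrite -exprD.
  have -> : (i + ((r + m) * k + (s + t)) = (r + m) * k + (s + t + i))%N by lia.
  apply: le_trans (@pnorm0_early _ _ _ _ _) _; [lia|lia|lia|].
  by apply: pw_le; have := leq0n (H * k); rewrite /h; case: (r + m)%N => [|n]; lia.
apply: (@le_trans _ _ (pw (J.+1 * k)%N * (pw ka * pw (- (H * k)%N%:Z)))).
  rewrite ler_wpM2l ?pw_ge0//; apply: le_trans (pnormB hp _ _ _) _.
  apply: le_trans (lerD B1 B2) _; rewrite -{1}[pw (- _)]mul1r -mulrDl.
  by rewrite ler_wpM2r// pw_ge0.
rewrite -!pwD; apply: pw_le; have := kaA; lia.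
Qed.

Lemma g_lip s t : (g s <= g (s + t) + 2 * t)%N.
Proof. rewrite /g; lia. Qed.

(** The case e = 1 is the continuity of the operator. Inside a row the weight
    of X^(n+e) is comparable with that of X^n since the exponent decreases
    slowly; where it decreases, n > k/4 dominates the loss. *)
Lemma small_shift_step j n e : (N < n <= top)%N -> (e <= E)%N ->
  pnorm p j ('X^e * p n) <= pw ((2 * j + 1) * n)%N%:Z.
Proof.
move=> /andP[Nn nt] eE; have eD : (e <= D)%N by lia.
set r := (n %/ k)%N; set s := (n %% k)%N.
have nE : n = (r * k + s)%N by exact: divn_eq.
have sk : (s < k)%N by rewrite ltn_mod.
have [X16 HA] := shift_bounds.
have en : (j * (e + n) <= 2 * j * n)%N.
  by rewrite [(2 * j)%N]mulnC -mulnA leq_mul2l; lia.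
have [sN|Ns] := leqP s N.
  case rE : r => [|r']; first by move: nE; rewrite rE; lia.
  have r'3 : (r' < J.+3)%N.
    rewrite -[(r' < _)%N]/(r'.+1 <= _)%N -rE -(leq_pmul2r k_gt0) -(leq_add2r s) -nE.
    have := nt; rewrite nE rE /top mulSnr => H1.
    case: (leqP r' J.+2) => h'; first by have := @rows r' h'; lia.
    have : (J.+3 * k <= r' * k)%N by rewrite leq_mul2r h' orbT.
    lia.
  have := @window_shift j r' 0 s e r'3; rewrite addn0 mul0n add0n -rE -nE => H0.
  apply: le_trans (H0 _ sN _) _; [by rewrite rE|lia|].
  by apply: pw_le; lia.
have rR : (r < J.+3)%N.
  rewrite ltnNge; apply/negP => rJ.
  have : (J.+3 * k <= r * k)%N by rewrite leq_mul2r rJ orbT.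
  move: nt; rewrite nE /top; lia.
have Nsk : (N < s < k)%N by rewrite Ns.
rewrite nE p_mono// -scalerAr -exprD pnormZ// normc_cpw -nE.
have h2 : (h r <= 2 * H)%N by rewrite /h; case: (r) => [|r']; lia.
have [se|se] := ltnP (s + e) k.
  have -> : (e + n = r * k + (s + e))%N by lia.
  apply: (@le_trans _ _ (pw (h r * g s)%N * pw ((j * (r * k + (s + e)))%N%:Z - (h r * g (s + e))%N%:Z))).
    rewrite ler_wpM2l ?pw_ge0//; apply: pnorm_deg_pw => //; first by rewrite size_polyXn.
    by rewrite pnorm0_mono//; lia.
  rewrite -pwD; apply: pw_le.
  have -> : (r * k + (s + e) = e + n)%N by lia.
  suff : (h r * g s <= h r * g (s + e) + n)%N by lia.
  (* On the plateau of the weights nothing is lost; otherwise n >= s > k/4. *)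
  have [s2|s2] := leqP (2 * (s + e)) k.
    have -> : g (s + e) = k by rewrite /g; lia.
    have -> : g s = k by rewrite /g; lia.
    by lia.
  apply: (@leq_trans (h r * (g (s + e) + 2 * e))%N); first by rewrite leq_mul2l g_lip orbT.
  rewrite mulnDr leq_add2l; apply: (@leq_trans (2 * H * (2 * D))%N); first by apply: leq_mul => //; lia.
  have : (s <= n)%N by exact: leq_mod.
  by lia.
(* X^(n+e) lies in the next window, and g s <= 2 e is small because n is within
   e of the end of its row. *)
apply: (@le_trans _ _ (pw (h r * g s)%N * pw ((j * (e + n))%N%:Z + A'))).
  rewrite ler_wpM2l ?pw_ge0//; apply: pnorm_deg_pw => //; first by rewrite size_polyXn.
  by apply: pnorm0_all; lia.
rewrite -pwD; apply: pw_le.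
have hg : (h r * g s <= 2 * H * (2 * D))%N by apply: leq_mul => //; rewrite /g; lia.
suff : (2 * H * (2 * D) + A' <= n)%N by lia.
have : (s <= n)%N by exact: leq_mod.
by lia.
Qed.

(** Apart from the row 0, n is comparable with the shift, so that the increase
    of the degree costs an admissible factor. In the row 0 it is paid by the
    doubled weights of row 1. The number J+3 of rows matters for the last
    window, whose image under X^k lies beyond the block: there the factor
    2^((J+1)k) remains, but n >= (J+3)k. *)
Lemma large_shift_step j n t : (N < n <= top)%N -> (t <= D)%N -> (j <= J)%N ->
  pnorm p j ('X^(k + t) * p n) <= pw ((3 * j + 4) * n)%N%:Z.
Proof.
move=> /andP[Nn nt] tD jJ.
set r := (n %/ k)%N; set s := (n %% k)%N.
have nE : n = (r * k + s)%N by exact: divn_eq.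
have sk : (s < k)%N by rewrite ltn_mod.
have jD : (j * D <= J.+2 * D)%N by rewrite leq_mul2r; lia.
have [X16 HA] := shift_bounds.
have sn : (s <= n)%N by exact: leq_mod.
have HkS : (J.+3 * k = J.+1 * k + k + k)%N by rewrite !mulSnr.
have jn3 : (k + t <= 2 * n)%N -> (j * (k + t + n) + 4 * n <= (3 * j + 4) * n)%N.
  move=> kn; have : (j * (k + t + n) <= j * (3 * n))%N.
    by rewrite leq_mul2l; apply/orP; right; lia.
  by lia.
have [sN|Ns] := leqP s N.
  case rE : r => [|r']; first by move: nE; rewrite rE; lia.
  have kn : (k <= n)%N by rewrite nE rE mulSnr; lia.
  have r'3 : (r' < J.+3)%N.
    case: (leqP r' J.+2) => h' //.
    have : (J.+3 * k <= r' * k)%N by rewrite leq_mul2r h' orbT.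
    by move: nt; rewrite nE rE /top mulSnr; lia.
  (* The last window is the one whose image leaves the block. *)
  have [r'2|r'2] := ltnP r' J.+2.
    have := @window_shift j r' 1 s t r'3; rewrite addn1 mul1n -rE -nE => H0.
    apply: le_trans (H0 _ _ _) _; [lia|by []|lia|].
    apply: pw_le; rewrite lez_nat -addnA.
    apply: leq_trans (jn3 _); last by lia.
    by rewrite addnA leq_addr.
  have {}rE : r = J.+3 by lia.
  rewrite nE rE p_window// -scalerAr mulrBr -exprD mulrCA -exprD.
  have -> : (k + t + (J.+3 * k + s) = k + t + n)%N by rewrite nE rE.
  have -> : ((3 * j + 4) * (J.+3 * k + s) = (3 * j + 4) * n)%N by rewrite nE rE.
  have n3 : (J.+3 * k <= n)%N by rewrite nE rE leq_addr.
  have n2 : (n + k + t <= 2 * top)%N by move: topk; rewrite /top; lia.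
  apply: le_trans (pnorm_deg_pw (n := k + t + n) (a := (J.+1 * k)%N%:Z + (ka%:Z + A'%:Z)) hp j _ _) _.
  - apply: leq_trans (size_scale_leq _ _) _.
    have [->|q0] := eqVneq q 0; first by rewrite mul0r subr0 size_polyXn.
    have qk : (size q <= k)%N by lia.
    rewrite size_polyDl ?size_polyXn// size_polyN size_mulXn// ltnS nE rE.
    have -> : (k + t + (J.+3 * k + s) = k + (J.+3 * k + s + t))%N by lia.
    have -> : (k + t + (J.+2 * k + s) = J.+3 * k + s + t)%N by rewrite [(J.+3 * k)%N]mulSnr; lia.
    by rewrite addnC leq_add2r.
  - rewrite pnormZ// normc_cpw !pwD ler_wpM2l ?pw_ge0//.
    apply: le_trans (pnormB hp _ _ _) _.
    apply: le_trans (ler_wpM2r (pw_ge0 _) hq); rewrite mulrDl mul1r.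
    apply: lerD; first by apply: pnorm0_all; lia.
    apply: pnormM => // i iq; rewrite -exprD; apply: pnorm0_all.
    by move: n2; rewrite nE rE; lia.
  - apply: pw_le; have ka' := kaA; have : (k + t <= 2 * n)%N by lia.
    by move=> /jn3; lia.
have rR : (r < J.+3)%N.
  rewrite ltnNge; apply/negP => rJ.
  have : (J.+3 * k <= r * k)%N by rewrite leq_mul2r rJ orbT.
  move: nt; rewrite nE /top; lia.
have Nsk : (N < s < k)%N by rewrite Ns.
have n2 : (k + t + n <= 2 * top)%N by move: topk; rewrite /top; lia.
rewrite nE p_mono// -scalerAr -exprD pnormZ// normc_cpw -nE.
have h2 : (h r <= 2 * H)%N by rewrite /h; case: (r) => [|r']; lia.
have [se|se] := ltnP (s + t) k; last first.
  (* The shift leads into the next window, so that g s <= 2 t is small. *)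
  apply: (@le_trans _ _ (pw (h r * g s)%N * pw ((j * (k + t + n))%N%:Z + A'))).
    rewrite ler_wpM2l ?pw_ge0//; apply: pnorm_deg_pw => //; first by rewrite size_polyXn.
    by apply: pnorm0_all; lia.
  rewrite -pwD; apply: pw_le.
  have hg : (h r * g s <= 2 * H * (2 * D))%N by apply: leq_mul => //; rewrite /g; lia.
  have : (2 * H * (2 * D) + A' <= n)%N by lia.
  have : (k + t <= 2 * n)%N by lia.
  by move=> /jn3; lia.
have E1 : (k + t + n = r.+1 * k + (s + t))%N by rewrite nE; lia.
have [r0|r0] := posnP r.
  (* From the row 0 to the row 1: the weight is gained once more. *)
  have ns : n = s by rewrite nE r0.
  have R1 : (1 < J.+3)%N by [].
  rewrite E1 r0; apply: (@le_trans _ _ (pw (H * g s)%N * pw ((j * (1 * k + (s + t)))%N%:Z - (2 * H * g (s + t))%N%:Z))).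
    rewrite ler_wpM2l ?pw_ge0//; apply: pnorm_deg_pw => //; first by rewrite size_polyXn.
    by rewrite pnorm0_mono//; lia.
  rewrite -pwD; apply: pw_le; rewrite mul1n ns.
  have gl := g_lip s t.
  have gl' : (H * g s <= H * g (s + t) + 2 * (H * D))%N.
    apply: (@leq_trans (H * (g (s + t) + 2 * t))%N); first by rewrite leq_mul2l gl orbT.
    by rewrite mulnDr leq_add2l mulnCA leq_mul2l leq_mul2l tD !orbT.
  have jt : (j * t <= H * D)%N by apply: leq_mul; lia.
  have : (j * k + j * s + 7 * (H * D) <= H * g s + (3 * j + 4) * s)%N.
    have js0 := leq0n (j * s).
    have jH u : ((j + 2) * u <= H * u)%N by rewrite leq_mul2r; lia.
    have [s2|s2] := leqP (2 * s) k.
      have -> : g s = k by rewrite /g; lia.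
      by have := jH k; lia.
    have -> : g s = (2 * (k - s))%N by rewrite /g; lia.
    have [u su] : exists u, k = (s + u)%N by exists (k - s)%N; lia.
    have ju0 := leq0n (j * u).
    by have := jH u; move: X16; rewrite su addKn; lia.
  by lia.
have kn : (k <= n)%N.
  by rewrite nE (leq_trans _ (leq_addr _ _))// -{1}(mul1n k) leq_mul2r r0 orbT.
have j3 : (j * (k + t + n) + 4 * n <= (3 * j + 4) * n)%N by apply: jn3; lia.
have [rlast|rlast] := leqP J.+3 r.+1.
  (* Row J+3 lies beyond the block, where [hT] applies. *)
  have rE : r.+1 = J.+3 by lia.
  apply: (@le_trans _ _ (pw (h r * g s)%N * pw ((j * (k + t + n))%N%:Z + - (4 * top)%N%:Z))).
    rewrite ler_wpM2l ?pw_ge0//; apply: pnorm_deg_pw => //; first by rewrite size_polyXn.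
    by apply: hT; rewrite n2 andbT E1 rE /top; lia.
  rewrite -pwD; apply: pw_le.
  have : (h r * g s <= 2 * H * k)%N by apply: leq_mul => //; rewrite /g; lia.
  have : (J.+3 * k <= top)%N by rewrite /top leq_addr.
  by lia.
rewrite E1; apply: (@le_trans _ _ (pw (h r * g s)%N * pw ((j * (r.+1 * k + (s + t)))%N%:Z - (h r.+1 * g (s + t))%N%:Z))).
  rewrite ler_wpM2l ?pw_ge0//; apply: pnorm_deg_pw => //; first by rewrite size_polyXn.
  by rewrite pnorm0_mono//; lia.
rewrite -pwD; apply: pw_le; rewrite -E1.
have -> : h r.+1 = h r by case: (r) r0.
have gl' : (h r * g s <= h r * g (s + t) + 4 * (H * D))%N.
  apply: (@leq_trans (h r * (g (s + t) + 2 * t))%N); first by rewrite leq_mul2l g_lip orbT.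
  rewrite mulnDr leq_add2l; apply: (@leq_trans (2 * H * (2 * D))%N); first by apply: leq_mul => //; lia.
  by lia.
have : (4 * (H * D) <= n)%N by lia.
by lia.
Qed.

End step.

(** * Sequences of blocks *)

Section states.
Context {R : realType}.
Local Notation C := (R[i]).
Implicit Types (p : nat -> {poly C}) (q g f : {poly C}) (J ka D k n j : nat).

(** A stage of the construction: the elements p_n, n <= top, are chosen as pol
    n; later blocks must keep the shifts X^e, e <= delay, bounded; the
    monomials up to top have norm at most 2^logbd. *)
Record state := State {
  top : nat; delay : nat; logbd : nat; pol : nat -> {poly C} }.
Implicit Types S T : state.

(** The new delay is 2k because X^(k+t), for t <= D < k, must remain under
    control on all later blocks. *)
Definition next_state S q J ka k := State (J.+3 * k + top S) (2 * k) (logbd S + J.+3 * ka)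
  (fun n => if (n <= top S)%N then pol S n else block (top S) q J k n).

(** The nonlinear requirement that k is huge compared with all earlier data; it
    holds for all large k, see [valid_step_exists]. *)
Definition valid_step S q J ka D k := [/\ (delay S <= D)%N, 1 + l1 0 q <= pw ka &
  (16 * J.+2 * D + 8 * D + 8 * top S + 8 * size q + logbd S + J.+4 * ka + 16 <= k)%N].

Definition graded p := forall n, size (p n) = n.+1.

Definition agree p S := forall n, (n <= top S)%N -> p n = pol S n.

Definition admissible S := [/\ (0 < delay S <= top S)%N, graded (pol S) &
  forall p, graded p -> agree p S ->
    forall i, (i <= top S)%N -> pnorm p 0 'X^i <= pw (logbd S)].

(** p is the limit of an infinite run of the construction passing through S.
    The estimates for an element p_n involve monomials of higher degree, hence
    blocks chosen later, so what is known about p at a stage must include that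
    the construction goes on. The run is encoded as a greatest fixpoint: a set
    of states in which every state has a valid next step. *)
Definition future S p := graded p /\ exists X : state -> Prop, X S /\
  forall T, X T -> agree p T /\
    exists q J ka D k, valid_step T q J ka D k /\ X (next_state T q J ka k).

Lemma agree_next p S q J ka k : agree p (next_state S q J ka k) -> agree p S.
Proof.
by move=> pS n nS; rewrite pS /= ?nS// (leq_trans nS)// leq_addl.
Qed.

Lemma agree_block p S q J ka k : agree p (next_state S q J ka k) ->
  forall n, (top S < n <= J.+3 * k + top S)%N -> p n = block (top S) q J k n.
Proof. by move=> pS n /andP[Sn nS]; rewrite pS//= leqNgt Sn. Qed.

Lemma top_next S q J ka D k : valid_step S q J ka D k -> (top S < top (next_state S q J ka k))%N.
Proof.
case=> _ _ hk /=; have : (3 * k <= J.+3 * k)%N by rewrite leq_mul2r orbC.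
by lia.
Qed.

Lemma admissible_next S q J ka D k : admissible S -> valid_step S q J ka D k -> admissible (next_state S q J ka k).
Proof.
move=> [/andP[d0 dt] gS bS] [dD hq hk]; split.
- rewrite /=; have : (2 * k <= J.+3 * k)%N by rewrite leq_mul2r orbC.
  by lia.
- have sq : (size q <= k)%N by lia.
  by move=> n /=; case: ifP => // _; rewrite size_block//; lia.
- move=> p gp pS i /= iS.
  apply: (@pnorm0_top R p gp (top S) (delay S) (logbd S) q J ka D k dt dD hq hk) => //.
    exact: agree_block pS.
  by apply: bS => //; exact: agree_next pS.
Qed.

Lemma future_graded S p : future S p -> graded p. Proof. by case. Qed.

Lemma future_agree S p : future S p -> agree p S.
Proof. by move=> [_ [X [XS XP]]]; case: (XP _ XS). Qed.

Lemma future_step S p : future S p ->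
  exists q J ka D k, valid_step S q J ka D k /\ future (next_state S q J ka k) p.
Proof.
move=> [gp [X [XS XP]]]; have [_ [q [J [ka [D [k [hok XT]]]]]]] := XP _ XS.
by exists q, J, ka, D, k; split=> //; split=> //; exists X.
Qed.

Lemma future_prev S q J ka D k p : valid_step S q J ka D k ->
  future (next_state S q J ka k) p -> future S p.
Proof.
move=> hok fp; split; first by case: fp.
exists (fun T => T = S \/ future T p); split; first by left.
move=> T [->|fT].
  split; first exact: agree_next (future_agree fp).
  by exists q, J, ka, D, k; split=> //; right.
split; first exact: future_agree.
have [q' [J' [ka' [D' [k' [hok' fT']]]]]] := future_step fT.
by exists q', J', ka', D', k'; split=> //; right.
Qed.

(** These monomials lie in the first half of the row 0 of the next block, where
    the weights are maximal. *)
Lemma future_tiny S p : admissible S -> future S p -> forall i, (top S < i <= 2 * top S)%N ->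
  pnorm p 0 'X^i <= pw (- (4 * top S)%N%:Z).
Proof.
move=> [/andP[d0 dt] gS bS] fp i /andP[Si i2].
have [q [J [ka [D [k [[dD hq hk] fn]]]]]] := future_step fp.
have gp := future_graded fp.
have ik : (i < k)%N by lia.
have := @pnorm0_mono R p gp (top S) (delay S) (logbd S) q J ka D k dt dD hq hk _ 0 i.
rewrite mul0n add0n => ->//; last by rewrite Si.
  apply: pw_le; have -> : minn k (2 * (k - i)) = k by lia.
  by rewrite lerN2 lez_nat; apply: (@leq_trans k); [lia|rewrite leq_pmull].
exact: agree_block (future_agree fn).
Qed.

(** Each element lies in some later block, and the delays increase. *)
Lemma future_small S p j n e : admissible S -> future S p -> (top S < n)%N -> (e <= delay S)%N ->
  pnorm p j ('X^e * p n) <= pw ((2 * j + 1) * n)%N%:Z.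
Proof.
have [m] := ubnP (n - top S); elim: m S => // m IH S nm iS fp Sn eS.
have [q [J [ka [D [k [hok fn]]]]]] := future_step fp.
have [dD hq hk] := hok; have [/andP[d0 dt] gS bS] := iS.
have iS' := admissible_next iS hok; have gp := future_graded fp.
have [nS'|nS'] := leqP n (J.+3 * k + top S).
  apply: (@small_shift_step R p gp (top S) (delay S) (logbd S) q J ka D k dt dD hq hk) => //.
  - exact: agree_block (future_agree fn).
  - by apply: bS => //; exact: future_agree.
  - by move=> i iT; apply: (future_tiny iS' fn).
  - by rewrite Sn.
apply: (IH _ _ iS' fn) => //=; last by lia.
by have := top_next hok => /=; lia.
Qed.

Section one_step.
Variables (S : state) (q : {poly C}) (J ka D k : nat) (p : nat -> {poly C}).
Hypothesis iS : admissible S.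
Hypothesis hok : valid_step S q J ka D k.
Hypothesis fp : future (next_state S q J ka k) p.

Lemma step_tail j n t : (top S < n)%N -> (t <= D)%N -> (j <= J)%N ->
  pnorm p j ('X^(k + t) * p n) <= pw ((3 * j + 4) * n)%N%:Z.
Proof.
move=> Sn tD jJ; have [dD hq hk] := hok; have [/andP[d0 dt] gS bS] := iS.
have iS' := admissible_next iS hok; have gp := future_graded fp.
have [nS'|nS'] := leqP n (J.+3 * k + top S).
  apply: (@large_shift_step R p gp (top S) (delay S) (logbd S) q J ka D k dt dD hq hk) => //.
  - exact: agree_block (future_agree fp).
  - by apply: bS => //; exact: agree_next (future_agree fp).
  - by move=> i iT; apply: (future_tiny iS' fp).
  - by rewrite Sn.
apply: (le_trans (future_small j iS' fp nS' _)); first by rewrite /=; lia.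
by apply: pw_le; rewrite lez_nat leq_mul2r; lia.
Qed.

Lemma step_window j f : (size f <= (top S).+1)%N ->
  pnorm p j (('X^k - q) * f) <= l1 0 f * pw ((j * (k + top S))%N%:Z - (J.+1 * k)%N%:Z).
Proof.
move=> fS; have [dD hq hk] := hok; have [/andP[d0 dt] gS bS] := iS; have gp := future_graded fp.
apply: (@pnorm_window_diff R p gp (top S) (delay S) (logbd S) q J ka D k dt dD hq hk) => //.
exact: agree_block (future_agree fp).
Qed.

Lemma step_early j i : (top S < i)%N -> (2 * i <= k)%N ->
  pnorm p j 'X^(k + i) <= pw ((j * (k + i))%N%:Z - (2 * J.+2 * k)%N%:Z).
Proof.
move=> Si ik; have [dD hq hk] := hok; have [/andP[d0 dt] gS bS] := iS; have gp := future_graded fp.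
have iS' := admissible_next iS hok.
have := @pnorm_early R p gp (top S) (delay S) (logbd S) q J ka D k dt dD hq hk _ _ j 1 i.
rewrite mul1n; apply => //.
- exact: agree_block (future_agree fp).
- by move=> i' iT; apply: (future_tiny iS' fp).
Qed.

End one_step.

Inductive reach : state -> state -> Prop :=
| reach_refl S : reach S S
| reach_step S q J ka D k T : valid_step S q J ka D k -> reach (next_state S q J ka k) T -> reach S T.

Lemma reach_trans S T U : reach S T -> reach T U -> reach S U.
Proof.
elim=> // {}S q J ka D k {}T hok _ IH TU.
exact: reach_step hok (IH TU).
Qed.

Lemma reach_one S q J ka D k : valid_step S q J ka D k -> reach S (next_state S q J ka k).
Proof. by move=> hok; apply: reach_step hok (reach_refl _). Qed.

Lemma reach_admissible S T : reach S T -> admissible S -> admissible T.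
Proof. by elim=> // {}S q J ka D k {}T hok _ IH iS; apply: IH; exact: admissible_next hok. Qed.

Lemma reach_first S T : reach S T -> S = T \/
  exists q J ka D k, valid_step S q J ka D k /\ reach (next_state S q J ka k) T.
Proof. by case=> [{}S|{}S q J ka D k {}T hok r]; [left|right; exists q, J, ka, D, k]. Qed.

Lemma reach_top S T : reach S T -> (top S <= top T)%N.
Proof.
elim=> // {}S q J ka D k {}T hok _; apply: leq_trans; exact: ltnW (top_next hok).
Qed.

Lemma reach_future S T p : reach S T -> future T p -> future S p.
Proof. by elim=> // {}S q J ka D k {}T hok _ IH fT; exact: future_prev hok (IH fT). Qed.

Lemma reach_pol S T n : reach S T -> (n <= top S)%N -> pol T n = pol S n.
Proof.
elim=> // {}S q J ka D k {}T hok _ IH nS; rewrite IH /= ?nS//.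
by rewrite (leq_trans nS)// leq_addl.
Qed.

(** The run required by [future] consists of all states met between consecutive
    S i; strict growth of the tops makes every p_n eventually constant. *)
Lemma limit_future (S : nat -> state) : admissible (S 0%N) ->
  (forall i, reach (S i) (S i.+1)) -> (forall i, (top (S i) < top (S i.+1))%N) ->
  let p n := pol (S n) n in forall i, future (S i) p.
Proof.
move=> i0 rS tS p.
have reachS i m : reach (S i) (S (i + m)%N).
  elim: m => [|m IH]; first by rewrite addn0; exact: reach_refl.
  by rewrite addnS; exact: reach_trans IH (rS _).
have invS i : admissible (S i) by have := reachS 0%N i; rewrite add0n => /reach_admissible; apply.
have topS i : (i <= top (S i))%N.
  by elim: i => // i IH; exact: leq_ltn_trans IH (tS i).
have agS i : agree p (S i).
  move=> n ni; rewrite /p; have [le|le] := leqP i n.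
    by have := reachS i (n - i)%N; rewrite subnKC// => r; exact: reach_pol r ni.
  have := reachS n (i - n)%N; rewrite subnKC ?(ltnW le)// => r.
  by apply/esym; exact: reach_pol r (topS n).
move=> i; split; first by move=> n; have [_ gn _] := invS n; exact: gn.
(* Strict inequality of the tops gives every such T a next step. *)
exists (fun T => exists i, reach (S i) T /\ reach T (S i.+1) /\ (top T < top (S i.+1))%N).
split; first by exists i; split; [exact: reach_refl|split].
move=> T [m [mT [Tm lt]]]; split.
  by move=> n nT; rewrite (agS m.+1) ?(reach_pol Tm)// (leq_trans nT)// ltnW.
have [E|[q [J [ka [D [k [hok TU]]]]]]] := reach_first Tm; first by rewrite E ltnn in lt.
exists q, J, ka, D, k; split=> //.
have [lt'|ge] := ltnP (top (next_state T q J ka k)) (top (S m.+1)).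
  by exists m; split; [exact: reach_trans mT (reach_one hok)|split].
have [E|[q' [J' [ka' [D' [k' [hok' TU']]]]]]] := reach_first TU.
  by exists m.+1; rewrite E; split; [exact: reach_refl|split].
have := leq_trans (top_next hok') (reach_top TU'); lia.
Qed.

End states.

Section estimates.
Context {R : realType}.
Local Notation C := (R[i]).

Lemma pwN_half (n : nat) : pw (- n%:Z) = (1/2) ^+ n :> R.
Proof.
apply: (@mulIf _ (pw n%:Z)); first by rewrite gt_eqF// pw_gt0.
rewrite pwNK pw_nat -exprMn; have -> : 1/2 * 2 = 1 :> R by field.
by rewrite expr1n.
Qed.

Lemma pw_small (B e : R) : 0 < e -> exists k0 : nat, forall k, (k0 <= k)%N ->
  B * pw (- k%:Z) <= e.
Proof.
move=> e0; have [n nP] := @pow_half_small R `|B| e e0; exists n => k nk.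
apply: le_trans (ler_wpM2r (pw_ge0 _) (ler_norm B)) _.
apply: le_trans nP; rewrite -pwN_half ler_wpM2l// pw_le//; lia.
Qed.

Lemma pw_large (B : R) : exists k : nat, B <= pw k.
Proof.
have [k /(_ k (leqnn _)) h] := @pw_small B 1 ltr01; exists k.
by have := ler_wpM2r (pw_ge0 k%:Z) h; rewrite -mulrA pwNK mulr1 mul1r.
Qed.

Lemma valid_step_exists (S : @state R) (q : {poly C}) J D : (delay S <= D)%N ->
  exists ka k0, forall k, (k0 <= k)%N -> valid_step S q J ka D k.
Proof.
move=> dD; have [ka kaP] := pw_large (1 + l1 0 q).
by exists ka; eexists => k kk; split=> //; exact: kk.
Qed.

End estimates.

(** * Approximate inverses of polynomials *)

Section covering.
Context {R : realType}.
Local Notation C := (R[i]).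
Implicit Types (y r h v : {poly C}).

Lemma l1_XnM n y : l1 0 ('X^n * y) <= l1 0 y.
Proof. by apply: le_trans (l1M _ _) _; rewrite l1_Xn mul0n pw0 mul1r. Qed.

Lemma l1_exp n y : l1 0 (y ^+ n) <= l1 0 y ^+ n.
Proof.
elim: n => [|n IH]; first by rewrite !expr0 -(expr0 'X) l1_Xn mul0n pw0.
rewrite !exprS; apply: le_trans (l1M _ _) _.
by rewrite ler_wpM2l ?l1_ge0.
Qed.

Definition shift_poly y : {poly C} := \poly_(i < size y) y`_i.+1.

Lemma shift_polyE y : y = (y`_0)%:P + 'X * shift_poly y.
Proof.
apply/polyP => i; rewrite coefD coefC coefXM; case: i => [|i] /=; first by rewrite addr0.
rewrite add0r coef_poly; case: ltnP => // yi.
by rewrite nth_default// ltnW.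
Qed.

Lemma l1_shift y : l1 0 (shift_poly y) <= l1 0 y.
Proof.
have sy : (size (shift_poly y) <= size y)%N by exact: size_poly.
rewrite (l1_widen _ sy) (@l1_widen _ _ y (size y).+1)//.
rewrite big_ord_recl -[leLHS]add0r; apply: lerD; first by rewrite mulr_ge0 ?normc_ge0 ?pw_ge0.
apply: ler_sum => i _; rewrite coef_poly ltn_ord /= !mul0n.
by rewrite /bump /= add1n.
Qed.

(** y = y_0 (1 - X v) is inverted by the geometric series in X v up to X^B,
    with bounds that depend only on those for y. *)
Lemma unit_inverse (m B : nat) (Y t : R) : 0 < t -> exists Q D,
  forall y, l1 0 y <= Y -> (size y <= m)%N -> t <= normc y`_0 ->
  exists r h, [/\ r * y = 1 + 'X^B * h, l1 0 r <= Q, l1 0 h <= Q,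
    (size r <= D)%N & (size h <= D)%N].
Proof.
move=> t0; pose Z := `|Y| / t.
have Z0 : 0 <= Z by rewrite divr_ge0// ltW.
exists (Num.max (Z ^+ B) (t^-1 * \sum_(i < B) Z ^+ i)), (B * m.+2).+1 => y yY ym yt.
have ny : 0 < normc y`_0 by apply: lt_le_trans yt.
have y0 : y`_0 != 0 by rewrite -normc_gt0.
pose v := (- (y`_0)^-1) *: shift_poly y.
have lv : l1 0 v <= Z.
  rewrite l1Z normcN normcV mulrC; apply: ler_pM; rewrite ?l1_ge0 ?invr_ge0 ?(ltW ny)//.
    exact: le_trans (l1_shift y) (le_trans yY (ler_norm _)).
  by rewrite lef_pV2.
have sv : (size v <= m)%N.
  apply: leq_trans (size_scale_leq _ _) _; apply: leq_trans ym; exact: size_poly.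
have yE : y = y`_0 *: (1 - 'X * v).
  rewrite {1}(shift_polyE y) /v -scalerAr scaleNr opprK scalerDr scalerA mulfV// scale1r.
  by rewrite alg_polyC.
exists ((y`_0)^-1 *: (\sum_(i < B) ('X * v) ^+ i)), (- v ^+ B); split.
- have E (c : C) (u w : {poly C}) : c != 0 -> (c^-1 *: u) * (c *: w) = u * w.
    by move=> c0; rewrite -scalerAl -scalerAr scalerA mulVf// scale1r.
  rewrite [X in _ * X = _]yE E// mulrC.
  have -> : 1 - 'X * v = - ('X * v - 1) by rewrite opprB.
  by rewrite mulNr -subrX1 opprB exprMn mulrN.
- rewrite le_max; apply/orP; right; rewrite l1Z normcV.
  apply: ler_pM; rewrite ?invr_ge0 ?l1_ge0 ?(ltW ny)//; first by rewrite lef_pV2.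
  apply: le_trans (l1_sum _ _ _ _) _; apply: ler_sum => i _.
  apply: le_trans (l1_exp _ _) _; rewrite lerXn2r ?nnegrE ?l1_ge0//.
  by apply: le_trans lv; rewrite -{1}(expr1 'X) l1_XnM.
- rewrite le_max; apply/orP; left; rewrite l1N.
  by apply: le_trans (l1_exp _ _) _; rewrite lerXn2r ?nnegrE ?l1_ge0.
- apply: leq_trans (size_scale_leq _ _) _; apply: (leq_trans (size_sum _ _ _)).
  apply/bigmax_leqP => i _; apply: leq_trans (size_poly_exp_leq _ _) _; rewrite ltnS mulnC.
  apply: leq_mul; first exact: ltnW.
  apply: leq_trans (leq_pred _) _; apply: (@leq_trans m.+1) => //.
  by rewrite mulrC; apply: leq_trans (size_polyMleq _ _) _; rewrite size_polyX addn2 /= ltnS.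
- rewrite size_polyN; apply: leq_trans (size_poly_exp_leq _ _) _; rewrite ltnS mulnC.
  apply: leq_mul => //; apply: leq_trans (leq_pred _) _; apply: leq_trans sv _.
  by apply: leq_trans (leqnSn _) (leqnSn _).
Qed.

(** Approximate inverses up to a power of X, uniform over a set of polynomials
    whose low coefficients are not all small. By induction on N: if y_0 is not
    small, y is inverted as a power series and the result multiplied by X^N.
    Otherwise y = y_0 + X y', an r is found for y' and N - 1, and r y = X r y'
    + y_0 r, where the last term joins the error. *)
Lemma almost_inverse (N m B : nat) (Y kappa eta : R) : 0 < kappa -> 0 < eta ->
  exists Q D, forall y, l1 0 y <= Y -> (size y <= m)%N ->
  kappa <= \sum_(s < N.+1) normc y`_s ->
  exists r err h, [/\ r * y = 'X^N + err + 'X^B * h, l1 0 r <= Q, l1 0 h <= Q,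
    l1 0 err <= eta & [/\ (size r <= D)%N, (size h <= D)%N & (size err <= D)%N]].
Proof.
elim: N kappa eta => [|N IH] kappa eta k0 e0.
  have [Q [D H]] := unit_inverse m B Y k0; exists Q, D => y yY ym yk.
  have [|r [h [rE rQ hQ rD hD]]] := H y yY ym; first by rewrite big_ord1 in yk.
  exists r, 0, h; split; rewrite ?l1_0 ?(ltW e0)//; last by rewrite size_poly0.
  by rewrite expr0 addr0.
have k20 : 0 < kappa / 2 by rewrite divr_gt0.
have e20 : 0 < eta / 2 by rewrite divr_gt0.
have [Q1 [D1 H1]] := IH _ _ k20 e20.
(* Below this threshold for y_0 the other low coefficients still amount to
   kappa / 2, and y_0 r is an admissible error. *)
pose t := Num.min (kappa / 2) (eta / (2 * (`|Q1| + 1))).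
have q1 : 0 < `|Q1| + 1 by rewrite ltr_pwDr.
have t0 : 0 < t by rewrite lt_min k20 divr_gt0// mulr_gt0.
have [Q2 [D2 H2]] := unit_inverse m B Y t0.
exists (Num.max Q1 Q2), (N.+2 + D1 + D2)%N => y yY ym yk.
have sX (n : nat) (f : {poly C}) : (size ('X^n * f)%R <= n + size f)%N.
  by have [->|f0] := eqVneq f 0; rewrite ?mulr0 ?size_poly0// mulrC size_mulXn.
have [ty|ty] := leP t (normc y`_0).
  have [r [h [rE rQ hQ rD hD]]] := H2 y yY ym ty.
  exists ('X^(N.+1) * r), 0, ('X^(N.+1) * h); split.
  - by rewrite -mulrA rE mulrDr mulr1 addr0 mulrCA.
  - by apply: le_trans (l1_XnM _ _) _; rewrite le_max rQ orbT.
  - by apply: le_trans (l1_XnM _ _) _; rewrite le_max hQ orbT.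
  - by rewrite l1_0 ltW.
  - split; rewrite ?size_poly0//; apply: leq_trans (sX _ _) _; rewrite -addnA.
      by apply: leq_add => //; exact: leq_trans rD (leq_addl _ _).
    by apply: leq_add => //; exact: leq_trans hD (leq_addl _ _).
have [||| r [err [h [rE rQ hQ eQ [rD hD eD]]]]] := H1 (shift_poly y).
- exact: le_trans (l1_shift y) yY.
- exact: leq_trans (size_poly _ _) ym.
- rewrite big_ord_recl in yk.
  have t2 : t <= kappa / 2 by rewrite /t ge_min lexx.
  have E : \sum_(i < N.+1) normc y`_(lift ord0 i) = \sum_(s < N.+1) normc (shift_poly y)`_s.
    apply: eq_bigr => i _; rewrite /shift_poly coef_poly lift0.
    by case: ltnP => // yi; rewrite nth_default// ltnW.
  by move: yk; rewrite E; move: ty t2; lra.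
exists r, (y`_0 *: r + 'X * err), ('X * h); split.
- rewrite {1}(shift_polyE y) mulrDr mulrCA rE -mul_polyC [in RHS]exprS; ring.
- by rewrite le_max rQ.
- by apply: le_trans (_ : l1 0 h <= _); [rewrite -(expr1 'X) l1_XnM|rewrite le_max hQ].
- apply: le_trans (l1D _ _ _) _; rewrite l1Z [eta]splitr; apply: lerD; last first.
    by apply: le_trans eQ; rewrite -(expr1 'X) l1_XnM.
  have tq : t <= eta / (2 * (`|Q1| + 1)) by rewrite /t ge_min lexx orbT.
  apply: (@le_trans _ _ (eta / (2 * (`|Q1| + 1)) * (`|Q1| + 1))).
    apply: ler_pM; rewrite ?normc_ge0 ?l1_ge0//; first exact: le_trans (ltW ty) tq.
    by apply: le_trans rQ _; have := ler_norm Q1; lra.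
  by rewrite le_eqVlt; apply/orP; left; apply/eqP; field; rewrite gt_eqF.
- have D1D : (1 + D1 <= N.+2 + D1 + D2)%N.
    by rewrite -[(N.+2 + _ + _)%N]addnA; apply: leq_add => //; exact: leq_addr.
  have D1' : (D1 <= N.+2 + D1 + D2)%N by exact: ltnW.
  split; first exact: leq_trans rD D1'.
    apply: leq_trans D1D; apply: (@leq_trans (1 + size h)); last by rewrite leq_add2l.
    by rewrite -(expr1 'X) sX.
  apply: leq_trans (size_polyD _ _) _; rewrite geq_max; apply/andP; split.
    exact: leq_trans (size_scale_leq _ _) (leq_trans rD D1').
  apply: leq_trans D1D; apply: (@leq_trans (1 + size err)); last by rewrite leq_add2l.
  by rewrite -(expr1 'X) sX.
Qed.

Lemma real_net (Q e : R) : 0 < e -> exists G : seq R,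
  forall x, `|x| <= Q -> exists2 d, d \in G & `|x - d| <= e.
Proof.
move=> e0; exists [seq - Q + i%:R * e | i <- iota 0 (Num.truncn (2 * Q / e)).+1] => x.
rewrite ler_norml => /andP[x1 x2].
have x0 : 0 <= (x + Q) / e by rewrite divr_ge0 ?(ltW e0)//; lra.
exists (- Q + (Num.truncn ((x + Q) / e))%:R * e).
  apply/mapP; exists (Num.truncn ((x + Q) / e)) => //.
  rewrite mem_iota add0n ltnS; apply: le_truncn.
  by rewrite ler_wpM2r ?invr_ge0 ?(ltW e0)//; lra.
have := truncn_itv x0; set n := Num.truncn _; rewrite -natr1.
rewrite ler_pdivlMr// ltr_pdivrMr// => /andP[h1 h2].
by rewrite ler_norml; lra.
Qed.

Lemma complex_net (Q e : R) : 0 < e -> exists G : seq C,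
  forall x, normc x <= Q -> exists2 d, d \in G & normc (x - d) <= e.
Proof.
move=> e0; have e20 : 0 < e / 2 by rewrite divr_gt0.
have [G GP] := real_net Q e20.
exists [seq (a +i* b)%C | a <- G, b <- G] => x xQ.
have [a aG ax] := GP _ (le_trans (Re_le_normc x) xQ).
have [b bG bx] := GP _ (le_trans (Im_le_normc x) xQ).
exists (a +i* b)%C; first by apply/allpairsP; exists (a, b).
by apply: le_trans (normc_le_ReIm _) _; rewrite ReB ImB [e]splitr lerD.
Qed.

(** Total boundedness of the set of polynomials of bounded degree and norm. *)
Lemma poly_net (D : nat) (Q e : R) : 0 < e -> exists F : seq {poly C},
  forall r, (size r <= D)%N -> l1 0 r <= Q ->
  exists2 f, f \in F & l1 0 (r - f) <= e /\ (size f <= D)%N.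
Proof.
elim: D e => [|D IH] e e0.
  exists [:: 0] => r; rewrite size_poly_leq0 => /eqP -> _.
  by exists 0; rewrite ?mem_head// subrr l1_0 size_poly0 ltW.
have e20 : 0 < e / 2 by rewrite divr_gt0.
have [F FP] := IH _ e20; have [G GP] := complex_net Q e20.
exists [seq f + c *: 'X^D | f <- F, c <- G] => r rD rQ.
pose r' := take_poly D r.
have rE : r = r' + r`_D *: 'X^D.
  apply/polyP => i; rewrite coefD coefZ coefXn coef_take_poly.
  case: ltngtP => [iD|iD|->]; rewrite ?mulr0 ?addr0 ?add0r ?mulr1//.
  by rewrite nth_default// (leq_trans rD).
have r'Q : l1 0 r' <= Q.
  apply: le_trans rQ; rewrite (@l1_widen _ _ r' D) ?size_take_poly// (@l1_widen _ _ r D.+1)//.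
  rewrite big_ord_recr /= -[leLHS]addr0; apply: lerD; last by rewrite mulr_ge0 ?normc_ge0 ?pw_ge0.
  by apply: ler_sum => i _; rewrite coef_take_poly ltn_ord.
have [f fF [fe fD]] := FP r' (size_take_poly _ _) r'Q.
have rDQ : normc r`_D <= Q.
  by apply: le_trans rQ; have := l1_coef 0 r D; rewrite mul0n pw0 mulr1.
have [c cG ce] := GP r`_D rDQ.
exists (f + c *: 'X^D); first by apply/allpairsP; exists (f, c).
split.
  rewrite {1}rE opprD addrACA -scalerBl [e]splitr.
  apply: le_trans (l1D _ _ _) _; apply: lerD => //.
  by rewrite l1Z l1_Xn mul0n pw0 mulr1.
apply: leq_trans (size_polyD _ _) _; rewrite geq_max (leq_trans fD)//=.
by apply: leq_trans (size_scale_leq _ _) _; rewrite size_polyXn.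
Qed.

(** Replacing the approximate inverses by elements of a finite net changes r y
    by a multiple of the mesh of the net only. *)
Lemma finite_cover (N m B : nat) (Y kappa eta : R) : 0 < kappa -> 0 < eta ->
  exists (F : seq {poly C}) Q D,
  (forall r, r \in F -> l1 0 r <= Q /\ (size r <= D)%N) /\
  forall y, l1 0 y <= Y -> (size y <= m)%N ->
  kappa <= \sum_(s < N.+1) normc y`_s ->
  exists r err h, [/\ r \in F, r * y = 'X^N + err + 'X^B * h,
    l1 0 err <= eta, l1 0 h <= Q & (size err <= D)%N /\ (size h <= D)%N].
Proof.
move=> k0 e0; have e20 : 0 < eta / 2 by rewrite divr_gt0.
have [Q [D H]] := almost_inverse N m B Y k0 e20.
pose e' := eta / (2 * (`|Y| + 1)).
have Y1 : 0 < `|Y| + 1 by rewrite ltr_pwDr.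
have e'0 : 0 < e' by rewrite divr_gt0// mulr_gt0.
have [F FP] := poly_net D Q e'0.
exists [seq f <- F | (l1 0 f <= Q + e') && (size f <= D)%N], (Q + e'), (D + m)%N.
split.
  move=> r; rewrite mem_filter => /andP[/andP[h1 h2] _]; split=> //.
  exact: leq_trans h2 (leq_addr _ _).
move=> y yY ym yk; have [r [err [h [rE rQ hQ eQ [rD hD eD]]]]] := H y yY ym yk.
have [f fF [fe fD]] := FP r rD rQ.
exists f, (err + (f - r) * y), h; split.
- rewrite mem_filter fF fD !andbT -[f](subrK r) addrC.
  apply: le_trans (l1D _ _ _) _; apply: lerD => //; by rewrite -l1N opprB.
- by rewrite mulrBl rE; ring.
- apply: le_trans (l1D _ _ _) _; rewrite [eta]splitr; apply: lerD => //.
  apply: le_trans (l1M _ _) _.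
  apply: (@le_trans _ _ (e' * (`|Y| + 1))).
    apply: ler_pM; rewrite ?l1_ge0//; first by rewrite -l1N opprB.
    by apply: le_trans yY _; have := ler_norm Y; lra.
  by rewrite le_eqVlt; apply/orP; left; apply/eqP; rewrite /e'; field; rewrite gt_eqF.
- by apply: le_trans hQ _; rewrite lerDl ltW.
- split; last exact: leq_trans hD (leq_addr _ _).
  apply: leq_trans (size_polyD _ _) _; rewrite geq_max.
  rewrite (leq_trans eD (leq_addr _ _)) /=.
  apply: leq_trans (size_polyMleq _ _) _; apply: leq_trans (leq_pred _) _.
  apply: leq_add => //.
  by apply: leq_trans (size_polyD _ _) _; rewrite size_polyN geq_max fD.
Qed.

End covering.

(** * One round of the construction *)

Section multiplier_steps.
Context {R : realType}.
Local Notation C := (R[i]).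

(** One block for each q of the list. On the elements preceding the block of q,
    X^c acts like q; from the block of q on they are covered by [step_tail]. *)
Lemma power_steps (F : seq {poly C}) (S : @state R) (J N1 : nat) (Y e : R) :
  admissible S -> (N1 <= top S)%N -> 0 < e ->
  exists T, reach S T /\ forall p, future T p -> forall q, q \in F ->
  exists c, (forall y : {poly C}, (size y <= N1.+1)%N -> l1 0 y <= Y ->
      pnorm p J (('X^c - q) * y) <= e) /\
    forall n, (N1 < n)%N ->
      pnorm p J ('X^c * p n) <= pnorm p J (q * p n) + pw ((3 * J + 4) * n)%N%:Z.
Proof.
move=> iS N1S e0; elim: F => [|q F [T [ST HT]]].
  by exists S; split=> //; exact: reach_refl.
have iT := reach_admissible ST iS; have NT := leq_trans N1S (reach_top ST).
have [ka [k0 okP]] := @valid_step_exists R T q J (delay T) (leqnn _).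
have [k1 k1P] := @pw_small R (`|Y| * pw (J * top T)%N%:Z) e e0.
pose P1 := \sum_(n < (top T).+1) l1 0 (pol T n).
have [k2 k2P] := @pw_small R (P1 * pw (J * top T)%N%:Z) 1 ltr01.
pose k := (k0 + k1 + k2)%N.
have hok : valid_step T q J ka (delay T) k by apply: okP; rewrite /k; lia.
exists (next_state T q J ka k); split; first exact: reach_trans ST (reach_one hok).
move=> p fp; have gp := future_graded fp.
have fT := future_prev hok fp.
have ex (f : {poly C}) : (size f <= (top T).+1)%N ->
    pnorm p J (('X^k - q) * f) <= l1 0 f * pw (J * top T)%N%:Z * pw (- k%:Z).
  move=> sf; apply: le_trans (step_window iT hok fp J sf) _.
  by rewrite -mulrA -pwD ler_wpM2l ?l1_ge0// pw_le//; lia.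
move=> q'; rewrite inE => /orP[/eqP ->|q'F]; last exact: HT.
exists k; split=> [y sy yY|n Nn].
  apply: le_trans (ex y _) _; first by apply: leq_trans sy _.
  apply: le_trans (k1P k _); last by rewrite /k; lia.
  rewrite !ler_wpM2r ?pw_ge0//; exact: le_trans yY (ler_norm _).
have [nT|Tn] := leqP n (top T); last first.
  have := step_tail iT hok fp Tn (leq0n _) (leqnn J); rewrite addn0 => /le_trans; apply.
  by rewrite lerDr pnorm_ge0.
have -> : 'X^k * p n = q * p n + ('X^k - q) * p n by ring.
apply: le_trans (pnormD gp _ _ _) _; rewrite lerD2l.
apply: le_trans (ex _ _) _; first by rewrite gp.
apply: (@le_trans _ _ 1); last by rewrite -(@pw0 R) pw_le.
apply: le_trans (k2P k _); last by rewrite /k; lia.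
rewrite !ler_wpM2r ?pw_ge0//.
rewrite (future_agree fT)// /P1 (bigD1 (Ordinal (nT : (n < (top T).+1)%N)))//= lerDl.
by apply: sumr_ge0 => i _; exact: l1_ge0.
Qed.

End multiplier_steps.

Section round.
Context {R : realType}.
Local Notation C := (R[i]).
Implicit Types (g q f r : {poly C}) (S T : @state R) (p : nat -> {poly C}) (x : nat -> C).

Definition initial_poly x n : {poly C} := \poly_(i < n) x i.

Lemma comb_initial p x n : comb p (initial_poly x n) = \sum_(i < n) x i *: p i.
Proof.
rewrite (comb_widen _ (size_poly _ _)); apply: eq_bigr => i _.
by rewrite coef_poly ltn_ord.
Qed.

Lemma l1_comb_initial p x n (M : R) : (forall i, normc (x i) <= M) ->
  l1 0 (comb p (initial_poly x n)) <= \sum_(i < n) M * l1 0 (p i).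
Proof.
move=> xM; rewrite comb_initial; apply: le_trans (l1_sum _ _ _ _) _.
by apply: ler_sum => i _; rewrite l1Z ler_wpM2r ?l1_ge0.
Qed.

Lemma geometric_sum m : \sum_(i < m) pw (- (i : nat)%:Z) <= 2 :> R.
Proof.
suff -> : \sum_(i < m) pw (- (i : nat)%:Z) = 2 - 2 * pw (- m%:Z) :> R.
  by rewrite gerBl mulr_ge0 ?pw_ge0.
elim: m => [|m IH]; first by rewrite big_ord0 oppr0 pw0 mulr1 subrr.
rewrite big_ord_recr /= IH; have -> : pw (- m%:Z) = 2 * pw (- m.+1%:Z) :> R.
  by rewrite -pw1 -pwD; congr pw; lia.
by ring.
Qed.

(** A basis element of the block meets the degrees s <= N only through the term
    q X^(n-a), with the factor 2^((J+1)a) <= 2^((J+1)n). The coefficients x_n,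
    which decrease like 2^-((J+3)n), leave 2^(-2n) <= 2^-a 2^-n because n >= a.
    *)
Lemma block_low_coef S g J a n s : (0 < a)%N -> (s <= top S)%N -> (top S < n)%N ->
  normc (block (top S) g J a n)`_s * pw (- (J.+3 * n)%N%:Z) <=
  l1 0 g * pw (- a%:Z) * pw (- n%:Z).
Proof.
move=> a0 sS Sn; have sn : (s == n) = false by apply/negbTE; rewrite neq_ltn (leq_ltn_trans sS).
rewrite /block; case: ifP => [/andP[an _]|_]; rewrite coefZ ?coefB coefXn sn; last first.
  by rewrite mulr0 normc0 mul0r !mulr_ge0 ?l1_ge0 ?pw_ge0.
rewrite sub0r normcM normcN normc_cpw.
have cg : normc (g * 'X^(n - a))`_s <= l1 0 g.
  rewrite coefMXn; case: ifP => _; first by rewrite normc0 l1_ge0.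
  by have := l1_coef 0 g (s - (n - a)); rewrite mul0n pw0 mulr1.
rewrite mulrAC mulrC -pwD -[leRHS]mulrA -pwD.
apply: ler_pM => //; rewrite ?normc_ge0 ?pw_ge0//.
apply: pw_le; have : (J.+1 * a <= J.+1 * n)%N by rewrite leq_mul2l an orbT.
have -> : (J.+3 * n = J.+1 * n + n + n)%N by rewrite !mulSnr.
by lia.
Qed.

Section lower_bound.
Variables (S : @state R) (g : {poly C}) (J ka D a : nat) (p : nat -> {poly C}).
Variables (x : nat -> C) (M : R).
Hypothesis iS : admissible S.
Hypothesis hok : valid_step S g J ka D a.
Hypothesis gp : graded p.
Hypothesis ag : agree p (next_state S g J ka a).
Hypothesis xM : forall n, normc (x n) <= M * pw (- (J.+3 * n)%N%:Z).
Local Notation N := (top S).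
Local Notation N1 := (top (next_state S g J ka a)).

Lemma a_gt0 : (0 < a)%N. Proof. by case: hok => _ _ h; lia. Qed.

Lemma M_ge0 : 0 <= M.
Proof. by have := le_trans (normc_ge0 _) (xM 0); rewrite muln0 oppr0 pw0 mulr1. Qed.

(** Adding the elements of the block to the sum changes the low coefficients by
    O(2^-a) only. *)
Lemma initial_low_coef s : (s <= N)%N ->
  normc (comb p (initial_poly x N.+1))`_s <= normc (comb p (initial_poly x N1.+1))`_s
     + 2 * M * l1 0 g * pw (- a%:Z).
Proof.
move=> sN.
have NN1 : (N.+1 <= N1.+1)%N by rewrite ltnS ltnW// (top_next hok).
pose d n : C := if (n < N.+1)%N then 0 else x n.
have E : comb p (initial_poly x N1.+1) = comb p (initial_poly x N.+1) + \sum_(n < N1.+1) d n *: p n.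
  have -> : comb p (initial_poly x N.+1) =
     \sum_(n < N1.+1) (if (n < N.+1)%N then x n *: p n else 0).
    by rewrite comb_initial (big_ord_widen _ (fun i => x i *: p i) NN1) big_mkcond.
  rewrite comb_initial -big_split /=.
  by apply: eq_bigr => i _; rewrite /d; case: ifP => _; rewrite ?scale0r ?addr0 ?add0r.
have -> : (comb p (initial_poly x N.+1))`_s =
   (comb p (initial_poly x N1.+1))`_s - \sum_(n < N1.+1) d n * (p n)`_s.
  rewrite E coefD; apply/esym/eqP; rewrite subr_eq; apply/eqP; congr (_ + _).
  by rewrite coef_sum; apply: eq_bigr => n _; rewrite coefZ.
(* Only the elements of the block, N < n <= N1, contribute to the difference.
   *)
apply: le_trans (le_normcD _ _) _; rewrite normcN lerD2l.
apply: le_trans (normc_sum _ _ _) _.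
apply: (@le_trans _ _ (\sum_(n < N1.+1) M * l1 0 g * pw (- a%:Z) * pw (- (n : nat)%:Z))).
  apply: ler_sum => n _; rewrite /d; case: ltnP => nN.
    by rewrite mul0r normc0 !mulr_ge0 ?M_ge0 ?l1_ge0 ?pw_ge0.
  have nN1 : (n <= N1)%N by rewrite -ltnS.
  rewrite (agree_block ag); last by rewrite nN; exact: nN1.
  rewrite normcM; apply: le_trans (ler_wpM2r (normc_ge0 _) (xM n)) _.
  rewrite -!mulrA ler_wpM2l ?M_ge0// mulrC !mulrA.
  exact: block_low_coef a_gt0 sN nN.
rewrite -mulr_sumr; apply: le_trans (ler_wpM2l _ (geometric_sum _)) _.
  by rewrite !mulr_ge0 ?M_ge0 ?l1_ge0 ?pw_ge0.
by rewrite mulrC !mulrA.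
Qed.

(** The sum over n <= N has norm sum |x_n| in the basis p, comparable up to
    2^logbd with the norm of its coefficients; by [initial_low_coef] the block
    changes little. The bound depends on x only through M and the sum of |x_n|
    over n <= N, so that a single finite set of approximate inverses can serve
    all these x. *)
Lemma initial_lower_bound :
  \sum_(n < N.+1) normc (x n) * pw (- (logbd S)%:Z) <=
  \sum_(s < N.+1) normc (comb p (initial_poly x N1.+1))`_s
   + N.+1%:R * (2 * M * l1 0 g) * pw (- a%:Z).
Proof.
have [_ _ bS] := iS.
have agS := agree_next ag.
have h1 : \sum_(n < N.+1) normc (x n) = pnorm p 0 (comb p (initial_poly x N.+1)).
  rewrite /pnorm combK// (l1_widen _ (size_poly _ _)); apply: eq_bigr => n _.
  by rewrite coef_poly ltn_ord mul0n pw0 mulr1.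
have h2 : pnorm p 0 (comb p (initial_poly x N.+1)) <=
   (\sum_(s < N.+1) normc (comb p (initial_poly x N.+1))`_s) * pw (logbd S).
  have sz : (size (comb p (initial_poly x N.+1)) <= N.+1)%N by rewrite size_comb// size_poly.
  have -> : \sum_(s < N.+1) normc (comb p (initial_poly x N.+1))`_s = l1 0 (comb p (initial_poly x N.+1)).
    by rewrite (l1_widen _ sz); apply: eq_bigr => s _; rewrite mul0n pw0 mulr1.
  rewrite -{1}[comb p (initial_poly x N.+1)]mulr1; apply: pnormM => // i iN; rewrite mulr1.
  by apply: bS => //; rewrite -ltnS (leq_trans iN).
have h3 : \sum_(n < N.+1) normc (x n) * pw (- (logbd S)%:Z) <=
    \sum_(s < N.+1) normc (comb p (initial_poly x N.+1))`_s.
  rewrite -mulr_suml h1; apply: le_trans (ler_wpM2r (pw_ge0 _) h2) _.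
  by rewrite -mulrA [pw _ * pw _]mulrC pwNK mulr1.
apply: le_trans h3 _.
have h4 : \sum_(s < N.+1) normc (comb p (initial_poly x N.+1))`_s <=
    \sum_(s < N.+1) (normc (comb p (initial_poly x N1.+1))`_s + 2 * M * l1 0 g * pw (- a%:Z)).
  by apply: ler_sum => s _; apply: initial_low_coef; rewrite -ltnS.
apply: le_trans h4 _; rewrite big_split /= lerD2l sumr_const card_ord -[leLHS]mulr_natl.
by rewrite !mulrA.
Qed.

End lower_bound.

(** The three kinds of blocks are chosen in this order because each depends on
    the earlier ones: the finite set F on the elements of the first block, the
    constant 2^b' on the norms of the elements of F, and the polynomials of the
    last blocks on b and b'. On the tail n > N1 the factor 2^-b' compensates
    the norm of r. *)
Lemma round S J g (M e : R) : admissible S -> 0 < M -> 0 < e ->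
  exists T, reach S T /\ (top S < top T)%N /\ exists N1, (top S <= N1)%N /\
  forall p, future T p -> forall x,
  (forall n, normc (x n) <= M * pw (- (J.+3 * n)%N%:Z)) ->
  M^-1 <= \sum_(n < (top S).+1) normc (x n) ->
  exists c, pnorm p J ('X^c * comb p (initial_poly x N1.+1) - g) <= e /\
    forall n, (N1 < n)%N -> pnorm p J ('X^c * p n) <= 2 * pw ((3 * J + 4) * n)%N%:Z.
Proof.
move=> iS M0 e0; set N := top S.
have e4 : 0 < e / 4 by rewrite divr_gt0.
have e8 : 0 < e / 8 by rewrite divr_gt0.
(* First block, with q = g. The number a also makes the change of the low
   coefficients smaller than kappa. *)
have [kaA [a0 okA]] := @valid_step_exists R S g J (delay S) (leqnn _).
have [a1 a1P] := @pw_small R (pw (J * N)%N%:Z) _ e4.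
pose kappa := pw (- (logbd S)%:Z) / (2 * M).
have kappa0 : 0 < kappa by rewrite divr_gt0 ?pw_gt0 ?mulr_gt0.
have [a2 a2P] := @pw_small R (N.+1%:R * (2 * M * l1 0 g)) kappa kappa0.
pose a := (a0 + a1 + a2 + N)%N.
have hokA : valid_step S g J kaA (delay S) a by apply: okA; rewrite /a; clear; lia.
set S1 := next_state S g J kaA a; have iS1 : admissible S1 := admissible_next iS hokA.
set N1 := top S1; have NN1 : (N < N1)%N := top_next hokA.
pose Y := \sum_(n < N1.+1) M * l1 0 (pol S1 n).
pose P1 : R := pw ((J * N1)%N%:Z + (logbd S1)%:Z).
have P10 : 0 < P1 by exact: pw_gt0.
pose eta := e / (8 * (P1 + 1)).
have eta0 : 0 < eta by rewrite divr_gt0// mulr_gt0// addr_gt0.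
have [F [Q [D [FQ FP]]]] := finite_cover N N1.+1 N1.+1 Y kappa0 eta0.
(* Second block, with q = 2^b' dominating the norms of all r in F. The tail has
   to bear the shifts X^b X^(a-N) X^i for i below the degree of r, whence DB.
   *)
have [b' b'Q] := pw_large Q.
pose DB := (delay S1 + a + D)%N.
have dDB : (delay S1 <= DB)%N by rewrite /DB -addnA leq_addr.
have [kaB [b0 okB]] := @valid_step_exists R S1 (cpw b'%:Z)%:P J DB dDB.
have [b1 b1P] := @pw_small R (pw (J * N1)%N%:Z) _ e8.
have [b2 b2P] := @pw_small R (pw (J * N1)%N%:Z) 1 ltr01.
have [b3 b3P] := @pw_small R `|Q| _ e8.
pose b := (b0 + b1 + b2 + b3 + 2 * (a + N1.+1 + D))%N.
have hokB : valid_step S1 (cpw b'%:Z)%:P J kaB DB b by apply: okB; rewrite /b; clear; lia.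
set S2 := next_state S1 (cpw b'%:Z)%:P J kaB b.
have iS2 : admissible S2 := admissible_next iS1 hokB.
have N12 : (N1 <= top S2)%N := ltnW (top_next hokB).
(* The last blocks. By construction qr r y is close to X^a if r y is close to
   X^N. *)
pose qr r := cpw (- b'%:Z) *: ('X^b * ('X^(a - N) * r)).
have [T [S2T TP]] := power_steps [seq qr r | r <- F] J Y iS2 N12 e4.
have r1 := reach_one hokA; have r2 := reach_one hokB.
exists T; split; first exact: reach_trans r1 (reach_trans r2 S2T).
split; first exact: leq_trans NN1 (leq_trans N12 (reach_top S2T)).
exists N1; split; first exact: ltnW.
move=> p fT x xM xlow.
have f2 := reach_future S2T fT; have f1 := future_prev hokB f2.
have f0 := future_prev hokA f1; have gp := future_graded fT.
set y := comb p (initial_poly x N1.+1).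
have sy : (size y <= N1.+1)%N by rewrite size_comb// size_poly.
have yY : l1 0 y <= Y.
  apply: le_trans (l1_comb_initial p N1.+1 (M := M) _) _.
    move=> n; apply: le_trans (xM n) _; rewrite -[leRHS]mulr1 ler_wpM2l ?(ltW M0)//.
    by apply: pw_le1; rewrite oppr_le0.
  by apply: ler_sum => n _; rewrite (future_agree f1)// -ltnS.
have yk : kappa <= \sum_(s < N.+1) normc y`_s.
  have := initial_lower_bound iS hokA gp (future_agree f1) xM.
  rewrite -mulr_suml -/y -/N => h.
  have h1 := a2P a; have {}h1 : N.+1%:R * (2 * M * l1 0 g) * pw (- a%:Z) <= kappa.
    by apply: h1; rewrite /a; clear; lia.
  have h2 := ler_wpM2r (pw_ge0 (- (logbd S)%:Z)) xlow.
  have kE : M^-1 * pw (- (logbd S)%:Z) = kappa + kappa.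
    by rewrite /kappa; field; rewrite gt_eqF.
  rewrite kE in h2; lra.
have [r [err [h [rF rE eQ hQ [eD hD]]]]] := FP y yY sy yk.
have [rQ rD] := FQ r rF.
have [c [cy cn]] := TP p fT (qr r) (map_f _ rF).
exists c; split; last first.
  (* On the tail qr r costs 2^-b' |r| <= 1 times the bound of [step_tail]. *)
  move=> n Nn; apply: le_trans (cn n Nn) _; rewrite mulr_natl mulr2n lerD2r.
  rewrite /qr -scalerAl pnormZ// normc_cpw.
  have -> : 'X^b * ('X^(a - N) * r) * p n = r * ('X^(a - N) * ('X^b * p n)) by ring.
  apply: (@le_trans _ _ (pw (- b'%:Z) * (Q * pw ((3 * J + 4) * n)%N%:Z))).
    rewrite ler_wpM2l ?pw_ge0//.
    apply: le_trans (pnormM gp (B := pw ((3 * J + 4) * n)%N%:Z) _) _; last first.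
      by rewrite ler_wpM2r ?pw_ge0.
    move=> i ir; have -> : 'X^i * ('X^(a - N) * ('X^b * p n)) = 'X^(b + (i + (a - N))) * p n.
      by rewrite !exprD; ring.
    apply: (step_tail iS1 hokB f2) => //; rewrite /DB.
    have : (i <= D)%N by exact: leq_trans (ltnW ir) rD.
    by clear; lia.
  rewrite mulrA -[leRHS]mul1r ler_wpM2r ?pw_ge0//.
  by apply: le_trans (ler_wpM2l (pw_ge0 _) b'Q) _; rewrite pwNK.
have WB f : (size f <= N1.+1)%N ->
    pnorm p J (('X^b - (cpw b'%:Z)%:P) * f) <= l1 0 f * (pw (J * N1)%N%:Z * pw (- b%:Z)).
  move=> sf; apply: le_trans (step_window iS1 hokB f2 J sf) _.
  by rewrite -pwD ler_wpM2l ?l1_ge0// pw_le//; clear; lia.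
(* X^b multiplies low monomials by 2^b' up to a small error, and makes the
   others tiny. *)
have XB m : (m <= N1 + a + D.+1)%N -> pnorm p J 'X^(b + m) <= pw b'%:Z * (P1 + 1).
  move=> mD; have b'1 : 1 <= pw b'%:Z :> R by rewrite -(@pw0 R) pw_le.
  have [mN|Nm] := leqP m N1.
    have -> : 'X^(b + m) = (cpw b'%:Z) *: 'X^m + ('X^b - (cpw b'%:Z)%:P) * 'X^m :> {poly C}.
      by rewrite mulrBl mul_polyC exprD addrC subrK.
    apply: le_trans (pnormD gp _ _ _) _; rewrite pnormZ// normc_cpw mulrDr; apply: lerD.
      rewrite ler_wpM2l ?pw_ge0//.
      have [_ _ bS1] := iS1.
      apply: le_trans (pnorm_deg_pw gp J (n := N1) (a := (logbd S1)%:Z) _ _) _ => //.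
        by rewrite size_polyXn ltnS.
      by apply: bS1 => //; exact: future_agree f1.
    apply: le_trans (WB _ _) _; first by rewrite size_polyXn ltnS.
    rewrite l1_Xn mul0n pw0 mul1r mulr1; apply: le_trans b'1; apply: b2P.
    by rewrite /b; clear; lia.
  apply: le_trans (step_early iS1 hokB f2 J Nm _) _.
    by move: mD; rewrite /b; clear; lia.
  apply: (@le_trans _ _ 1); last first.
    rewrite -[X in X <= _]mulr1; apply: ler_pM => //.
    by rewrite lerDr ltW.
  apply: pw_le1; have : (J * (b + m) <= J * (2 * b))%N.
    by rewrite leq_mul2l; apply/orP; right; move: mD; rewrite /b; clear; lia.
  by clear; lia.
have hS m : (N1 < m <= N1 + a + D.+1)%N -> pnorm p J 'X^(b + m) <= pw (- b%:Z).
  move=> /andP[Nm mD]; apply: le_trans (step_early iS1 hokB f2 J Nm _) _.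
    by move: mD; rewrite /b; clear; lia.
  apply: pw_le; have : (J * (b + m) <= J * (2 * b))%N.
    by rewrite leq_mul2l; apply/orP; right; move: mD; rewrite /b; clear; lia.
  by clear; lia.
have aN : (N <= a)%N by rewrite /a leq_addl.
have aN1 : (a <= N1)%N by rewrite /N1 /S1 /=; clear; lia.
(* The errors, besides that of X^c against qr r: t1 replaces 2^-b' X^b by 1, t2
   replaces X^a by g, t3 and t4 come from the error and from the multiple of
   X^(N1+1) in r y. *)
pose t1 := cpw (- b'%:Z) *: (('X^b - (cpw b'%:Z)%:P) * 'X^a) : {poly C}.
pose t2 := ('X^a - g) * 1.
pose t3 := cpw (- b'%:Z) *: (err * 'X^(b + (a - N))) : {poly C}.
pose t4 := cpw (- b'%:Z) *: (h * 'X^(b + (a - N + N1.+1))) : {poly C}.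
have E : 'X^c * y - g = ('X^c - qr r) * y + (t1 + t2 + t3 + t4).
  suff H : qr r * y = t1 + 'X^a + t3 + t4 by rewrite mulrBl H /t2; ring.
  rewrite /qr -scalerAl -!mulrA rE.
  have -> : t1 = cpw (- b'%:Z) *: ('X^b * 'X^a) - 'X^a.
    by rewrite /t1 mulrBl scalerBr mul_polyC scalerA cpwNK scale1r.
  rewrite subrK /t3 /t4 -!scalerDr; congr (_ *: _).
  have -> : 'X^a = 'X^(a - N) * 'X^N :> {poly C} by rewrite -exprD subnK.
  by rewrite !exprD; ring.
have n1 : pnorm p J t1 <= e / 8.
  rewrite /t1 pnormZ// normc_cpw.
  have h1 : pnorm p J (('X^b - (cpw b'%:Z)%:P) * 'X^a) <= e / 8.
    apply: le_trans (WB _ _) _; first by rewrite size_polyXn ltnS.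
    by rewrite l1_Xn mul0n pw0 mul1r; apply: b1P; rewrite /b; clear; lia.
  apply: le_trans h1; rewrite -[leRHS]mul1r ler_wpM2r ?pnorm_ge0//.
  by apply: pw_le1; rewrite oppr_le0.
have n2 : pnorm p J t2 <= e / 4.
  apply: le_trans (step_window iS hokA f1 J _) _; first by rewrite size_poly1.
  rewrite -(expr0 'X) l1_Xn mul0n pw0 mul1r; apply: le_trans (a1P a _); last first.
    by rewrite /a; clear; lia.
  by rewrite -pwD pw_le// /N; clear; lia.
have n3 : pnorm p J t3 <= e / 8.
  rewrite /t3 pnormZ// normc_cpw.
  have h1 : pnorm p J (err * 'X^(b + (a - N))) <= l1 0 err * (pw b'%:Z * (P1 + 1)).
    apply: pnormM => // i ie; rewrite -exprD addnCA; apply: XB.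
    by move: (leq_trans (ltnW ie) eD); clear -aN; lia.
  apply: (@le_trans _ _ (pw (- b'%:Z) * (eta * (pw b'%:Z * (P1 + 1))))).
    rewrite ler_wpM2l ?pw_ge0//; apply: le_trans h1 _.
    by rewrite ler_wpM2r ?mulr_ge0 ?pw_ge0// addr_ge0// ltW.
  have -> : pw (- b'%:Z) * (eta * (pw b'%:Z * (P1 + 1))) =
     pw (- b'%:Z) * pw b'%:Z * (eta * (P1 + 1)) by ring.
  rewrite pwNK mul1r /eta.
  by rewrite le_eqVlt; apply/orP; left; apply/eqP; field; rewrite gt_eqF// addr_gt0.
have n4 : pnorm p J t4 <= e / 8.
  rewrite /t4 pnormZ// normc_cpw.
  have h1 : pnorm p J (h * 'X^(b + (a - N + N1.+1))) <= l1 0 h * pw (- b%:Z).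
    apply: pnormM => // i ih; rewrite -exprD addnCA; apply: hS.
    by move: (leq_trans (ltnW ih) hD); clear -aN; lia.
  apply: (@le_trans _ _ (1 * (e / 8))); last by rewrite mul1r.
  apply: ler_pM; rewrite ?pw_ge0 ?pnorm_ge0//; first by apply: pw_le1; rewrite oppr_le0.
  apply: le_trans h1 _; apply: le_trans (b3P b _); last by rewrite /b; clear; lia.
  by rewrite ler_wpM2r ?pw_ge0//; exact: le_trans hQ (ler_norm _).
rewrite E; have h0 := cy y sy yY.
have g1 := pnormD gp J (('X^c - qr r) * y) (t1 + t2 + t3 + t4).
have g2 := pnormD gp J (t1 + t2 + t3) t4.
have g3 := pnormD gp J (t1 + t2) t3.
have g4 := pnormD gp J t1 t2.
by move: h0 g1 g2 g3 g4 n1 n2 n3 n4; clear -e0; lra.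
Qed.

End round.

(** * A basis in which multiplication by X has dense orbits *)

Section read_basis.
Context {R : realType}.
Local Notation C := (R[i]).

Definition state0 : @state R := State 1 1 0 (fun n => 'X^n).

Lemma admissible0 : admissible state0.
Proof.
split=> //; first by move=> n; rewrite size_polyXn.
move=> p gp ap i i1; have := pnorm_p gp 0 i.
by rewrite (ap i i1) /= mul0n => ->.
Qed.

Lemma invS_gt0 u : 0 < (u.+1%:R : R)^-1. Proof. by rewrite invr_gt0. Qed.

Definition net (d u : nat) : seq {poly C} :=
  projT1 (cid (@poly_net R d u%:R _ (invS_gt0 u))).

(** Stage s serves the norm J and the v-th point of a net for polynomials of
    size at most d and norm at most u. The last component is free, so that
    every instruction recurs at arbitrarily late stages. *)
Definition instruction (s : nat) : nat * {poly C} :=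
  if @unpickle (nat * nat * nat * nat * nat)%type s is Some (J, d, u, v, _) then (J, nth 0 (net d u) v) else (0%N, 0).

Lemma instruction_recurs J d u v s0 : exists2 s, (s0 <= s)%N &
  instruction s = (J, nth 0 (net d u) v).
Proof.
have [F Fi FK] : exists2 F : nat -> nat, injective F &
    forall w, @unpickle (nat * nat * nat * nat * nat)%type (F w) = Some (J, d, u, v, w).
  exists (fun w => pickle (J, d, u, v, w)) => [w w'|w]; last exact: pickleK.
  by move/(pcan_inj pickleK) => [].
(* Infinitely many distinct codes cannot all lie below s0. *)
have [w ws] : exists w, (s0 <= F w)%N.
  apply: contrapT => /forallNP H.
  have lt (w : 'I_s0.+1) : (F w < s0)%N by rewrite ltnNge; apply/negP; exact: H.
  pose f (w : 'I_s0.+1) : 'I_s0 := Ordinal (lt w).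
  have fi : injective f.
    move=> w w' E; have E' : F w = F w' by exact: (congr1 (@nat_of_ord s0) E).
    by apply: val_inj; exact: Fi E'.
  by have := leq_card f fi; rewrite !card_ord ltnn.
by exists (F w) => //; rewrite /instruction FK.
Qed.

Definition rapid_seq (x : nat -> C) :=
  forall k : nat, exists M : R, forall n, normc (x n) <= M * pw (- (k * n)%N%:Z).

(** At stage s the round is taken with M = s + 1 and precision 1/(s + 1), so
    that a given x satisfies its hypotheses at all late stages. *)
Lemma read_basis : exists p : nat -> {poly C}, graded p /\
  (forall j n, pnorm p j ('X * p n) <= pw (j + (2 * j + 1) * n)%N%:Z) /\
  forall x, rapid_seq x -> (exists n, x n != 0) ->
  forall J (g : {poly C}) (e : R) n0, 0 < e ->
  exists N c : nat, (n0 <= N)%N /\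
    pnorm p J ('X^c * comb p (initial_poly x N.+1) - g) <= e /\
    forall n, (N < n)%N -> pnorm p J ('X^c * p n) <= 2 * pw ((3 * J + 4) * n)%N%:Z.
Proof.
pose T := {S : @state R | admissible S}.
pose good s (S S' : T) := reach (sval S) (sval S') /\ (top (sval S) < top (sval S'))%N /\
  exists N1, (top (sval S) <= N1)%N /\
  forall p, future (sval S') p -> forall x,
  (forall n, normc (x n) <= s.+1%:R * pw (- ((instruction s).1.+3 * n)%N%:Z)) ->
  s.+1%:R^-1 <= \sum_(n < (top (sval S)).+1) normc (x n) ->
  exists c, pnorm p (instruction s).1 ('X^c * comb p (initial_poly x N1.+1) - (instruction s).2) <= s.+1%:R^-1 /\
    forall n, (N1 < n)%N -> pnorm p (instruction s).1 ('X^c * p n) <=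
      2 * pw ((3 * (instruction s).1 + 4) * n)%N%:Z.
have nxt s S : exists S', good s S S'.
  have M0 : 0 < s.+1%:R :> R by [].
  have e0 : 0 < s.+1%:R^-1 :> R by rewrite invr_gt0.
  have [S' [r [lt H]]] := round (instruction s).1 (instruction s).2 (svalP S) M0 e0.
  by exists (exist _ S' (reach_admissible r (svalP S))).
pose S := fix S n : T := if n is m.+1 then projT1 (cid (nxt m (S m)))
  else exist _ state0 admissible0.
have SP n : good n (S n) (S n.+1) by rewrite /=; case: (cid _).
have topS n : (n < top (sval (S n)))%N.
  by elim: n => // n IH; have [_ [lt _]] := SP n; exact: leq_ltn_trans IH lt.
pose p n := pol (sval (S n)) n.
have fut i : future (sval (S i)) p.
  apply: (@limit_future R (fun i => sval (S i))) => //.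
  - exact: admissible0.
  - by move=> n; have [] := SP n.
  - by move=> n; have [_ []] := SP n.
have f0 := fut 0%N; have gp := future_graded f0.
have ag := future_agree f0.
exists p; split=> //; split.
  move=> j n; have [n1|n1] := ltnP 1 n.
    have := future_small j admissible0 f0 n1 (leqnn 1); rewrite expr1 => /le_trans; apply.
    by apply: pw_le; rewrite lez_nat leq_addl.
  rewrite (ag n n1) /= -exprS; case: n n1 => [|[|//]] _.
    have := pnorm_p gp j 1; rewrite (ag 1%N)//= => ->; apply: pw_le; lia.
  (* X p_1 = X^2 is the first monomial beyond the initial state. *)
  have h : pnorm p 0 'X^2 <= pw (- (4 * 1)%N%:Z).
    exact: (future_tiny admissible0 f0 (i := 2)).
  apply: le_trans (pnorm_deg_pw gp j (n := 2) _ h) _; first by rewrite size_polyXn.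
  by apply: pw_le; lia.
move=> x xr [n1 xn1] J g e n0 e0.
have [M xM] := xr J.+3.
(* B turns the mesh of the net, measured on coefficients, into a distance in
   the norm J. *)
pose B := 1 + \sum_(i < size g) pnorm p J 'X^i.
have B1 : 1 <= B by rewrite lerDl; apply: sumr_ge0 => i _; exact: pnorm_ge0.
have e20 : 0 < e / 2 by rewrite divr_gt0.
have [u uP] : exists u : nat, l1 0 g <= u%:R /\ (u.+1%:R)^-1 * B <= e / 2.
  have k0 : 0 <= l1 0 g + B / (e / 2) + 1.
    by rewrite !addr_ge0 ?l1_ge0 ?divr_ge0//; lra.
  exists (Num.bound (l1 0 g + B / (e / 2) + 1)).
  have := archi_boundP k0; set b := Num.bound _ => hb.
  have b1 : l1 0 g <= b%:R.
    by apply: ltW; apply: le_lt_trans hb; rewrite -addrA lerDl addr_ge0 ?divr_ge0//; lra.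
  split=> //; rewrite mulrC ler_pdivrMr// -ler_pdivrMl//.
  have : B / (e / 2) <= b%:R.
    by apply: ltW; apply: le_lt_trans hb; have := l1_ge0 0 g; lra.
  by rewrite mulrC -natr1; lra.
have [ug uB] := uP.
have [g0 g0net [gg0 sg0]] : exists2 f, f \in net (size g) u &
    l1 0 (g - f) <= (u.+1%:R)^-1 /\ (size f <= size g)%N.
  by rewrite /net; case: cid => F /= FP; exact: FP.
have [v vE] : exists v, nth 0 (net (size g) u) v = g0.
  by exists (index g0 (net (size g) u)); rewrite nth_index.
have gg : pnorm p J (g0 - g) <= e / 2.
  rewrite -opprB pnormN// -[g - g0]mulr1.
  apply: le_trans (pnormM gp (B := B) _) _.
    move=> i ig; rewrite mulr1.
    have ig' : (i < size g)%N.
      apply: leq_trans ig _; apply: leq_trans (size_polyD _ _) _.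
      by rewrite size_polyN geq_max leqnn.
    rewrite /B (bigD1 (Ordinal ig'))//= addrCA lerDl addr_ge0//.
    by apply: sumr_ge0 => k _; exact: pnorm_ge0.
  apply: le_trans uB; rewrite ler_wpM2r//; lra.
have [k0 kP] : exists k0 : nat, forall s, (k0 <= s)%N ->
    [/\ M <= s.+1%:R, s.+1%:R^-1 <= normc (x n1) & s.+1%:R^-1 <= e / 2].
  have nx : 0 < normc (x n1) by rewrite normc_gt0.
  pose t := `|M| + (normc (x n1))^-1 + (e / 2)^-1.
  have t0 : 0 <= t by rewrite !addr_ge0 ?invr_ge0// ltW.
  exists (Num.bound t) => s hs; have ts : t <= s.+1%:R.
    apply: ltW; apply: lt_le_trans (archi_boundP t0) _.
    by rewrite ler_nat (leq_trans hs).
  have i1 : 0 <= (normc (x n1))^-1 by rewrite invr_ge0 ltW.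
  have i2 : 0 <= (e / 2)^-1 by rewrite invr_ge0 ltW.
  split.
  - by apply: le_trans ts; have := ler_norm M; rewrite /t; lra.
  - rewrite invf_ple ?posrE//; apply: le_trans ts; have := normr_ge0 M; rewrite /t; lra.
  - rewrite invf_ple ?posrE//; apply: le_trans ts; have := normr_ge0 M; rewrite /t; lra.
have [s ks sE] := instruction_recurs J (size g) u v (k0 + n0 + n1).
have [Ms xs es] := kP s (leq_trans (leq_addr _ _) (leq_trans (leq_addr _ _) ks)).
have [_ [_ [N1 [N1S H]]]] := SP s.
have sS := topS s.
have [|| c [c1 c2]] := H p (fut s.+1) x.
- by move=> n; rewrite sE /=; apply: le_trans (xM n) _; rewrite ler_wpM2r ?pw_ge0.
- have n1S : (n1 < (top (sval (S s))).+1)%N.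
    rewrite ltnS; apply: leq_trans (ltnW sS); apply: leq_trans ks; exact: leq_addl.
  rewrite (bigD1 (Ordinal n1S))//=; apply: le_trans xs _; rewrite lerDl.
  by apply: sumr_ge0 => i _; exact: normc_ge0.
exists N1, c; split.
  apply: leq_trans N1S; apply: leq_trans (ltnW sS); apply: leq_trans ks.
  by rewrite -addnA addnCA leq_addr.
rewrite sE /= vE in c1 c2; split=> //.
have -> : 'X^c * comb p (initial_poly x N1.+1) - g =
  ('X^c * comb p (initial_poly x N1.+1) - g0) + (g0 - g) by rewrite subrKA.
apply: le_trans (pnormD gp _ _ _) _; rewrite [e]splitr; apply: lerD => //.
exact: le_trans c1 es.
Qed.

End read_basis.

(** * Entire functions as coefficient sequences *)

Section entire_coefficients.
Context {R : realType}.
Local Notation C := (R[i]).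
Local Notation E := (entire_fun R).
Implicit Types (f g : E) (a b : nat -> C) (c d : {poly C}) (j k n : nat).

Lemma entire_holo f (z : C) : holo f z.
Proof. by case: f => f /= /asboolP; apply. Qed.

Lemma seminorm_mono j k f : (j <= k)%N -> seminorm j f <= seminorm k f.
Proof.
move=> jk; apply: seminorm_le => z zj; apply: seminorm_ub.
by apply: le_trans zj _; rewrite ler_nat.
Qed.

(** The expansions on the squares of half-side r agree by uniqueness. *)
Lemma taylor f : exists a, forall r : nat, (0 < r)%N ->
  (forall n, normc (a n) * r%:R ^+ n <= 4 * seminorm (2 * r) f) /\
  forall z : C, normc z <= r%:R / 2 -> forall M,
    normc (f z - \sum_(n < M) a n * z ^+ n) <= 8 * seminorm (2 * r) f * (normc z / r%:R) ^+ M.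
Proof.
have H (r : nat) : (0 < r)%N -> exists a,
  (forall n, normc (a n) * r%:R ^+ n <= 4 * seminorm (2 * r) f) /\
  forall z : C, normc z <= r%:R / 2 -> forall M,
    normc (f z - \sum_(n < M) a n * z ^+ n) <= 8 * seminorm (2 * r) f * (normc z / r%:R) ^+ M.
  move=> r0; have r0' : 0 < r%:R :> R by rewrite ltr0n.
  have [a aP] := taylor_square r0' (@entire_holo f); exists a; apply: aP => w wr.
  by apply: seminorm_ub; rewrite natrM.
have ex (r : nat) a : (0 < r)%N -> (forall z : C, normc z <= r%:R / 2 -> forall M,
    normc (f z - \sum_(n < M) a n * z ^+ n) <= 8 * seminorm (2 * r) f * (normc z / r%:R) ^+ M) ->
    expands f a.
  move=> r0 aP; exists (8 * seminorm (2 * r) f), (r%:R^-1), (r%:R / 2).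
  split; first by rewrite divr_gt0// ltr0n.
  by move=> z zr M; rewrite [_^-1 * _]mulrC; exact: aP.
have [a [_ a2]] := H 1%N isT; exists a => r r0.
have [b [b1 b2]] := H r r0.
by rewrite (expands_unique (ex 1%N a isT a2) (ex r b r0 b2)).
Qed.

Definition tcoef f : nat -> C := projT1 (cid (taylor f)).

Lemma tcoef_bound k n f : normc (tcoef f n) * pw (k * n)%N%:Z <= 4 * seminorm (2 * 2 ^ k) f.
Proof.
rewrite /tcoef; case: cid => a /= /(_ (2 ^ k)%N); rewrite expn_gt0 => /(_ isT)[+ _] => /(_ n).
by rewrite natrX -exprM pw_nat.
Qed.

Lemma tcoef_taylor k (z : C) M f : normc z <= k.+1%:R ->
  normc (f z - \sum_(n < M) tcoef f n * z ^+ n) <= 8 * seminorm (4 * k.+1) f * (1/2) ^+ M.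
Proof.
move=> zk; rewrite /tcoef; case: cid => a /= /(_ (2 * k.+1)%N isT)[_ H].
have zk' : normc z <= (2 * k.+1)%:R / 2 by rewrite natrM mulrAC divff// mul1r.
have := H z zk' M; rewrite mulnA => /le_trans; apply.
rewrite ler_wpM2l ?mulr_ge0 ?seminorm_ge0// lerXn2r ?nnegrE ?divr_ge0 ?normc_ge0//.
rewrite ler_pdivrMr; last by rewrite ltr0n muln_gt0.
by have -> : 1/2 * (2 * k.+1)%:R = k.+1%:R :> R by rewrite natrM; field.
Qed.

Lemma tcoef_expands f : expands f (tcoef f).
Proof.
exists (8 * seminorm 2 f), 1, (1/2); split; first by rewrite divr_gt0.
move=> z z1 M; rewrite /tcoef; case: cid => a /= /(_ 1%N isT)[_ /(_ z z1 M)].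
by rewrite divr1 mul1r.
Qed.

Lemma tcoef_rapid f : rapid_seq (tcoef f).
Proof.
move=> k; exists (4 * seminorm (2 * 2 ^ k) f) => n.
by apply: le_pwN; exact: tcoef_bound.
Qed.

Lemma tcoefD f g : tcoef (f + g) = (fun n => tcoef f n + tcoef g n).
Proof.
have H : expands (f + g) (fun n => tcoef f n + tcoef g n).
  exact: (expandsD (tcoef_expands f) (tcoef_expands g)).
exact: expands_unique (tcoef_expands _) H.
Qed.

Lemma tcoefZ (l : C) f : tcoef (l *: f) = (fun n => l * tcoef f n).
Proof.
have H : expands (l *: f) (fun n => l * tcoef f n) by exact: (expandsZ l (tcoef_expands f)).
exact: expands_unique (tcoef_expands _) H.
Qed.

Lemma entire_psum f : (f : C -> C) = psum (tcoef f).
Proof.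
apply/funext => z; apply/esym/csumE.
exists (8 * seminorm (4 * (Num.bound (normc z)).+1) f) => M.
apply: tcoef_taylor; apply: ltW; apply: lt_le_trans (archi_boundP (normc_ge0 z)) _.
by rewrite ler_nat.
Qed.

(** An entire function is the sum of its Taylor series. *)
Lemma tcoef_inj : injective tcoef.
Proof.
move=> f g fg; apply: val_inj.
by have := entire_psum f; rewrite fg -entire_psum.
Qed.

Lemma rapid_pw a : (forall k, exists B : R, forall n, normc (a n) * pw (k * n)%N%:Z <= B) ->
  rapid a.
Proof.
move=> H r r0; have [k rk] := pw_large r; have [B HB] := H k.
exists B => n; apply: le_trans (HB n); rewrite ler_wpM2l ?normc_ge0//.
rewrite pw_nat exprM; apply: lerXn2r; rewrite ?nnegrE ?exprn_ge0//.
Qed.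

Fact psum_entire a : rapid a -> (psum a : R[i]^o -> R[i]^o) \in entire R.
Proof. by move=> ha; apply/asboolP => z; exact: psum_holo. Qed.

Definition entire_of_coef a (ha : rapid a) : E := EntireFun (psum_entire ha).

Lemma tcoef_entire_of_coef a (ha : rapid a) : tcoef (entire_of_coef ha) = a.
Proof.
have H : expands (entire_of_coef ha) a by exact: expands_psum.
exact: expands_unique (tcoef_expands _) H.
Qed.

Lemma seminorm_entire_of_coef j a (ha : rapid a) (B : R) :
  (forall n, normc (a n) * (2 * j%:R) ^+ n <= B) -> seminorm j (entire_of_coef ha) <= 4 * B.
Proof. by move=> aB; apply: seminorm_le => z zj; exact: psum_normc_le aB zj. Qed.

Fact rapid_poly c : rapid (fun n => c`_n).
Proof.
apply: rapid_pw => k; exists (l1 k c) => n; exact: l1_coef.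
Qed.

Definition entire_of_poly c : E := entire_of_coef (rapid_poly c).

Lemma tcoef_entire_of_poly c n : tcoef (entire_of_poly c) n = c`_n. Proof. by rewrite tcoef_entire_of_coef. Qed.

Lemma sums_finite (u : nat -> C) N : (forall n, (N <= n)%N -> u n = 0) ->
  sums u (\sum_(n < N) u n).
Proof.
move=> uN; exists ((\sum_(n < N) normc (u n)) * 2 ^+ N) => M.
have [NM|MN] := leqP N M.
  rewrite -(subnKC NM) big_split_ord /= opprD addrA subrr add0r normcN big1.
    by rewrite normc0 !mulr_ge0 ?exprn_ge0 ?half_ge0// sumr_ge0// => i _; exact: normc_ge0.
  by move=> i _; rewrite uN// leq_addr.
rewrite -(subnKC (ltnW MN)) big_split_ord /= addrAC subrr add0r subnKC ?(ltnW MN)//.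
apply: le_trans (normc_sum _ _ _) _.
have h : \sum_(i < N - M) normc (u (M + i)%N) <= \sum_(n < N) normc (u n).
  rewrite -[in leRHS](subnKC (ltnW MN)) big_split_ord /= lerDr.
  by apply: sumr_ge0 => i _; exact: normc_ge0.
apply: le_trans h _; rewrite -mulrA -[leLHS]mulr1 ler_wpM2l//.
  by apply: sumr_ge0 => i _; exact: normc_ge0.
rewrite -(subnKC (ltnW MN)) exprD mulrAC -exprMn.
have -> : 2 * (1/2) = 1 :> R by field.
by rewrite expr1n mul1r exprn_ege1// ler1n.
Qed.

Lemma seminorm_entire_of_poly j c : seminorm j (entire_of_poly c) <= l1 j c.
Proof.
apply: seminorm_le => z zj; rewrite /= /psum (csumE (X := \sum_(i < size c) c`_i * z ^+ i)).
  apply: le_trans (normc_sum _ _ _) _; apply: ler_sum => i _.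
  rewrite normcM ler_wpM2l ?normc_ge0// normcX pw_nat exprM.
  apply: lerXn2r; rewrite ?nnegrE ?normc_ge0 ?exprn_ge0//.
  by apply: le_trans zj _; rewrite -natrX ler_nat ltnW// ltn_expl.
by apply: sums_finite => n cn; rewrite nth_default// mul0r.
Qed.

Definition taylor_poly f n : E := entire_of_poly (initial_poly (tcoef f) n).

Lemma seminorm_taylor_poly j n f :
  seminorm j.+1 (f - taylor_poly f n) <= 8 * seminorm (4 * j.+1) f * (1/2) ^+ n.
Proof.
apply: seminorm_le => z zj.
have -> : (f - taylor_poly f n) z = f z - \sum_(i < n) tcoef f i * z ^+ i; last exact: tcoef_taylor.
rewrite /taylor_poly; congr (_ - _); rewrite /= /psum.
rewrite (csumE (X := \sum_(i < n) (initial_poly (tcoef f) n)`_i * z ^+ i)).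
  by apply: eq_bigr => i _; rewrite coef_poly ltn_ord.
by apply: sums_finite => i ni; rewrite coef_poly ltnNge ni mul0r.
Qed.

End entire_coefficients.

(** * The operator *)

Section read_operator.
Context {R : realType}.
Local Notation C := (R[i]).
Local Notation E := (entire_fun R).
Variable p : nat -> {poly C}.
Hypothesis gp : graded p.
Hypothesis Xp : forall j n, pnorm p j ('X * p n) <= pw (j + (2 * j + 1) * n)%N%:Z.
Implicit Types (f g : E) (c : {poly C}) (j k n m : nat).

Let t n : {poly C} := coord p ('X * p n).

(** The coefficient of z^m in the image of f, z^n being sent to the polynomial
    with coefficients t n. *)
Definition image_coef f m : C := csum (fun n => tcoef f n * (t n)`_m).

(** A radius at which Cauchy's estimate yields the decrease 2^-((2j+2)n) of the
    coefficients, one factor 2^-n better than the growth 2^((2j+1)n) of the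
    images of the monomials z^n. *)
Let level j := (2 * 2 ^ (2 * j + 2))%N.

Lemma image_term_bound j f m n : normc (tcoef f n * (t n)`_m) <=
  4 * seminorm (level j) f * pw (j%:Z - (j * m)%N%:Z) * (1/2) ^+ n.
Proof.
rewrite normcM -pwN_half.
have h1 := le_pwN (tcoef_bound (2 * j + 2) n f).
have h2 := le_pwN (le_trans (l1_coef j (t n) m) (Xp j n)).
rewrite -pwD in h2.
apply: le_trans (ler_pM (normc_ge0 _) (normc_ge0 _) h1 h2) _.
rewrite -[leLHS]mulrA -[leRHS]mulrA -!pwD.
by rewrite ler_wpM2l ?mulr_ge0 ?seminorm_ge0// pw_le//; lia.
Qed.

Lemma image_sums f m : sums (fun n => tcoef f n * (t n)`_m) (image_coef f m).
Proof. by have [] := csumP (image_term_bound 0 f m). Qed.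

Lemma image_coef_bound j f m : normc (image_coef f m) * pw (j * m)%N%:Z <=
  16 * seminorm (level j) f * pw j%:Z.
Proof.
have [_ /(_ 0%N)] := csumP (image_term_bound j f m).
rewrite big_ord0 subr0 expr0 mulr1 => /(ler_wpM2r (pw_ge0 (j * m)%N%:Z))/le_trans; apply.
rewrite le_eqVlt; apply/orP; left; apply/eqP.
have -> : pw j%:Z = pw (j%:Z - (j * m)%N%:Z) * pw (j * m)%N%:Z :> R.
  by rewrite -pwD subrK.
by ring.
Qed.

Fact image_rapid f : rapid (image_coef f).
Proof.
apply: rapid_pw => k; exists (16 * seminorm (level k) f * pw k%:Z) => n.
exact: image_coef_bound.
Qed.

Definition read_op f : E := entire_of_coef (image_rapid f).

Fact read_op_linear : linear read_op.
Proof.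
move=> l f g; apply: tcoef_inj; rewrite tcoefD tcoefZ !tcoef_entire_of_coef.
apply/funext => m; apply: csumE.
have -> : (fun n => tcoef (l *: f + g) n * (t n)`_m) =
  (fun n => l * (tcoef f n * (t n)`_m) + tcoef g n * (t n)`_m).
  by apply/funext => n; rewrite tcoefD tcoefZ mulrDl mulrA.
by apply: sumsD; [apply: sumsZ|]; exact: image_sums.
Qed.

HB.instance Definition _ := GRing.isLinear.Build C E E *:%R read_op read_op_linear.

Lemma seminorm_read_op j f : seminorm j (read_op f) <=
  64 * pw j.+1%:Z * seminorm (level j.+1) f.
Proof.
have H n : normc (image_coef f n) * (2 * j%:R) ^+ n <= 16 * seminorm (level j.+1) f * pw j.+1%:Z.
  apply: le_trans (image_coef_bound j.+1 f n); rewrite ler_wpM2l ?normc_ge0//.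
  rewrite pw_nat exprM; apply: lerXn2r; rewrite ?nnegrE ?mulr_ge0 ?exprn_ge0//.
  by rewrite exprS ler_wpM2l// -natrX ler_nat ltnW// ltn_expl.
apply: le_trans (seminorm_entire_of_coef _ H) _; rewrite le_eqVlt; apply/orP; left; apply/eqP; ring.
Qed.

Lemma read_op_continuous : continuous (read_op : E -> E).
Proof.
move=> f A [[n e] /= e0 fA].
pose K : R := 64 * pw n.+1%:Z; have K0 : 0 < K by rewrite mulr_gt0 ?pw_gt0.
exists (level n.+1, e / K) => /=; first by rewrite divr_gt0.
move=> g fg; apply: fA => j /andP[j1 jn] /=.
apply: le_lt_trans (seminorm_mono _ jn) _.
rewrite -(raddfB read_op); apply: le_lt_trans (seminorm_read_op n _) _.
rewrite mulrC -ltr_pdivlMr//; apply: fg.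
by rewrite leqnn andbT /level muln_gt0 expn_gt0.
Qed.

Lemma iter_read_op_bound k j : exists K L, 0 <= K /\ forall f,
  seminorm j (iter k read_op f) <= K * seminorm L f.
Proof.
elim: k j => [|k IH] j; first by exists 1, j; split=> // f; rewrite mul1r.
have [K [L [K0 KL]]] := IH (level j.+1).
exists (64 * pw j.+1%:Z * K), L; split; first by rewrite !mulr_ge0 ?pw_ge0.
move=> f; rewrite iterS; apply: le_trans (seminorm_read_op j _) _.
by rewrite -!mulrA ler_wpM2l// ler_wpM2l ?pw_ge0.
Qed.

Lemma iter_read_opB k f g : iter k read_op (f - g) = iter k read_op f - iter k read_op g.
Proof. by elim: k => //= k ->; rewrite raddfB. Qed.

Lemma read_op_poly c : read_op (entire_of_poly c) = entire_of_poly (coord p ('X * comb p c)).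
Proof.
apply: tcoef_inj; rewrite !tcoef_entire_of_coef; apply/funext => m.
rewrite /image_coef (csumE (X := \sum_(n < size c) c`_n * (t n)`_m)); last first.
  have -> : (fun n => tcoef (entire_of_poly c) n * (t n)`_m) = (fun n => c`_n * (t n)`_m).
    by apply/funext => n; rewrite tcoef_entire_of_poly.
  by apply: sums_finite => n cn; rewrite nth_default// mul0r.
have -> : coord p ('X * comb p c) = \sum_(n < size c) c`_n *: t n.
  rewrite /comb mulr_sumr.
  rewrite coord_sum//; apply: eq_bigr => n _; by rewrite -scalerAr coordZ.
by rewrite coef_sum; apply: eq_bigr => n _; rewrite coefZ.
Qed.

(** On polynomials the operator is multiplication by X in the basis p. *)
Lemma iter_read_op_poly k c : iter k read_op (entire_of_poly c) = entire_of_poly (coord p ('X^k * comb p c)).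
Proof.
elim: k => [|k IH]; first by rewrite expr0 mul1r combK.
by rewrite iterS IH read_op_poly coordK// exprS mulrA.
Qed.

(** The tail is cut off at a large degree M. Up to M the estimate of X^k p_n
    applies term by term; beyond M the continuity of the fixed power k of the
    operator suffices. *)
Lemma tail_bound J k N f (K : R) : (0 < J)%N ->
  (forall n, (N < n)%N -> pnorm p J ('X^k * p n) <= 2 * pw ((3 * J + 4) * n)%N%:Z) ->
  (forall n, normc (tcoef f n) <= K * pw (- ((3 * J + 5) * n)%N%:Z)) ->
  seminorm J (iter k read_op (f - taylor_poly f N.+1)) <= 4 * K * (1/2) ^+ N.
Proof.
case: J => // J _ kN fK; apply/ler_addgt0Pl => e e0.
have K0 : 0 <= K by have := le_trans (normc_ge0 _) (fK 0%N); rewrite muln0 oppr0 pw0 mulr1.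
have [K1 [L [K10 KL]]] := iter_read_op_bound k J.+1.
have [m mP] := @pow_half_small R (K1 * (8 * seminorm (4 * L.+1) f)) e e0.
pose M := (N.+1 + m)%N.
have -> : f - taylor_poly f N.+1 = (f - taylor_poly f M) - (taylor_poly f N.+1 - taylor_poly f M).
  by rewrite opprB addrA subrK.
rewrite iter_read_opB; apply: le_trans (seminormD _ _ _) _; rewrite seminormN; apply: lerD.
  apply: le_trans (KL _) _; apply: le_trans mP; rewrite -!mulrA ler_wpM2l//.
  apply: le_trans (seminorm_mono _ (leqnSn L)) _; apply: le_trans (seminorm_taylor_poly _ _ _) _.
  rewrite -!mulrA !ler_wpM2l ?seminorm_ge0// -!pwN_half pw_le// /M; lia.
have -> : taylor_poly f N.+1 - taylor_poly f M = entire_of_poly (- \sum_(i < m) tcoef f (N.+1 + i)%N *: 'X^(N.+1 + i)).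
  apply: tcoef_inj; rewrite tcoefD -scaleN1r tcoefZ; apply/funext => n.
  rewrite !tcoef_entire_of_poly coefN coef_sum mulN1r; apply/eqP; rewrite subr_eq; apply/eqP.
  rewrite addrC; apply/eqP; rewrite eq_sym subr_eq eq_sym; apply/eqP.
  have -> : \sum_(i < m) (tcoef f (N.+1 + i)%N *: 'X^(N.+1 + i))`_n =
     (\poly_(i < M) tcoef f i)`_n - (\poly_(i < N.+1) tcoef f i)`_n.
    have := poly_def M (tcoef f); rewrite /M big_split_ord /= -poly_def => ->.
    by rewrite coefD addrC addKr coef_sum.
  by rewrite addrC subrK.
rewrite iter_read_op_poly; apply: le_trans (seminorm_entire_of_poly _ _) _.
rewrite -/(pnorm p J.+1 _).
have -> : 'X^k * comb p (- \sum_(i < m) tcoef f (N.+1 + i)%N *: 'X^(N.+1 + i)) =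
   - \sum_(i < m) tcoef f (N.+1 + i)%N *: ('X^k * p (N.+1 + i)%N).
  rewrite -scaleN1r combZ// scaleN1r comb_sum// mulrN mulr_sumr; congr (- _).
  by apply: eq_bigr => i _; rewrite combZ// combXn -scalerAr.
rewrite pnormN//; apply: le_trans (pnorm_sum _ _ _ _ _) _ => //.
apply: (@le_trans _ _ (\sum_(i < m) (2 * K * (1/2) ^+ N) * pw (- (i : nat)%:Z))).
  apply: ler_sum => i _; rewrite pnormZ//.
  apply: le_trans (ler_pM (normc_ge0 _) (pnorm_ge0 _ _ _) (fK _) (kN _ _)) _.
    by rewrite ltnS leq_addr.
  have sw (u v : R) : K * u * (2 * v) = 2 * K * (u * v) by ring.
  rewrite sw -pwN_half -[leRHS]mulrA -!pwD ler_wpM2l ?mulr_ge0// pw_le//; lia.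
rewrite -mulr_sumr; apply: le_trans (ler_wpM2l _ (geometric_sum m)) _.
  by rewrite !mulr_ge0 ?exprn_ge0 ?half_ge0.
by rewrite le_eqVlt; apply/orP; left; apply/eqP; ring.
Qed.

Hypothesis orbits : forall x, rapid_seq x -> (exists n, x n != 0) ->
  forall J (g : {poly C}) (e : R) n0, 0 < e ->
  exists N c : nat, (n0 <= N)%N /\
    pnorm p J ('X^c * comb p (initial_poly x N.+1) - g) <= e /\
    forall n, (N < n)%N -> pnorm p J ('X^c * p n) <= 2 * pw ((3 * J + 4) * n)%N%:Z.

(** The target h is replaced by a Taylor polynomial and f is split into a
    Taylor polynomial, which is moved close to the target, and a tail, whose
    image is small. *)
Lemma read_op_orbit f h J (e : R) : f != 0 -> 0 < e ->
  exists k, seminorm J.+1 (h - iter k read_op f) < e.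
Proof.
move=> f0 e0; have e4 : 0 < e / 4 by rewrite divr_gt0.
have [m mP] := @pow_half_small R (8 * seminorm (4 * J.+1) h) _ e4.
have fn0 : exists n, tcoef f n != 0.
  apply: contrapT => /forallNP H; move/eqP: f0; apply; apply: tcoef_inj; apply/funext => n.
  have := H n; move/negP; rewrite negbK => /eqP ->.
  have -> : (0 : E) = (0 : C) *: (0 : E) by rewrite scale0r.
  by rewrite tcoefZ mul0r.
have [K fK] := tcoef_rapid f (3 * J.+1 + 5).
have [n0 n0P] := @pow_half_small R (4 * K) _ e4.
have K0 : 0 <= K by have := le_trans (normc_ge0 _) (fK 0%N); rewrite muln0 oppr0 pw0 mulr1.
have [N [k [n0N [kg kN]]]] :=
  orbits (tcoef_rapid f) fn0 J.+1 (comb p (initial_poly (tcoef h) m)) n0 e4.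
exists k.
have -> : h - iter k read_op f = (h - taylor_poly h m)
   + (taylor_poly h m - iter k read_op (taylor_poly f N.+1)) - iter k read_op (f - taylor_poly f N.+1).
  by rewrite iter_read_opB subrKA opprB subrKA.
apply: (@le_lt_trans _ _ (e / 4 + e / 4 + e / 4)); last by lra.
apply: le_trans (seminormD _ _ _) _; rewrite seminormN; apply: lerD; last first.
  apply: le_trans (tail_bound _ kN fK) _ => //; apply: le_trans n0P.
  by rewrite ler_wpM2l ?mulr_ge0// -!pwN_half pw_le//; lia.
apply: le_trans (seminormD _ _ _) _; apply: lerD.
  exact: le_trans (seminorm_taylor_poly _ _ _) mP.
rewrite /taylor_poly iter_read_op_poly -seminormN opprB.
have -> : entire_of_poly (coord p ('X^k * comb p (initial_poly (tcoef f) N.+1))) - entire_of_poly (initial_poly (tcoef h) m) =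
   entire_of_poly (coord p ('X^k * comb p (initial_poly (tcoef f) N.+1) - comb p (initial_poly (tcoef h) m))).
  apply: tcoef_inj; rewrite tcoefD -scaleN1r tcoefZ; apply/funext => n.
  by rewrite !tcoef_entire_of_poly -[- comb p _]scaleN1r coordD// coordZ// combK// coefD coefZ.
exact: le_trans (seminorm_entire_of_poly _ _) kg.
Qed.

Lemma read_op_no_invariant : ~ has_nontrivial_invariant_subset (read_op : E -> E).
Proof.
move=> [M [[f0 Mf0] cM M0 MT TM]]; apply: MT; apply/seteqP; split => // h _.
have [f Mf fN0] : exists2 f, M f & f != 0.
  apply: contrapT => H; apply: M0; apply/seteqP; split => [g Mg /=|g /= ->].
    by apply/eqP; apply: contrapT => /negP gN; apply: H; exists g.
  have [<-|f0N] := eqVneq f0 0 => //.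
  by case: H; exists f0.
have orbM k : M (iter k read_op f).
  by elim: k => // k IH; apply: TM; exists (iter k read_op f).
apply: cM => B [[n e] /= e0 hB].
have [k hk] := read_op_orbit h n fN0 e0.
exists (iter k read_op f); split; first exact: orbM.
apply: hB => j /andP[_ jn]; apply: le_lt_trans hk; apply: seminorm_mono.
exact: leq_trans jn (leqnSn n).
Qed.

End read_operator.

Theorem corollary3p9 (R : realType) :
  ~ invariant_subset_property (entire_fun R).
Proof.
have [p [gp [Xp orbits]]] := @read_basis R.
move=> /(_ (read_op Xp))/(_ (@read_op_continuous R p Xp)).
exact: read_op_no_invariant orbits.
Qed.
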